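(* Let $\pi=(d_{\max},\ldots,d_{\min})$ be a graphic sequence with $n$ elements (listed in nonincreasing order, with largest element $d_{\max}$ and smallest element $d_{\min}$), where $d_{\max}\leq n/6$, $d_{\min}\geq 2$, and each value appearing in $\pi$ appears more than once. Let $c$ be the sum of the distinct integers between $1$ and $d_{\max}$ which do not appear in $\pi$. Then $\pi$ has a connected realization $G$ such that \[ \lambda_{1}(G)\leq\frac{2c}{|E(G)|-d_{\max}/2}, \] where $|E(G)|$ is the number of edges of $G$.
   Context: All graphs are finite, without loops or multiple edges. A sequence $\pi=(d_1,\ldots,d_n)$ of nonnegative integers is graphic if there is a graph with $n$ vertices whose vertex degrees are $d_1,\ldots,d_n$; such a graph is a realization of $\pi$. For a graph $G$ with adjacency matrix $A$ and diagonal degree matrix $D$, the normalized Laplacian is $L=D^{-1}A-I$; its eigenvalues are real and nonpositive, written $-\lambda_0,-\lambda_1,\ldots$ with $0=\lambda_0\leq\lambda_1\leq\cdots$, and $\lambda_1(G)$ denotes the smallest nontrivial such value (the spectral gap). *)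

(* Defs.v *)
From HB Require Import structures.
From mathcomp Require Import all_boot all_order all_algebra.
From mathcomp Require Import polyrcf.
From mathcomp Require Import reals.
Set Implicit Arguments. Unset Strict Implicit. Unset Printing Implicit Defensive.
Import Order.TTheory GRing.Theory Num.Theory.
Local Open Scope ring_scope.

Definition simple_graph (n : nat) (e : rel 'I_n) : Prop :=
  (forall i j, e i j = e j i) /\ (forall i, e i i = false).

Definition deg (n : nat) (e : rel 'I_n) (i : 'I_n) : nat := #|[set j | e i j]|.

Definition nedges (n : nat) (e : rel 'I_n) : nat :=
  #|[set p : 'I_n * 'I_n | e p.1 p.2 && (p.1 < p.2)%N]|.

Definition connected_graph (n : nat) (e : rel 'I_n) : Prop :=
  forall i j : 'I_n, connect e i j.

Definition realizes (n : nat) (d : seq nat) (e : rel 'I_n) : Prop :=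
  simple_graph e /\ size d = n /\ forall i : 'I_n, deg e i = nth 0%N d i.

Definition graphic (d : seq nat) : Prop :=
  exists e : rel 'I_(size d), realizes d e.

(* Adjacency matrix, and the matrix I - D^{-1} A  (= - L where
   L = D^{-1}A - I is the normalized Laplacian of the paper). *)
Definition adjmx (R : ringType) (n : nat) (e : rel 'I_n) : 'M[R]_n :=
  \matrix_(i, j) (e i j)%:R.

Definition negLap (R : fieldType) (n : nat) (e : rel 'I_n) : 'M[R]_n :=
  \matrix_(i, j) ((i == j)%:R - (e i j)%:R / (deg e i)%:R).

(* Real eigenvalues of a real matrix, listed in nondecreasing order with
   algebraic multiplicity. *)
Definition spectrum (R : rcfType) (n : nat) (M : 'M[R]_n) : seq R :=
  let p := char_poly M in flatten [seq nseq (mup x p) x | x <- rootsR p].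

(* lambda_k(G): eigenvalues of L are -lambda_0, -lambda_1, ... with
   0 = lambda_0 <= lambda_1 <= ... *)
Definition lambda (R : rcfType) (n : nat) (e : rel 'I_n) (k : nat) : R :=
  nth 0 (spectrum (negLap R e)) k.

Definition lambda1 (R : rcfType) (n : nat) (e : rel 'I_n) : R := lambda R e 1.

(* Main.v *)
Require Import Defs.
From HB Require Import structures.
From mathcomp Require Import all_boot all_order all_algebra zify ring lra.
From mathcomp Require Import complex polyrcf reals.
Import Order.TTheory GRing.Theory Num.Theory.
Local Open Scope ring_scope.

(** Split the vertices into two halves (even and odd positions of the sorted
    sequence) so that every degree occurs on both sides; the indicator of one
    half bounds lambda_1 by a cut ratio, so it is enough to find a connected
    realization with at most c edges across.

    Among loopless digraphs with these in- and out-degrees take one with the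
    fewest crossing arcs. Its residual graph has no negative cycle, which gives
    an integral potential w on the vertices certifying optimality: pairs with
    large w-sum are arcs, pairs with small w-sum are not. Counting degrees
    through the few vertices of large w bounds the number of crossing arcs by
    the sum of the missing degrees. The asymmetric arcs form a balanced digraph
    on tight pairs; two-colouring its closed trails turns the digraph into a
    graph at the cost of at most one more crossing edge. If c = 1 the halves are
    chosen with odd volume, so that the number of crossing edges is odd, hence
    equal to 1. Edge switches with non-bridges then make the graph connected.
    When all degrees are 2 the cycle is used instead, with a tent function as
    test function. *)

(** Digraphs replace graphs because minimizing crossing arcs under prescribed out- and in-degrees is
    a transportation problem between tails and heads: its integral optimum is certified by
    shortest-path potentials. For graphs the same question is a matching problem with odd-cycle
    obstructions. These reappear as the odd closed trails of the symmetrization, where the potential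
    confines their degree errors to zeros of [w]. The edge possibly added by symmetrization must be
    regained in the count, since the budget of c edges is already used up by the missing degrees.
    This is where the bound d_max <= n/6 enters: each half has vertices to spare beyond those of
    large w and those representing the degrees, and every pair of spares, having degree at least 2,
    lowers the count. For c = 1 there is no room for the two edges that a switch between the halves
    creates, so an empty cut cannot be repaired; hence the recourse to parity. *)

Set Implicit Arguments. Unset Strict Implicit. Unset Printing Implicit Defensive.

(** * Potentials of weighted digraphs *)

Section Potential.
Variables (T : finType) (r : rel T) (w : T -> T -> int).

Fixpoint walk_cost (x : T) (p : seq T) : int :=
  if p is y :: p' then w x y + walk_cost y p' else 0.

Lemma walk_cost_cat x p q :
  walk_cost x (p ++ q) = walk_cost x p + walk_cost (last x p) q.
Proof. by elim: p x => [|y p IHp] x /=; rewrite ?add0r // IHp addrA. Qed.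

Lemma walk_cost_rcons x p y :
  walk_cost x (rcons p y) = walk_cost x p + w (last x p) y.
Proof. by rewrite -cats1 walk_cost_cat /= addr0. Qed.

(** Bounding the length by [#|T|] makes the simple walks a finite type, so a cheapest one can be
    chosen. The start is left free, which amounts to an extra source joined to every vertex at cost
    0. *)
Let simple_walk_to (y : T) (s : #|T|.-bseq T) : bool :=
  if val s is x :: p then [&& path r x p, uniq (x :: p) & last x p == y]
  else false.

Let bseq_cost (s : #|T|.-bseq T) : int :=
  if val s is x :: p then walk_cost x p else 0.

(** The potential of [y] is the least cost of a simple walk ending at [y]. A cheapest walk to [x]
    followed by the step to [y] competes for [y], unless [y] already lies on it; then the part from
    [y] on closes to a cycle of nonnegative cost, and the prefix ending at [y] competes instead. *)
Lemma potential_exists :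
  (forall x p, uniq (x :: p) -> path r x (rcons p x) ->
     0 <= walk_cost x (rcons p x)) ->
  exists pi : T -> int, forall x y, r x y -> pi y <= pi x + w x y.
Proof.
move=> nonneg.
have sizeT (x : T) p : uniq (x :: p) -> (size (x :: p) <= #|T|)%N.
  by move=> U; rewrite -(card_uniqP U) max_card.
pose start y : #|T|.-bseq T := Bseq (sizeT y [::] isT).
pose best y := [arg min_(s < start y | simple_walk_to y s) bseq_cost s]%O.
have startP y : simple_walk_to y (start y) by rewrite /simple_walk_to /= eqxx.
have bestP y x (p : seq T) : path r x p -> uniq (x :: p) -> last x p = y ->
    bseq_cost (best y) <= walk_cost x p.
  move=> rp up ly; rewrite /best; case: arg_minP => // s _ /(_ (Bseq (sizeT _ _ up))).
  by apply; rewrite /simple_walk_to /= rp ly eqxx; move: up => /= ->.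
have bestE x : exists x0 p, [/\ path r x0 p, uniq (x0 :: p), last x0 p = x &
    bseq_cost (best x) = walk_cost x0 p].
  rewrite /best; case: arg_minP => // [[[|x0 p] /= sz]]; rewrite /simple_walk_to //=.
  by case/and3P=> rp up /eqP lx _; exists x0, p.
exists (fun y => bseq_cost (best y)) => x y rxy.
have [x0 [p [rp up lx ->]]] := bestE x.
have [yin|yout] := boolP (y \in x0 :: p); last first.
  rewrite -[in X in _ + X]lx -walk_cost_rcons; apply: bestP.
  - by rewrite rcons_path rp lx.
  - by rewrite -rcons_cons rcons_uniq yout.
  - by rewrite last_rcons.
move: yin; rewrite inE => /orP [/eqP ey|yp].
  subst x0; have := nonneg y p up; rewrite rcons_path rp lx rxy => /(_ isT).
  rewrite walk_cost_rcons lx => H.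
  have := @bestP y y [::] isT isT erefl => /= H'; lia.
case/splitPr: p / yp rp up lx => p1 p2 rp up lx.
move: rp; rewrite cat_path /= => /and3P [rp1 ry rp2].
move: lx; rewrite last_cat /= => lx.
have U2 : uniq (y :: p2) by move: up; rewrite -cat_cons cat_uniq => /and3P [].
have := nonneg y p2 U2; rewrite rcons_path rp2 lx rxy => /(_ isT).
rewrite walk_cost_rcons lx => H.
have : bseq_cost (best y) <= walk_cost x0 (rcons p1 y).
  apply: bestP; rewrite ?last_rcons //; first by rewrite rcons_path rp1.
  by move: up; rewrite -cat_cons -cat_rcons cat_uniq => /and3P [].
rewrite walk_cost_rcons walk_cost_cat /=; lia.
Qed.

Lemma walk_cost_cycle x p : uniq (x :: p) ->
  walk_cost x (rcons p x) = \sum_(z <- x :: p) w z (next (x :: p) z).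
Proof.
move=> U.
have H (y : T) q s : uniq (y :: q) -> walk_cost y (rcons q s) =
    \sum_(z <- y :: q) w z (next_at z s y q).
  elim: q y => [|a q IHq] y /=.
    by rewrite big_cons big_nil eqxx.
  rewrite inE negb_or -andbA => /and3P [ya yq U'].
  rewrite big_cons eqxx IHq //; congr (_ + _).
  apply: eq_big_seq => z zin /=; case: eqP => // ezy.
  by move: zin; rewrite ezy inE (negPf ya) (negPf yq).
by rewrite H.
Qed.
End Potential.

(** * Digraphs with the fewest crossing arcs *)

Section Digraph.
Variables (V : finType) (side : V -> bool) (dg : V -> nat).
Implicit Types (Z : {set V * V}) (u v : V).

Definition outn Z u := #|[set v | (u, v) \in Z]|.
Definition inn Z v := #|[set u | (u, v) \in Z]|.
Definition cross u v := side u != side v.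
Definition realizes_digraph Z :=
  [forall v, [&& outn Z v == dg v, inn Z v == dg v & (v, v) \notin Z]].
Definition cross_count Z : nat := (\sum_(e in Z) cross e.1 e.2)%N.

Lemma realizes_digraphP Z : reflect
  [/\ forall v, outn Z v = dg v, forall v, inn Z v = dg v &
      forall v, (v, v) \notin Z] (realizes_digraph Z).
Proof.
apply: (iffP forallP) => [H|[H1 H2 H3] v].
  by split=> v; have /and3P [/eqP ? /eqP ? ?] := H v.
by rewrite H1 H2 H3 !eqxx.
Qed.

Lemma card_exchange (T : finType) (N R A : {set T}) :
  R \subset N -> [disjoint A & N] -> #|R| = #|A| -> #|(N :\: R) :|: A| = #|N|.
Proof.
move=> sRN dAN eqRA; rewrite cardsU.
have -> : (N :\: R) :&: A = set0.
  apply/setP=> x; rewrite !inE; apply/negP => /andP [/andP [_ xN] xA].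
  by move/disjointFr: dAN => /(_ _ xA); rewrite xN.
rewrite cards0 subn0 cardsD (setIidPr sRN) eqRA subnK // -eqRA.
exact: subset_leq_card.
Qed.

(** * Cycles of the residual graph *)

Section Residual.
Variable Z : {set V * V}.

(** [inl u] is [u] as a tail and [inr v] is [v] as a head. A step from tail to head inserts an arc,
    a step back deletes one, and [res_cost] is the resulting change in the number of crossing
    arcs. *)
Definition res_rel : rel (V + V) := fun x y =>
  match x, y with
  | inl u, inr v => (u != v) && ((u, v) \notin Z)
  | inr v, inl u => (u, v) \in Z
  | _, _ => false
  end.

Definition res_cost (x y : V + V) : int :=
  match x, y with
  | inl u, inr v => (cross u v : nat)%:Z
  | inr v, inl u => - (cross u v : nat)%:Z
  | _, _ => 0
  end.

Variables (cyc : seq (V + V)).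
Hypotheses (Ucyc : uniq cyc) (Rcyc : cycle res_rel cyc).

Definition res_add : {set V * V} :=
  [set e | (inl e.1 \in cyc) && (next cyc (inl e.1) == inr e.2)].
Definition res_rem : {set V * V} :=
  [set e | (inr e.2 \in cyc) && (next cyc (inr e.2) == inl e.1)].
Definition res_flip := (Z :\: res_rem) :|: res_add.

Lemma res_next_row u : inl u \in cyc ->
  exists v, [/\ next cyc (inl u) = inr v, u != v & (u, v) \notin Z].
Proof.
move=> uc; have := next_cycle Rcyc uc.
by case: (next cyc (inl u)) => //= v /andP [uv nZ]; exists v.
Qed.

Lemma res_next_col v : inr v \in cyc ->
  exists2 u, next cyc (inr v) = inl u & (u, v) \in Z.
Proof.
move=> vc; have := next_cycle Rcyc vc.
by case: (next cyc (inr v)) => //= u uZ; exists u.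
Qed.

Lemma res_prev_row u : inl u \in cyc ->
  exists v, [/\ inr v \in cyc, next cyc (inr v) = inl u & (u, v) \in Z].
Proof.
move=> uc; have := prev_cycle Rcyc uc; have := next_prev Ucyc (inl u).
have : prev cyc (inl u) \in cyc by rewrite mem_prev.
by case: (prev cyc (inl u)) => //= v vc nv uZ; exists v.
Qed.

Lemma res_prev_col v : inr v \in cyc ->
  exists u, [/\ inl u \in cyc & next cyc (inl u) = inr v].
Proof.
move=> vc; have := prev_cycle Rcyc vc; have := next_prev Ucyc (inr v).
have : prev cyc (inr v) \in cyc by rewrite mem_prev.
by case: (prev cyc (inr v)) => //= u uc nu _; exists u.
Qed.

Lemma next_inj x y : x \in cyc -> y \in cyc -> next cyc x = next cyc y -> x = y.
Proof. by move=> _ _ /(congr1 (prev cyc)); rewrite !(prev_next Ucyc). Qed.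

Lemma res_add_notin e : e \in res_add -> e.1 != e.2 /\ e \notin Z.
Proof.
case: e => u v; rewrite inE /= => /andP [uc /eqP nu].
by have [v' []] := res_next_row uc; rewrite nu => -[<-].
Qed.

Lemma res_rem_sub : res_rem \subset Z.
Proof.
apply/subsetP=> -[u v]; rewrite inE /= => /andP [vc /eqP nv].
by have [u'] := res_next_col vc; rewrite nv => -[<-].
Qed.

(** A simple cycle through [inl u] arrives by deleting one arc out of [u] and departs by inserting
    another; a cycle that avoids [inl u] touches no arc out of [u]. *)
Lemma outn_flip u : outn res_flip u = outn Z u.
Proof.
rewrite /outn.
pose A := [set v | (u, v) \in res_add]; pose R := [set v | (u, v) \in res_rem].
have -> : [set v | (u, v) \in res_flip] = ([set v | (u, v) \in Z] :\: R) :|: A.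
  by apply/setP=> v; rewrite !inE.
apply: card_exchange.
- by apply/subsetP=> v; rewrite [v \in R]inE [v \in [set _ | _]]inE => /(subsetP res_rem_sub).
- rewrite disjoint_subset; apply/subsetP=> v; rewrite [v \in A]inE => /res_add_notin [_].
  by rewrite !inE.
have [uc|uc] := boolP (inl u \in cyc).
  have [v [nv _ _]] := res_next_row uc; have [v' [vc' nv' _]] := res_prev_row uc.
  have -> : A = [set v].
    by apply/setP=> x; rewrite !inE /= uc nv /= eq_sym.
  have -> : R = [set v'].
    apply/setP=> x; rewrite !inE /=; apply/andP/eqP => [[xc /eqP nx]|-> //].
      by have [] : inr x = inr v' :> V + V by apply: next_inj; rewrite // nx nv'.
    by split=> //; apply/eqP.
  by rewrite !cards1.
have -> : A = set0 by apply/setP=> x; rewrite !inE /= (negPf uc).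
have -> // : R = set0.
apply/setP=> x; rewrite !inE /=; apply/negP=> /andP [xc /eqP nx].
by move: uc; rewrite -nx mem_next xc.
Qed.

Lemma inn_flip v : inn res_flip v = inn Z v.
Proof.
rewrite /inn.
pose A := [set u | (u, v) \in res_add]; pose R := [set u | (u, v) \in res_rem].
have -> : [set u | (u, v) \in res_flip] = ([set u | (u, v) \in Z] :\: R) :|: A.
  by apply/setP=> u; rewrite !inE.
apply: card_exchange.
- by apply/subsetP=> u; rewrite [u \in R]inE [u \in [set _ | _]]inE => /(subsetP res_rem_sub).
- rewrite disjoint_subset; apply/subsetP=> u; rewrite [u \in A]inE => /res_add_notin [_].
  by rewrite !inE.
have [vc|vc] := boolP (inr v \in cyc).
  have [u nu _] := res_next_col vc; have [u' [uc' nu']] := res_prev_col vc.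
  have -> : R = [set u].
    by apply/setP=> x; rewrite !inE /= vc nu /= eq_sym.
  have -> : A = [set u'].
    apply/setP=> x; rewrite !inE /=; apply/andP/eqP => [[xc /eqP nx]|-> //].
      by have [] : inl x = inl u' :> V + V by apply: next_inj; rewrite // nx nu'.
    by split=> //; apply/eqP.
  by rewrite !cards1.
have -> : R = set0 by apply/setP=> x; rewrite !inE /= (negPf vc).
have -> // : A = set0.
apply/setP=> x; rewrite !inE /=; apply/negP=> /andP [xc /eqP nx].
by move: vc; rewrite -nx mem_next xc.
Qed.

Lemma sum_res_add : (\sum_(e in res_add) cross e.1 e.2)%N%:Z =
  \sum_(u | inl u \in cyc) res_cost (inl u) (next cyc (inl u)).
Proof.
rewrite (eq_bigr (fun e : V * V => nat_of_bool (cross e.1 e.2))) //.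
rewrite (eq_bigl (fun e : V * V => (inl e.1 \in cyc) &&
  (next cyc (inl e.1) == inr e.2))); last by move=> e; rewrite inE.
rewrite -(pair_big_dep (fun u => inl u \in cyc)
  (fun u v => next cyc (inl u) == inr v) (fun u v => nat_of_bool (cross u v))) /=.
rewrite (big_morph Posz PoszD (erefl _)); apply: eq_bigr => u uc.
have [v [nv _ _]] := res_next_row uc.
by rewrite (big_pred1 v) ?nv // => x; rewrite eq_sym.
Qed.

Lemma sum_res_rem : (\sum_(e in res_rem) cross e.1 e.2)%N%:Z =
  - \sum_(v | inr v \in cyc) res_cost (inr v) (next cyc (inr v)).
Proof.
rewrite (reindex_inj (h := fun e : V * V => (e.2, e.1))) /=; last first.
  by move=> [a b] [a' b'] [-> ->].
rewrite (eq_bigl (fun e : V * V => (inr e.1 \in cyc) &&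
  (next cyc (inr e.1) == inl e.2))); last by move=> e; rewrite inE.
rewrite -(pair_big_dep (fun v => inr v \in cyc)
  (fun v u => next cyc (inr v) == inl u) (fun v u => nat_of_bool (cross u v))) /=.
rewrite (big_morph Posz PoszD (erefl _)) -sumrN; apply: eq_bigr => v vc.
have [u nu _] := res_next_col vc.
by rewrite (big_pred1 u) ?nu /= ?opprK // => x; rewrite eq_sym.
Qed.

Lemma cross_count_flip : (cross_count res_flip)%:Z =
  (cross_count Z)%:Z + \sum_(x <- cyc) res_cost x (next cyc x).
Proof.
have dis : [disjoint Z :\: res_rem & res_add].
  rewrite disjoint_sym disjoint_subset; apply/subsetP=> e /res_add_notin [_ eZ].
  by rewrite !inE negb_and eZ orbT.
rewrite /cross_count.
have -> : (\sum_(e in res_flip) cross e.1 e.2 =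
    \sum_(e in Z :\: res_rem) cross e.1 e.2 + \sum_(e in res_add) cross e.1 e.2)%N.
  by rewrite -bigU //=; apply: eq_bigl => e; rewrite !inE.
rewrite PoszD sum_res_add.
rewrite [in RHS](big_setID res_rem) /= (setIidPr res_rem_sub) PoszD sum_res_rem.
rewrite [in RHS]big_uniq //= [in RHS]big_sumType /=.
set a := (X in Posz X + _); set b := \sum_(u | _) _; set c := \sum_(v | inr v \in cyc) _.
by rewrite [- c + _]addrC addrACA -addrA [- c + c]addrC subrr addr0. 
Qed.
End Residual.

(** Flipping a residual cycle of negative cost would produce fewer crossing arcs, so a potential
    exists. It gives the dual solution of the transportation problem, with [p] pricing tails and [q]
    pricing heads. *)
Lemma optimal_potentials Z : realizes_digraph Z ->
  (forall Z', realizes_digraph Z' -> (cross_count Z <= cross_count Z')%N) ->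
  exists p q : V -> int,
    (forall u v, (u, v) \in Z -> (cross u v : nat)%:Z <= p u + q v) /\
    (forall u v, u != v -> (u, v) \notin Z -> p u + q v <= (cross u v : nat)%:Z).
Proof.
move=> /realizes_digraphP [Zo Zi Zd] Zmin.
have [x p U C|pi piP] := @potential_exists _ (res_rel Z) res_cost.
  rewrite walk_cost_cycle //.
  have Rc : cycle (res_rel Z) (x :: p) by [].
  have := cross_count_flip U Rc.
  have : realizes_digraph (res_flip Z (x :: p)).
    apply/realizes_digraphP; split=> v; first by rewrite outn_flip.
      by rewrite inn_flip.
    rewrite !inE (negPf (Zd v)) andbF /=; apply/negP => H.
    have := @res_add_notin _ _ Rc (v, v); rewrite inE => /(_ H) /= [].
    by rewrite eqxx.
  move=> /Zmin; set S := \sum_(z <- _) _; move: S => S; lia.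
(* The sign on the tail copies turns differences of potentials along residual steps into sums
   [p u + q v]. *)
exists (fun u => - pi (inl u)), (fun v => pi (inr v)); split=> u v.
  by move=> uZ; have := piP (inr v) (inl u) uZ; rewrite /=; lia.
by move=> uv uZ; have := piP (inl u) (inr v); rewrite /= uv uZ => /(_ isT); lia.
Qed.

Lemma sum_digraph Z (f g : V -> int) : realizes_digraph Z ->
  \sum_(e in Z) (f e.1 + g e.2) = \sum_v (f v + g v) *+ dg v.
Proof.
move=> /realizes_digraphP [Zo Zi _].
rewrite big_split /= [RHS](eq_bigr (fun v => f v *+ dg v + g v *+ dg v)); last first.
  by move=> v _; rewrite mulrnDl.
rewrite [RHS]big_split /=; congr (_ + _).
  rewrite (eq_bigl (fun e : V * V => true && ((e.1, e.2) \in Z))); last by case.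
  rewrite -(pair_big_dep xpredT (fun u v => (u, v) \in Z) (fun u v => f u)) /=.
  apply: eq_bigr => u _; rewrite -Zo /outn -sumr_const.
  by apply: eq_bigl => v; rewrite inE.
rewrite (reindex_inj (h := fun e : V * V => (e.2, e.1))) /=; last first.
  by move=> [a b] [a' b'] [-> ->].
rewrite -(pair_big_dep xpredT (fun u v => (v, u) \in Z) (fun u v => g u)) /=.
apply: eq_bigr => u _; rewrite -Zi /inn -sumr_const.
by apply: eq_bigl => v; rewrite inE.
Qed.

Lemma cross_sym u v : cross u v = cross v u.
Proof. by rewrite /cross eq_sym. Qed.

(* The transpose of an optimal digraph is optimal, so complementary slackness
   holds for it too; adding both gives a single potential on vertices. *)
Lemma symmetric_potential : (exists Z, realizes_digraph Z) ->
  exists Z (w : V -> int), [/\ realizes_digraph Z,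
    forall u v, (u, v) \in Z -> 2 * (cross u v : nat)%:Z <= w u + w v &
    forall u v, u != v -> (u, v) \notin Z -> w u + w v <= 2 * (cross u v : nat)%:Z].
Proof.
case=> Z0 Z0P.
pose Z := [arg min_(Z < Z0 | realizes_digraph Z) cross_count Z]%N.
have [ZP Zmin] : realizes_digraph Z /\
    (forall Z', realizes_digraph Z' -> (cross_count Z <= cross_count Z')%N).
  by rewrite /Z; case: arg_minnP.
have [p [q [pqZ pqN]]] := optimal_potentials ZP Zmin.
have [Zo Zi Zd] := realizes_digraphP _ ZP.
(* Over any digraph with the prescribed degrees [r] sums to a constant minus the number of crossing
   arcs, so [Z] and its transpose have the same sum. *)
pose r u v := p u + q v - (cross u v : nat)%:Z.
pose Zt : {set V * V} := [set e | (e.2, e.1) \in Z].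
have ZtP : realizes_digraph Zt.
  apply/realizes_digraphP; split=> v; last by rewrite inE.
  - by rewrite -Zi; apply: eq_card => u; rewrite !inE.
  - by rewrite -Zo; apply: eq_card => u; rewrite !inE.
have cZt : cross_count Zt = cross_count Z.
  rewrite /cross_count (reindex_inj (h := fun e : V * V => (e.2, e.1))) /=; last first.
    by move=> [a b] [a' b'] [-> ->].
  by apply: eq_big => [[a b]|[a b] _]; rewrite ?inE //= cross_sym.
have sr Z' : realizes_digraph Z' -> \sum_(e in Z') r e.1 e.2 =
    \sum_v (p v + q v) *+ dg v - (cross_count Z')%:Z.
  move=> Z'P; rewrite -(sum_digraph p q Z'P) /cross_count.
  by rewrite (big_morph Posz PoszD (erefl _)) -sumrB.
have eqS : \sum_(e in Z) r e.1 e.2 = \sum_(e in Zt) r e.1 e.2 by rewrite !sr // cZt.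
(* The terms on the left are nonnegative and those on the right nonpositive, so all of them
   vanish. *)
have D1 : \sum_(e in Z :\: Zt) r e.1 e.2 = \sum_(e in Zt :\: Z) r e.1 e.2.
  move: eqS; rewrite (big_setID Zt) [RHS](big_setID Z) /= [Zt :&: Z]setIC.
  by move/addrI.
have pos e : e \in Z -> 0 <= r e.1 e.2.
  by case: e => u v uZ; rewrite /r subr_ge0 pqZ.
have neg e : e.1 != e.2 -> e \notin Z -> r e.1 e.2 <= 0.
  by case: e => u v uv uZ; rewrite /r subr_le0 pqN.
have offd e : e \in Zt -> e.1 != e.2.
  by case: e => u v; rewrite inE /=; apply: contraTneq => ->.
have S1 : 0 <= \sum_(e in Z :\: Zt) r e.1 e.2.
  by apply: sumr_ge0 => e; rewrite inE => /andP [_ /pos].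
have S2 : 0 <= \sum_(e in Zt :\: Z) - r e.1 e.2.
  apply: sumr_ge0 => e; rewrite inE => /andP [eZ eZt].
  by rewrite oppr_ge0 neg ?offd.
have S0 : \sum_(e in Z :\: Zt) r e.1 e.2 = 0.
  by move: S2; rewrite sumrN -D1; lia.
have r0 u v : (u, v) \in Z -> (v, u) \notin Z -> r u v = 0.
  move=> uZ vZ; move: S0 => /eqP; rewrite psumr_eq0; last first.
    by move=> e; rewrite inE => /andP [_ /pos].
  move=> /allP /(_ (u, v) (mem_index_enum _)); rewrite !inE /= uZ vZ /=.
  by move/eqP.
have r0t u v : (u, v) \in Z -> (v, u) \notin Z -> r v u = 0.
  move=> uZ vZ; have : \sum_(e in Zt :\: Z) - r e.1 e.2 = 0.
    by rewrite sumrN -D1 S0 oppr0.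
  move/eqP; rewrite psumr_eq0; last first.
    by move=> e; rewrite inE => /andP [eZ eZt]; rewrite oppr_ge0 neg ?offd.
  move=> /allP /(_ (v, u) (mem_index_enum _)); rewrite !inE /= uZ vZ /=.
  by rewrite oppr_eq0 => /eqP.
exists Z, (fun v => p v + q v); split=> // u v.
  move=> uZ; have h1 := pos _ uZ; have cs := cross_sym u v.
  have [vZ|vZ] := boolP ((v, u) \in Z).
    by have := pos _ vZ; move: h1; rewrite /r /= cs; lia.
  by have := r0t _ _ uZ vZ; move: h1; rewrite /r /= cs; lia.
move=> uv uZ; have h1 : r u v <= 0 := @neg (u, v) uv uZ; have cs := cross_sym u v.
have [vZ|vZ] := boolP ((v, u) \in Z).
  by have := r0 _ _ vZ uZ; move: h1; rewrite /r /= cs; lia.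
have : r v u <= 0 by apply: (@neg (v, u)) => //=; rewrite eq_sym.
by move: h1; rewrite /r /= cs; lia.
Qed.
End Digraph.

(** * Symmetrization *)

Section Asym.
Variables (V : finType).
Implicit Types (Z : {set V * V}) (u v : V) (e : V * V).

Definition swap e := (e.2, e.1).
Definition asym Z : {set V * V} := [set e in Z | swap e \notin Z].

Lemma swapK : involutive swap.
Proof. by case. Qed.

Lemma asym_swap Z e : e \in asym Z -> swap e \notin asym Z.
Proof. by case: e => u v; rewrite !inE /= => /andP [-> _]; rewrite andbF. Qed.

Lemma card_asym_out Z v :
  #|[set e in asym Z | e.1 == v]| = (outn Z v - #|[set u | ((v, u) \in Z) && ((u, v) \in Z)]|)%N.
Proof.
have -> : [set e in asym Z | e.1 == v] =
    [set (v, u) | u in [set u | (v, u) \in Z] :\: [set u | ((v, u) \in Z) && ((u, v) \in Z)]].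
  apply/setP=> -[x y]; apply/idP/imsetP => [|[u]]; rewrite !inE /=.
    move=> /andP [/andP [xZ yZ] /eqP ex]; subst x; exists y => //.
    by rewrite !inE xZ (negPf yZ).
  by move=> /andP [H uZ] [-> ->]; rewrite /swap /= uZ eqxx; move: H; rewrite uZ /= => ->.
rewrite card_imset; last by move=> a b [].
rewrite cardsD /outn; congr (_ - #|pred_of_set _|)%N.
by apply/setP=> u; rewrite !inE andbA andbb.
Qed.

Lemma card_asym_in Z v :
  #|[set e in asym Z | e.2 == v]| = (inn Z v - #|[set u | ((v, u) \in Z) && ((u, v) \in Z)]|)%N.
Proof.
have -> : [set e in asym Z | e.2 == v] =
    [set (u, v) | u in [set u | (u, v) \in Z] :\: [set u | ((v, u) \in Z) && ((u, v) \in Z)]].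
  apply/setP=> -[x y]; apply/idP/imsetP => [|[u]]; rewrite !inE /=.
    move=> /andP [/andP [xZ yZ] /eqP ex]; subst y; exists x => //.
    by rewrite !inE xZ (negPf yZ).
  by move=> /andP [H uZ] [-> ->]; rewrite /swap /= uZ eqxx; move: H; rewrite uZ andbT /= => ->.
rewrite card_imset; last by move=> a b [].
rewrite cardsD /inn; congr (_ - #|pred_of_set _|)%N.
by apply/setP=> u; rewrite !inE andbCA andbb.
Qed.

(* Pairing the arcs entering each vertex with the arcs leaving it. *)
Lemma exists_rotation Z : (forall v, outn Z v = inn Z v) ->
  exists phi : V * V -> V * V, injective phi /\
    forall e, e \in asym Z -> phi e \in asym Z /\ (phi e).1 = e.2.
Proof.
move=> bal.
pose outs v := [set e in asym Z | e.1 == v]; pose ins v := [set e in asym Z | e.2 == v].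
pose phi e := if e \in asym Z then
  nth e (enum (outs e.2)) (index e (enum (ins e.2))) else e.
have sz v : size (enum (outs v)) = size (enum (ins v)).
  by rewrite -!cardE card_asym_out card_asym_in bal.
have ie e : e \in asym Z -> (index e (enum (ins e.2)) < size (enum (outs e.2)))%N.
  by move=> eE; rewrite sz index_mem mem_enum inE eE eqxx.
have phiE e : e \in asym Z -> phi e \in outs e.2.
  by move=> eE; rewrite /phi eE -mem_enum mem_nth ?ie.
have phiP e : e \in asym Z -> phi e \in asym Z /\ (phi e).1 = e.2.
  by move=> /phiE; rewrite inE => /andP [? /eqP].
exists phi; split=> // e e'.
have [eE|eE] := boolP (e \in asym Z); have [eE'|eE'] := boolP (e' \in asym Z).
- move=> eq_phi; have ev : e.2 = e'.2.
    by rewrite -(phiP _ eE).2 -(phiP _ eE').2 eq_phi.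
  move: eq_phi; rewrite /phi eE eE' -ev (set_nth_default e) -?ev; last first.
    by rewrite {2}ev -/(outs _) ev ie.
  move/eqP; rewrite nth_uniq ?enum_uniq ?ie //; last by rewrite ev ie.
  move/eqP => ei; have e1 : e \in enum (ins e.2) by rewrite mem_enum inE eE eqxx.
  have e2 : e' \in enum (ins e.2) by rewrite mem_enum inE eE' ev eqxx.
  by rewrite -(nth_index e e1) ei nth_index.
- by move=> eq; have := (phiP _ eE).1; rewrite eq {1}/phi (negPf eE') (negPf eE').
- by move=> eq; have := (phiP _ eE').1; rewrite -eq {1}/phi (negPf eE) (negPf eE).
- by rewrite /phi (negPf eE) (negPf eE').
Qed.

Lemma sum_out (S : {set V * V}) u (F : V * V -> int) :
  \sum_v (if (u, v) \in S then F (u, v) else 0) = \sum_(e in S | e.1 == u) F e.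
Proof.
rewrite -big_mkcond /= (reindex_omap (fun v => (u, v))
  (fun e : V * V => if e.1 == u then Some e.2 else None)) /=; last first.
  by move=> [a b] /= /andP [_ /eqP ->]; rewrite eqxx.
by apply: eq_bigl => v; rewrite !eqxx !andbT.
Qed.

Lemma sum_in (S : {set V * V}) u (F : V * V -> int) :
  \sum_v (if (v, u) \in S then F (v, u) else 0) = \sum_(e in S | e.2 == u) F e.
Proof.
rewrite -big_mkcond /= (reindex_omap (fun v => (v, u))
  (fun e : V * V => if e.2 == u then Some e.1 else None)) /=; last first.
  by move=> [a b] /= /andP [_ /eqP ->]; rewrite eqxx.
by apply: eq_bigl => v; rewrite !eqxx !andbT.
Qed.

Lemma outnE Z u : (outn Z u)%:Z = \sum_v ((u, v) \in Z : nat)%:Z.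
Proof.
rewrite /outn -sum1_card (big_morph Posz PoszD (erefl _)) big_mkcond.
by apply: eq_bigr => v _; rewrite inE; case: (_ \in _).
Qed.

Lemma innE Z u : (inn Z u)%:Z = \sum_v ((v, u) \in Z : nat)%:Z.
Proof.
rewrite /inn -sum1_card (big_morph Posz PoszD (erefl _)) big_mkcond.
by apply: eq_bigr => v _; rewrite inE; case: (_ \in _).
Qed.

(** * Alternating recolouring of one closed trail *)

Section Recolor.
Variables (Z : {set V * V}) (phi : V * V -> V * V) (e0 : V * V) (b : bool).
Let S := [set e | fconnect phi e0 e].
Hypotheses (phiI : injective phi) (SE : S \subset asym Z)
  (phiT : forall e, e \in S -> (phi e).1 = e.2).

Definition orbit_color e := b (+) odd (findex phi e0 e).
(** An arc of the orbit coloured [true] acquires its reverse, one coloured [false] disappears.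
    Either way it stops being asymmetric. *)
Definition recolor : {set V * V} :=
  [set e | if e \in S then orbit_color e else
           if swap e \in S then orbit_color (swap e) else e \in Z].

Lemma phi_orbit e : (phi e \in S) = (e \in S).
Proof. by rewrite !inE -(same_fconnect1_r phiI). Qed.

(** Consecutive arcs have opposite colours, so exactly one of them survives, except where an odd
    orbit closes up: there the last and the first arc both have colour [b]. *)
Lemma orbit_color_defect e : e \in S ->
  (orbit_color e : nat)%:Z - 1 + (orbit_color (phi e) : nat)%:Z =
  if phi e == e0 then (if odd (order phi e0) then (if b then 1 else -1) else 0) else 0.
Proof.
rewrite inE /orbit_color => e0e.
have lti := findex_max e0e; have eqi := iter_findex e0e.
set i := findex phi e0 e in lti eqi *.
have -> : phi e = iter i.+1 phi e0 by rewrite iterS eqi.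
have [i1|] := ltnP i.+1 (order phi e0).
  rewrite findex_iter // -[X in if iter i.+1 phi e0 == X then _ else _]/(iter 0 phi e0).
  case: eqP => [eq0|_]; last by rewrite oddS; case: (b); case: (odd i).
  have := congr1 (findex phi e0) eq0.
  by rewrite !findex_iter //; exact: leq_ltn_trans i1.
move=> i1; have eqo : i.+1 = order phi e0 by apply/eqP; rewrite eqn_leq lti.
rewrite eqo iter_order // eqxx.
have -> : findex phi e0 e0 = 0%N by have := @findex_iter _ phi e0 0; rewrite /=; apply; rewrite -eqo.
by rewrite -eqo oddS; case: (b); case: (odd i).
Qed.

(** Each passage of the trail through [u] consists of an entering arc and its image under [phi]. It
    contributes 1 to the out-degree before recolouring, and afterwards 1 for each of its two arcs
    coloured [true]. *)
Lemma recolor_defect u :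
  \sum_(e in S | e.1 == u) ((orbit_color e : nat)%:Z - 1) +
  \sum_(e in S | e.2 == u) (orbit_color e : nat)%:Z =
  if (u == e0.1) && odd (order phi e0) then (if b then 1 else -1) else 0.
Proof.
rewrite (reindex_inj phiI) /=.
rewrite (eq_bigl (fun e => (e \in S) && (e.2 == u))); last first.
  by move=> e; rewrite phi_orbit; case: (boolP (e \in S)) => //= eS; rewrite phiT.
rewrite -big_split /=.
rewrite (eq_bigr (fun e => if phi e == e0 then (if odd (order phi e0) then
  (if b then 1 else -1) else 0) else 0)); last first.
  by move=> e /andP [eS _]; rewrite -orbit_color_defect // addrC addrA addrAC.
rewrite (eq_bigl (fun e => (phi e \in S) && ((phi e).1 == u))); last first.
  by move=> e; rewrite phi_orbit; case: (boolP (e \in S)) => //= eS; rewrite phiT.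
rewrite -(reindex_inj phiI (P := fun e => (e \in S) && (e.1 == u))
  (F := fun e => if e == e0 then (if odd (order phi e0) then
  (if b then 1 else -1) else 0) else 0)) /=.
rewrite -big_mkcondr /=; have e0S : e0 \in S by rewrite inE connect0.
case: eqP => [->|ne] /=.
  rewrite (big_pred1 e0) // => e /=; case: (eqVneq e e0) => [->|]; rewrite ?andbF //.
  by rewrite e0S eqxx.
rewrite big_pred0 // => e /=; case: (eqVneq e e0) => [->|]; rewrite ?andbF //.
by rewrite andbT; apply/negP => /andP [_ /eqP] /esym.
Qed.

Lemma recolor_memZ u v : ((u, v) \in recolor : nat)%:Z - ((u, v) \in Z : nat)%:Z =
  (if (u, v) \in S then (orbit_color (u, v) : nat)%:Z - 1 else 0) +
  (if (v, u) \in S then (orbit_color (v, u) : nat)%:Z else 0).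
Proof.
rewrite [_ \in recolor]inE /swap /=.
case: ifP => [/(subsetP SE) uS|_].
  have := asym_swap uS; case: ifP => [/(subsetP SE) -> //|_ _].
  by move: uS; rewrite inE => /andP [-> _]; rewrite addr0.
case: ifP => [/(subsetP SE)|_]; last by rewrite subrr.
by rewrite inE => /andP [_ /negPf ->]; rewrite subr0 add0r.
Qed.

Lemma outn_recolor u : (outn recolor u)%:Z = (outn Z u)%:Z +
  if (u == e0.1) && odd (order phi e0) then (if b then 1 else -1) else 0.
Proof.
rewrite -recolor_defect -sum_out -sum_in -big_split /= !outnE -big_split /=.
by apply: eq_bigr => v _; rewrite -recolor_memZ addrC subrK.
Qed.

(** The defect is the same as for out-degrees because [phi] matches the arcs of the orbit entering
    [u] with those leaving it, so the correction by -1 occurs equally often in both counts. *)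
Lemma inn_recolor u : (inn recolor u)%:Z = (inn Z u)%:Z +
  if (u == e0.1) && odd (order phi e0) then (if b then 1 else -1) else 0.
Proof.
have -> : (inn recolor u)%:Z = (inn Z u)%:Z +
    \sum_v (if (v, u) \in S then (orbit_color (v, u) : nat)%:Z - 1 else 0) +
    \sum_v (if (u, v) \in S then (orbit_color (u, v) : nat)%:Z else 0).
  rewrite !innE -!big_split /=.
  by apply: eq_bigr => v _; rewrite -addrA -recolor_memZ addrC subrK.
rewrite (sum_in S u (fun e => (orbit_color e : nat)%:Z - 1)) (sum_out S u (fun e => (orbit_color e : nat)%:Z)).
rewrite -recolor_defect -addrA; congr (_ + _).
rewrite !big_split /= addrAC [in RHS]addrAC [X in X + _]addrC; congr (_ + _).
rewrite !sumr_const; congr (- 1 *+ _).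
rewrite -(card_imset (fun e => (e \in S) && (e.2 == u)) phiI).
apply: eq_card => e; apply/imsetP/idP.
  move=> [e' /andP [eS /eqP eu] ->]; apply/andP.
  by rewrite phi_orbit eS phiT ?eu.
move=> /andP [eS /eqP eu]; exists (finv phi e); rewrite ?f_finv //; apply/andP.
have fS : finv phi e \in S by rewrite -phi_orbit f_finv.
by rewrite fS -phiT // f_finv ?eu.
Qed.

Lemma recolor_out u v : (u, v) \notin S -> (v, u) \notin S ->
  ((u, v) \in recolor) = ((u, v) \in Z).
Proof. by rewrite [_ \in recolor]inE /swap /= => /negPf -> /negPf ->. Qed.

Lemma asym_recolor : asym recolor = asym Z :\: S.
Proof.
have swS e : e \in S -> swap e \notin S.
  move=> eS; apply/negP => /(subsetP SE); apply/negP.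
  exact/asym_swap/(subsetP SE).
apply/setP=> e; rewrite inE [in RHS]inE [e \in recolor]inE [swap e \in recolor]inE swapK.
have [eS|eS] := boolP (e \in S).
  by rewrite (negPf (swS _ eS)) andbN.
have [eS'|eS'] := boolP (swap e \in S); last by rewrite inE.
rewrite andbN /=; apply/esym/negP => eE; move: eS' => /(subsetP SE).
exact/negP/asym_swap.
Qed.
End Recolor.
End Asym.

(** * Removing all asymmetric arcs at the cost of one crossing edge *)

Section Symmetrize.
Variables (V : finType) (side : V -> bool) (dg : V -> nat) (w : V -> int).
Implicit Types (Z : {set V * V}) (u v : V) (e : V * V).
Local Notation cross := (cross side).
Local Notation cross_count := (cross_count side).
Local Notation realizes_digraph := (realizes_digraph dg).

(** The optimality certificate with [w] held fixed. A pair with equality may be an arc or not, and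
    this is the freedom that symmetrization exploits. *)
Definition compatible Z :=
  (forall u v, (u, v) \in Z -> 2 * (cross u v : nat)%:Z <= w u + w v) /\
  (forall u v, u != v -> (u, v) \notin Z -> w u + w v <= 2 * (cross u v : nat)%:Z).

Definition loopless Z := forall v, (v, v) \notin Z.

Lemma asym_tight Z u v : loopless Z -> compatible Z -> (u, v) \in asym Z ->
  w u + w v = 2 * (cross u v : nat)%:Z.
Proof.
move=> nl [cin cout]; rewrite inE /swap /= => /andP [uZ vZ].
have uv : v != u by apply: contraTneq uZ => ->; exact: nl.
have := cin _ _ uZ; have := cout _ _ uv vZ; rewrite (cross_sym side v u); lia.
Qed.

Lemma sum_pairs Z (f : V -> int) : \sum_(e in Z) (f e.1 + f e.2) =
  \sum_v f v * ((outn Z v)%:Z + (inn Z v)%:Z).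
Proof.
rewrite [RHS](eq_bigr (fun v => f v * (outn Z v)%:Z + f v * (inn Z v)%:Z)); last first.
  by move=> v _; rewrite mulrDr.
rewrite !big_split /=; congr (_ + _).
  rewrite (eq_bigl (fun e : V * V => true && ((e.1, e.2) \in Z))); last by case.
  rewrite -(pair_big_dep xpredT (fun u v => (u, v) \in Z) (fun u v => f u)) /=.
  apply: eq_bigr => u _;
  by rewrite outnE mulr_sumr big_mkcond /=; apply: eq_bigr => v _;
    case: (_ \in Z); rewrite ?mulr1 ?mulr0.
rewrite (reindex_inj (h := fun e : V * V => (e.2, e.1))) /=; last first.
  by move=> [a b] [a' b'] [-> ->].
rewrite -(pair_big_dep xpredT (fun u v => (v, u) \in Z) (fun u v => f u)) /=.
apply: eq_bigr => u _.
by rewrite innE mulr_sumr big_mkcond /=; apply: eq_bigr => v _;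
    case: (_ \in Z); rewrite ?mulr1 ?mulr0.
Qed.

(** Summing [w e.1 + w e.2] over the arcs gives twice the number of crossing arcs plus the positive
    parts of [s] summed over all pairs, and this last sum does not depend on the digraph. The total
    itself only sees degrees at vertices where [w] is nonzero, so degree errors at zeros of [w] do
    no harm. *)
Lemma cross_count_compatible Z Z' : loopless Z -> loopless Z' ->
  compatible Z -> compatible Z' ->
  (forall v, w v != 0 -> outn Z v = outn Z' v /\ inn Z v = inn Z' v) ->
  cross_count Z = cross_count Z'.
Proof.
pose s e := w e.1 + w e.2 - 2 * (cross e.1 e.2 : nat)%:Z.
have H Y : loopless Y -> compatible Y ->
    \sum_(e in Y) (w e.1 + w e.2) = 2 * (cross_count Y)%:Z +
    \sum_(e | e.1 != e.2) (if 0 <= s e then s e else 0).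
  move=> nl [cin cout].
  have -> : \sum_(e | e.1 != e.2) (if 0 <= s e then s e else 0) = \sum_(e in Y) s e.
    rewrite big_mkcond [RHS]big_mkcond; apply: eq_bigr => -[u v] _ /=.
    case: (eqVneq u v) => [->|uv] /=; first by rewrite (negPf (nl v)).
    have [uY|uY] := boolP (_ \in Y).
      by have := cin _ _ uY; rewrite /s /= -subr_ge0 => ->.
    have := cout _ _ uv uY; rewrite /s /= => h; case: ifP => // h'; lia.
  rewrite /cross_count (big_morph Posz PoszD (erefl _)) mulr_sumr -big_split /=.
  by apply: eq_bigr => e _; rewrite /s addrC subrK.
move=> nl nl' c c' eqw; have := H _ nl c; have := H _ nl' c'.
rewrite !sum_pairs.
have -> : \sum_v w v * ((outn Z v)%:Z + (inn Z v)%:Z) =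
    \sum_v w v * ((outn Z' v)%:Z + (inn Z' v)%:Z).
  apply: eq_bigr => v _; case: (eqVneq (w v) 0) => [w0|/eqw [-> ->]] //.
  by rewrite w0 !mul0r.
by move=> -> /addIr h; lia.
Qed.

Lemma even_symmetric Y : loopless Y -> asym Y = set0 -> ~~ odd #|Y|.
Proof.
move=> nl sy.
pose L := [set e in Y | (enum_rank e.1 < enum_rank e.2)%N].
have symY e : (swap e \in Y) = (e \in Y).
  have Y1 e' : e' \in Y -> swap e' \in Y.
    move=> eY; apply: contraT => sY; have : e' \in asym Y by rewrite inE eY.
    by rewrite sy inE.
  by apply/idP/idP => /Y1; rewrite ?swapK.
have -> : Y = L :|: (@swap V @: L).
  apply/setP=> -[u v]; rewrite !inE /=; apply/idP/orP => [uY|].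
    have uv : u != v by apply: contraTneq uY => ->; exact: nl.
    case: (ltngtP (enum_rank u) (enum_rank v)) => h; first by left; rewrite uY.
      right; apply/imsetP; exists (v, u) => //.
      by rewrite inE /= h -(symY (v, u)) uY.
    by move/val_inj/enum_rank_inj: h uv => ->; rewrite eqxx.
  case=> [/andP [] //|/imsetP [e]]; rewrite inE => /andP [eY _] ->.
  by rewrite symY.
rewrite cardsU card_imset; last exact: inv_inj (@swapK V).
have -> : L :&: swap (V:=V) @: L = set0.
  apply/setP=> -[u v]; rewrite !inE /=; apply/negP => /andP [/andP [_ h]].
  by move=> /imsetP [[a b]]; rewrite inE /= => /andP [_ h'] [? ?]; subst; lia.
by rewrite cards0 subn0 addnn odd_double.
Qed.

Lemma card_digraph Z : #|Z| = (\sum_v outn Z v)%N.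
Proof.
rewrite -sum1_card (eq_bigl (fun e : V * V => true && ((e.1, e.2) \in Z))); last by case.
rewrite -(pair_big_dep xpredT (fun u v => (u, v) \in Z) (fun u v => 1%N)) /=.
by apply: eq_bigr => u _; rewrite /outn -sum1_card; apply: eq_bigl => v; rewrite inE.
Qed.

Lemma even_asym Z : loopless Z -> ~~ odd #|Z| -> ~~ odd #|asym Z|.
Proof.
move=> nl ev.
have -> : asym Z = Z :\: [set e in Z | swap e \in Z].
  by apply/setP=> e; rewrite !inE; case: (e \in Z); rewrite //= andbT.
rewrite cardsD.
have -> : Z :&: [set e in Z | swap e \in Z] = [set e in Z | swap e \in Z].
  by apply/setP=> e; rewrite !inE; case: (e \in Z).
rewrite oddB; last by apply: subset_leq_card; apply/subsetP=> e; rewrite inE => /andP [].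
rewrite (negPf ev) /= even_symmetric // => [v|].
  by rewrite inE (negPf (nl v)).
by apply/setP=> e; rewrite !inE swapK; case: (e \in Z); case: (swap e \in Z).
Qed.

Definition rotation Z (phi : V * V -> V * V) := injective phi /\
  forall e, e \in asym Z -> phi e \in asym Z /\ (phi e).1 = e.2.

Lemma rotation_orbit Z phi e0 : rotation Z phi -> e0 \in asym Z ->
  [set e | fconnect phi e0 e] \subset asym Z.
Proof.
move=> [_ phiP] e0E; apply/subsetP=> e; rewrite inE => /iter_findex <-.
by elim: (findex _ _ _) => //= k /phiP [].
Qed.

(* Along a tight pair [w u + w v] is 0 or 2, so [bit] alternates there unless
   [w u = 0]; hence a closed trail of odd length meets a zero of [w]. *)
Definition bit v : bool := if (w v %% 2 == 1)%Z then side v (+) (w v %% 4 == 1)%Z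
  else 2 <= w v.

Lemma bit_toggle u v : w u + w v = 2 * (cross u v : nat)%:Z -> w u != 0 ->
  bit v = ~~ bit u.
Proof.
rewrite /bit /cross => tight u0.
have ev : (w v %% 2 == 1)%Z = (w u %% 2 == 1)%Z by lia.
rewrite ev; case: ifP => h; last by lia.
case: (side u) tight; case: (side v) => /=; lia.
Qed.

Lemma odd_orbit_zero Z phi e0 : loopless Z -> compatible Z -> rotation Z phi ->
  e0 \in asym Z -> odd (order phi e0) ->
  exists2 e, fconnect phi e0 e & w e.1 = 0.
Proof.
move=> nl cZ rot e0E oddo.
have [/existsP [e /andP [h /eqP he]]|] := boolP [exists e, fconnect phi e0 e && (w e.1 == 0)].
  by exists e.
rewrite negb_exists => /forallP none.
have SE := rotation_orbit rot e0E; have [phiI phiP] := rot.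
have H k : bit (iter k phi e0).1 = odd k (+) bit e0.1.
  elim: k => //= k IHk; set e := iter k phi e0 in IHk *.
  have ce : fconnect phi e0 e by exact: fconnect_iter.
  have eE : e \in asym Z by apply: (subsetP SE); rewrite inE.
  rewrite (phiP _ eE).2 (@bit_toggle e.1) ?IHk //; first by case: (odd k); case: (bit _).
    by apply: asym_tight nl cZ _; rewrite -surjective_pairing.
  by have := none e; rewrite ce.
by have := H (order phi e0); rewrite iter_order // oddo /=; case: (bit _).
Qed.

(** Only pairs joined by an asymmetric arc change, and these are tight, so both inequalities permit
    them to be present or absent. *)
Lemma recolor_compatible Z phi e0 b : loopless Z -> compatible Z ->
  rotation Z phi -> e0 \in asym Z ->
  loopless (recolor Z phi e0 b) /\ compatible (recolor Z phi e0 b).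
Proof.
move=> nl cZ rot e0E; have SE := rotation_orbit rot e0E.
have tight u v : ((u, v) \in asym Z) || ((v, u) \in asym Z) ->
    w u + w v = 2 * (cross u v : nat)%:Z.
  by case/orP => /(asym_tight nl cZ) //; rewrite cross_sym addrC.
have mem u v : ~~ (((u, v) \in asym Z) || ((v, u) \in asym Z)) ->
    ((u, v) \in recolor Z phi e0 b) = ((u, v) \in Z).
  rewrite negb_or => /andP [h1 h2].
  by apply: recolor_out; [apply: contra h1|apply: contra h2]; move/(subsetP SE).
split=> [v|].
  by rewrite mem ?nl // inE (negPf (nl v)).
case: (cZ) => cin cout; split=> u v.
  by have [/tight -> //|/mem ->] := boolP (((u, v) \in asym Z) || ((v, u) \in asym Z)); apply: cin.
move=> uv.
by have [/tight -> //|/mem ->] := boolP (((u, v) \in asym Z) || ((v, u) \in asym Z)); apply: cout.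
Qed.

Definition sgb (b : bool) : int := if b then 1 else -1.

(* Recolouring one odd orbit changes one degree by one; two of them are
   recoloured together so that the errors can be cancelled. *)
Lemma recolor_two Z phi e1 e2 b1 b2 : loopless Z -> compatible Z ->
  rotation Z phi -> e1 \in asym Z -> e2 \in asym Z -> ~~ fconnect phi e1 e2 ->
  odd (order phi e1) -> odd (order phi e2) ->
  exists Z', [/\ loopless Z', compatible Z',
    asym Z' = asym Z :\: ([set e | fconnect phi e1 e] :|: [set e | fconnect phi e2 e]),
    forall u, (outn Z' u)%:Z = (outn Z u)%:Z + (if u == e1.1 then sgb b1 else 0)
      + (if u == e2.1 then sgb b2 else 0) /\
     (inn Z' u)%:Z = (inn Z u)%:Z + (if u == e1.1 then sgb b1 else 0)
      + (if u == e2.1 then sgb b2 else 0) &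
    forall u v, (u, v) \notin asym Z -> (v, u) \notin asym Z ->
      ((u, v) \in Z') = ((u, v) \in Z)].
Proof.
move=> nl cZ rot e1E e2E e12 o1 o2.
have [phiI phiP] := rot.
have S1 := rotation_orbit rot e1E; have S2 := rotation_orbit rot e2E.
have T1 e : e \in [set e | fconnect phi e1 e] -> (phi e).1 = e.2.
  by move/(subsetP S1)/phiP => [].
have T2 e : e \in [set e | fconnect phi e2 e] -> (phi e).1 = e.2.
  by move/(subsetP S2)/phiP => [].
pose Z1 := recolor Z phi e1 b1.
have [nl1 cZ1] : loopless Z1 /\ compatible Z1 by apply: recolor_compatible.
have A1 : asym Z1 = asym Z :\: [set e | fconnect phi e1 e] by apply: asym_recolor.
have dis e : fconnect phi e2 e -> ~~ fconnect phi e1 e.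
  move=> c2; apply: contra e12 => c1; apply: connect_trans c1 _.
  by rewrite (fconnect_sym phiI).
have S2' : [set e | fconnect phi e2 e] \subset asym Z1.
  apply/subsetP=> e eS; rewrite A1 inE (subsetP S2) // andbT.
  by move: eS; rewrite !inE; apply: dis.
have rot1 : rotation Z1 phi.
  split=> // e; rewrite A1 !inE => /andP [h eE].
  have /phiP [pE pT] : e \in asym Z by rewrite inE.
  by move: pE; rewrite inE => ->; rewrite -(same_fconnect1_r phiI) h.
have e2E1 : e2 \in asym Z1 by rewrite A1 inE e2E inE e12.
exists (recolor Z1 phi e2 b2).
have [nl2 cZ2] : loopless (recolor Z1 phi e2 b2) /\ compatible (recolor Z1 phi e2 b2).
  exact: recolor_compatible.
split=> //.
- by rewrite asym_recolor // A1 setDDl.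
- move=> u; rewrite outn_recolor // outn_recolor // inn_recolor // inn_recolor //.
  by rewrite o1 o2 !andbT.
- move=> u v h1 h2; rewrite !recolor_out //.
  + by apply: contra h1 => /(subsetP S1).
  + by apply: contra h2 => /(subsetP S1).
  + by apply: contra h1 => /(subsetP S2).
  + by apply: contra h2 => /(subsetP S2).
Qed.

Lemma outn_add Z z1 z2 u : z1 != z2 -> (z1, z2) \notin Z -> (z2, z1) \notin Z ->
  (outn (Z :|: [set (z1, z2); (z2, z1)]) u)%:Z =
    (outn Z u)%:Z + (u == z1 : nat)%:Z + (u == z2 : nat)%:Z /\
  (inn (Z :|: [set (z1, z2); (z2, z1)]) u)%:Z =
    (inn Z u)%:Z + (u == z1 : nat)%:Z + (u == z2 : nat)%:Z.
Proof.
move=> z12 n1 n2.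
have mem x y : ((x, y) \in Z :|: [set (z1, z2); (z2, z1)] : nat)%:Z =
    ((x, y) \in Z : nat)%:Z + ((x == z1) && (y == z2) : nat)%:Z
    + ((x == z2) && (y == z1) : nat)%:Z.
  rewrite !inE !xpair_eqE.
  case: (eqVneq x z1) => [->|_]; case: (eqVneq y z2) => [->|_] //=.
  - by rewrite (negPf n1) (negPf z12).
  - by rewrite (negPf z12); case: (_ \in Z).
  - by case: (eqVneq x z2) => [->|_]; rewrite /= ?[z2 == _]eq_sym ?(negPf z12) ?orbF ?addr0.
  - by case: (eqVneq x z2) => [->|_]; case: (eqVneq y z1) => [->|_] /=;
      rewrite ?(negPf n2) ?orbF ?addr0.
have one (a : V) (P : bool) : \sum_v (P && (v == a) : nat)%:Z = (P : nat)%:Z.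
  rewrite (bigD1 a) //= eqxx andbT big1 ?addr0 // => v /negPf ->; by rewrite andbF.
split.
  rewrite !outnE (eq_bigr _ (fun v _ => mem u v)) !big_split /= !one //.
rewrite !innE (eq_bigr _ (fun v _ => mem v u)) !big_split /=.
under [X in _ + X + _]eq_bigr do rewrite andbC.
under [X in _ + X]eq_bigr do rewrite andbC.
by rewrite !one addrAC.
Qed.

Lemma asym_addsym Z (X : {set V * V}) : (forall e, (swap e \in X) = (e \in X)) ->
  asym (Z :|: X) \subset asym Z.
Proof.
move=> sX; apply/subsetP=> e; rewrite !inE sX !negb_or.
by case: (e \in X); rewrite ?andbF ?orbF ?andbT.
Qed.

Lemma asym_subsym Z (X : {set V * V}) : (forall e, (swap e \in X) = (e \in X)) ->
  asym (Z :\: X) \subset asym Z.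
Proof.
by move=> sX; apply/subsetP=> e; rewrite !inE sX; case: (e \in X).
Qed.

Lemma swap_pair z1 z2 e :
  (swap e \in [set (z1, z2); (z2, z1)]) = (e \in [set (z1, z2); (z2, z1)]).
Proof. by case: e => a b; rewrite !inE !xpair_eqE orbC ![_ && (b == _)]andbC. Qed.

Lemma cross_count_add Z z1 z2 :
  (cross_count (Z :|: [set (z1, z2); (z2, z1)]) <= cross_count Z + 2)%N.
Proof.
have bound (X Y : {set V * V}) : (cross_count (X :|: Y) <= cross_count X + #|Y|)%N.
  rewrite /cross_count.
  rewrite (big_setID X) /= setIC setIUr setIid.
  have -> : X :|: X :&: Y = X by apply/setUidPl; exact: subsetIl.
  rewrite leq_add2l; apply: (@leq_trans #|(X :|: Y) :\: X|).
    by rewrite -sum1_card; apply: leq_sum => e _; case: (cross _ _).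
  by apply: subset_leq_card; apply/subsetP=> e; rewrite !inE; case: (e \in X).
apply: leq_trans (bound _ _) _; rewrite leq_add2l cards2; by case: (_ != _).
Qed.

(** Induction on the number of asymmetric arcs. Even orbits are recoloured without any degree error.
    Odd orbits are treated in pairs whose errors cancel, either at a common vertex or through the
    edge joining a zero of [w] on each. Only a final pair with zeros on opposite sides adds a
    crossing edge, that is, two crossing arcs. *)
Theorem symmetrize Z : realizes_digraph Z -> compatible Z ->
  ~~ odd (\sum_v dg v) ->
  exists Z', [/\ realizes_digraph Z', asym Z' = set0 &
    (cross_count Z' <= cross_count Z + 2)%N].
Proof.
move=> rZ cZ ev; have [k] := ubnP #|asym Z|.
elim: k Z rZ cZ => // k IHk Z rZ cZ; rewrite ltnS => leE.
have [Zo Zi nl] := realizes_digraphP _ _ rZ.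
have reduce Z1 : realizes_digraph Z1 -> compatible Z1 -> (#|asym Z1| < #|asym Z|)%N ->
    exists Z', [/\ realizes_digraph Z', asym Z' = set0 &
    (cross_count Z' <= cross_count Z + 2)%N].
  move=> r1 c1 lt1; have [Z' [rZ' sZ' cZ']] := IHk _ r1 c1 (leq_trans lt1 leE).
  exists Z'; split=> //; rewrite (@cross_count_compatible Z Z1) //.
    by case/realizes_digraphP: r1.
  by move=> v _; case/realizes_digraphP: r1 => o1 i1 _; rewrite o1 i1 Zo Zi.
have [phi rot] : exists phi, rotation Z phi.
  by apply: exists_rotation => v; rewrite Zo Zi.
have [phiI phiP] := rot.
have lt_asym Z1 e : e \in asym Z -> e \notin asym Z1 -> asym Z1 \subset asym Z ->
    (#|asym Z1| < #|asym Z|)%N.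
  move=> eE eE1 sub; apply: proper_card; apply/properP; split=> //.
  by exists e.
have [/existsP [e /andP [eE evo]]|] :=
    boolP [exists e, (e \in asym Z) && ~~ odd (order phi e)].
  have SE := rotation_orbit rot eE.
  have [nl1 c1] := recolor_compatible true nl cZ rot eE.
  have TE e' : e' \in [set e' | fconnect phi e e'] -> (phi e').1 = e'.2.
    by move/(subsetP SE)/phiP => [].
  have A1 := asym_recolor true SE.
  apply: (reduce _ _ c1).
    apply/realizes_digraphP; split=> // v.
      by have := outn_recolor true phiI SE TE v; rewrite (negPf evo) andbF addr0 Zo => -[].
    by have := inn_recolor true phiI SE TE v; rewrite (negPf evo) andbF addr0 Zi => -[].
  apply: (lt_asym _ e) => //; rewrite A1 ?subsetDl // inE [e \in [set _ | _]]inE.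
  by rewrite connect0.
rewrite negb_exists => /forallP oddA.
have odds e : e \in asym Z -> odd (order phi e).
  by move=> eE; have := oddA e; rewrite eE negbK.
(* Two odd orbits meeting in a vertex are based there and get opposite colours, so that their errors
   cancel. *)
have [/existsP [e1 /existsP [e2 /and4P [e1E e2E /eqP t12 n12]]]|] :=
    boolP [exists e1, exists e2, [&& e1 \in asym Z, e2 \in asym Z, e1.1 == e2.1
      & ~~ fconnect phi e1 e2]].
  have [Z1 [nl1 c1 A1 deg1 _]] := recolor_two true false nl cZ rot e1E e2E n12
    (odds _ e1E) (odds _ e2E).
  apply: (reduce _ _ c1).
    apply/realizes_digraphP; split=> // v; have [] := deg1 v; rewrite -t12;
      by rewrite ?Zo ?Zi; move: (outn Z1 v) (inn Z1 v) (dg v); case: (v == e1.1); clear; rewrite /sgb /=; lia.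
  apply: (lt_asym _ e1) => //; rewrite A1 ?subsetDl // !inE.
  by rewrite connect0.
rewrite negb_exists => /forallP disj0.
have disj e1 e2 : e1 \in asym Z -> e2 \in asym Z -> e1.1 = e2.1 -> fconnect phi e1 e2.
  move=> e1E e2E t12; have := disj0 e1; rewrite negb_exists => /forallP /(_ e2).
  by rewrite e1E e2E t12 eqxx /= negbK.
have zero e : e \in asym Z -> exists e', [/\ e' \in asym Z, w e'.1 = 0,
    fconnect phi e e' & forall x, fconnect phi e' x = fconnect phi e x].
  move=> eE; have [e' ee' w0] := odd_orbit_zero nl cZ rot eE (odds _ eE).
  exists e'; split=> //; first by apply: (subsetP (rotation_orbit rot eE)); rewrite inE.
  by move=> x; apply/esym/(same_connect (fconnect_sym phiI)).
(* From here on arcs with a common tail share an orbit. An asymmetric arc between the two tails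
   would therefore belong to both orbits. *)
have nadj e1 e2 : e1 \in asym Z -> e2 \in asym Z -> ~~ fconnect phi e1 e2 ->
    (e1.1, e2.1) \notin asym Z.
  move=> e1E e2E; apply: contra => aE.
  have [pE pT] := phiP _ aE.
  apply: connect_trans (disj _ _ e1E aE erefl) _.
  by apply: connect_trans (fconnect1 phi _) (disj _ _ pE e2E _).
have conn_sym e1 e2 : ~~ fconnect phi e1 e2 -> ~~ fconnect phi e2 e1.
  by rewrite (fconnect_sym phiI).
have tails e1 e2 : e1 \in asym Z -> e2 \in asym Z -> ~~ fconnect phi e1 e2 -> e1.1 != e2.1.
  by move=> h1 h2; apply: contra => /eqP /(disj _ _ h1 h2).
(* Two zeros of [w] on one side form a tight pair, so the edge between them may be inserted or
   deleted. If it is present, both recolourings raise a degree and the edge is deleted; if not, both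
   lower a degree and it is inserted. *)
have same e1 e2 : e1 \in asym Z -> e2 \in asym Z -> w e1.1 = 0 -> w e2.1 = 0 ->
    ~~ fconnect phi e1 e2 -> side e1.1 = side e2.1 ->
    exists Z', [/\ realizes_digraph Z', asym Z' = set0 &
    (cross_count Z' <= cross_count Z + 2)%N].
  move=> e1E e2E w1 w2 n12 s12.
  have z12 := tails _ _ e1E e2E n12.
  have a12 := nadj _ _ e1E e2E n12; have a21 := nadj _ _ e2E e1E (conn_sym _ _ n12).
  have symz : ((e1.1, e2.1) \in Z) = ((e2.1, e1.1) \in Z).
    move: a12 a21; rewrite !inE /swap /=.
    by case: (_ \in Z); case: (_ \in Z).
  pose b := (e1.1, e2.1) \in Z.
  have [Z1 [nl1 [cin cout] A1 deg1 mem1]] := recolor_two b b nl cZ rot e1E e2E n12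
    (odds _ e1E) (odds _ e2E).
  have tight u v : (u, v) \in [set (e1.1, e2.1); (e2.1, e1.1)] ->
      w u + w v = 2 * (cross u v : nat)%:Z.
    rewrite !inE !xpair_eqE /cross => /orP [] /andP [/eqP -> /eqP ->];
      by rewrite w1 w2 s12 eqxx.
  pose X := [set (e1.1, e2.1); (e2.1, e1.1)].
  pose Z2 := if b then Z1 :\: X else Z1 :|: X.
  have nX v : (v, v) \notin X.
    rewrite !inE !xpair_eqE; apply: contra z12.
    by case/orP => /andP [/eqP <- /eqP <-].
  have nl2 : loopless Z2.
    by move=> v; rewrite /Z2; case: (b); rewrite inE (negPf (nl1 v)) ?andbF //= (negPf (nX v)).
  have memZ2 u v : (u, v) \notin X -> ((u, v) \in Z2) = ((u, v) \in Z1).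
    by move=> h; rewrite /Z2; case: (b); rewrite inE (negPf h) //= orbF.
  have c2 : compatible Z2.
    split=> u v; have [/tight ->|h] := boolP ((u, v) \in X) => //; rewrite memZ2 //.
      exact: cin.
    by move=> uv; exact: cout.
  have m12 := mem1 _ _ a12 a21; have m21 := mem1 _ _ a21 a12.
  have degs v : (outn Z2 v)%:Z = (dg v)%:Z /\ (inn Z2 v)%:Z = (dg v)%:Z.
    have [] := deg1 v; rewrite Zo Zi /Z2.
    have [bT|bF] := boolP b.
      have [] := @outn_add (Z1 :\: X) e1.1 e2.1 v z12.
      - by rewrite !inE eqxx.
      - by rewrite !inE eqxx orbT.
      rewrite -/X.
      have -> : Z1 :\: X :|: X = Z1.
        apply/setP=> e; rewrite [LHS]inE [X in X || _]inE; case: (boolP (e \in X)) => //=; last by rewrite orbF.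
        by rewrite !inE => /orP [] /eqP ->; rewrite ?m12 ?m21 -?symz; exact: esym bT.
      move=> -> ->; move: (outn (Z1 :\: X) v) (inn (Z1 :\: X) v) (dg v).
      by case: (v == e1.1); case: (v == e2.1); clear; rewrite /sgb /=; lia.
    have [] := @outn_add Z1 e1.1 e2.1 v z12.
    - by rewrite m12.
    - by rewrite m21 -symz.
    rewrite -/X => -> -> -> ->; move: (dg v).
    by case: (v == e1.1); case: (v == e2.1); clear; rewrite /sgb /=; lia.
  have A2 : asym Z2 \subset asym Z1.
    rewrite /Z2; case: (b); [apply: asym_subsym|apply: asym_addsym];
      move=> e; exact: swap_pair.
  apply: (reduce _ _ c2).
    by apply/realizes_digraphP; split=> // v; have [[h1] [h2]] := degs v.
  have A1' : asym Z1 \subset asym Z by rewrite A1 subsetDl.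
  apply: (lt_asym _ e1) => //; last exact: subset_trans A1'.
  by apply: contraL e1E => /(subsetP A2); rewrite A1 !inE connect0.
have [E0|/set0Pn [e0 e0E]] := eqVneq (asym Z) set0.
  by exists Z; split=> //; rewrite leq_addr.
have [e1 [e1E w1 _ _]] := zero _ e0E.
have [/existsP [e0' /andP [e0'E n1]]|] :=
    boolP [exists e, (e \in asym Z) && ~~ fconnect phi e1 e]; last first.
  rewrite negb_exists => /forallP all1.
  (* A single orbit would have odd size, but the even degree sum makes the number of asymmetric arcs
     even. *)
  have := even_asym nl; rewrite card_digraph (eq_bigr dg) // => /(_ ev).
  suff -> : #|asym Z| = order phi e1 by rewrite odds.
  apply: eq_card => e; rewrite [RHS]inE; apply/idP/idP => h.
    by have := all1 e; rewrite h negbK.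
  by apply: (subsetP (rotation_orbit rot e1E)); rewrite inE.
have [e2 [e2E w2 _ conn2]] := zero _ e0'E.
have n12 : ~~ fconnect phi e1 e2.
  by rewrite (fconnect_sym phiI) conn2 (fconnect_sym phiI).
have [s12|s12] := eqVneq (side e1.1) (side e2.1); first exact: (same e1 e2).
(* Among three orbits, two have their zeros on the same side. *)
have [/existsP [e /and3P [eE n1e n2e]]|] :=
    boolP [exists e, [&& e \in asym Z, ~~ fconnect phi e1 e & ~~ fconnect phi e2 e]].
  have [e3 [e3E w3 _ conn3]] := zero _ eE.
  have n13 : ~~ fconnect phi e1 e3 by rewrite (fconnect_sym phiI) conn3 (fconnect_sym phiI).
  have n23 : ~~ fconnect phi e2 e3 by rewrite (fconnect_sym phiI) conn3 (fconnect_sym phiI).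
  have [s13|s13] := eqVneq (side e1.1) (side e3.1); first exact: (same e1 e3).
  apply: (same e2 e3) => //.
  by move: s12 s13; case: (side _); case: (side _); case: (side _).
rewrite negb_exists => /forallP all2.
(* Exactly two orbits remain, with zeros on opposite sides. Both base points lose a degree, and the
   crossing edge between them restores it; that edge is absent from [Z] because its [w]-sum is 0 and
   not at least 2. *)
have [Z1 [nl1 c1 A1 deg1 mem1]] := recolor_two false false nl cZ rot e1E e2E n12
    (odds _ e1E) (odds _ e2E).
have A10 : asym Z1 = set0.
  apply/setP=> e; rewrite A1 in_setD in_setU in_set0; have := all2 e.
  have -> : (e \in [set e | fconnect phi e1 e]) = fconnect phi e1 e by rewrite inE.
  have -> : (e \in [set e | fconnect phi e2 e]) = fconnect phi e2 e by rewrite inE.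
  by case: (e \in asym Z); case: (fconnect phi e1 e); case: (fconnect phi e2 e).
have z12 := tails _ _ e1E e2E n12.
have a12 := nadj _ _ e1E e2E n12; have a21 := nadj _ _ e2E e1E (conn_sym _ _ n12).
have nZ : (e1.1, e2.1) \notin Z.
  by apply/negP => /(cZ.1); rewrite w1 w2 /cross s12.
have nZ' : (e2.1, e1.1) \notin Z.
  by apply/negP => /(cZ.1); rewrite w1 w2 /cross eq_sym s12.
have degs v := @outn_add Z1 e1.1 e2.1 v z12.
exists (Z1 :|: [set (e1.1, e2.1); (e2.1, e1.1)]); split.
- apply/realizes_digraphP; split=> v.
  + have [] := degs v; rewrite ?mem1 //; have [-> ->] := deg1 v; rewrite Zo Zi /sgb.
    by move: (outn _ _) (inn _ _) (dg v); case: (v == e1.1); case: (v == e2.1); clear; rewrite /=; lia.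
  + have [] := degs v; rewrite ?mem1 //; have [-> ->] := deg1 v; rewrite Zo Zi /sgb.
    by move: (outn _ _) (inn _ _) (dg v); case: (v == e1.1); case: (v == e2.1); clear; rewrite /=; lia.
  + rewrite inE (negPf (nl1 v)) /= !inE !xpair_eqE; apply: contra z12.
    by case/orP => /andP [/eqP <- /eqP <-].
- apply/eqP; rewrite -subset0 -A10; apply: asym_addsym => e; exact: swap_pair.
- apply: leq_trans (cross_count_add _ _ _) _.
  rewrite (@cross_count_compatible Z Z1) // => v wv.
  have v1 : v == e1.1 = false by apply: contraNF wv => /eqP ->; rewrite w1.
  have v2 : v == e2.1 = false by apply: contraNF wv => /eqP ->; rewrite w2.
  by have [] := deg1 v; rewrite v1 v2 !addr0 => -[->] [->].
Qed.
End Symmetrize.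

(** * Counting crossing arcs *)

Lemma sum_minn D k : (k <= D.+1)%N ->
  (2 * (\sum_(x < D.+1) minn x k) + k * (k - 1) = 2 * (k * D))%N.
Proof.
elim: D k => [|D IHD] k lek.
  rewrite big_ord_recl big_ord0 /= min0n; have : (k = 0 \/ k = 1)%N by lia.
  by case=> ->.
rewrite big_ord_recr /=; move: lek; rewrite leq_eqVlt => /predU1P [->|].
  have -> : (\sum_(i < D.+1) minn i D.+2 = \sum_(i < D.+1) minn i D.+1)%N.
    by apply: eq_bigr => i _; have := ltn_ord i; lia.
  by have := IHD D.+1 (leqnn _); rewrite minnE; nia.
rewrite ltnS => lek; have := IHD k lek.
have -> : minn D.+1 k = k by lia.
set S := (\sum_(i < _) _)%N; move: S (k * (k - 1))%N (k * D)%N (mulnS k D) => S a b e; rewrite e => h; lia.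
Qed.

Lemma sum_subn_le g k : (2 * (\sum_(j < k) (g - j)) <= g * g.+1)%N.
Proof.
elim: g k => [|g IHg] k; first by rewrite big1 // => i _; rewrite sub0n.
case: k => [|k]; first by rewrite big_ord0.
rewrite big_ord_recl /= subn0.
rewrite (eq_bigr (fun i : 'I_k => (g - i)%N)) => [|i _]; last by rewrite /bump /= subSS.
by have := IHg k; set S := (\sum_(i < k) _)%N; move: S => S; nia.
Qed.

Lemma sum_subset_le (T : finType) (S1 S2 : {set T}) (F : T -> int) :
  (forall x, 0 <= F x) -> S1 \subset S2 ->
  \sum_(x in S1) F x <= \sum_(x in S2) F x.
Proof.
move=> F0 sub; rewrite [leRHS](big_setID S1) /= (setIidPr sub) lerDl.
by apply: sumr_ge0 => x _.
Qed.

(** This is applied to each half, with [H] its vertices of large potential and [f v] the number of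
    arcs between [v] and [H]. The representatives lying in [H] have distinct degrees [x], so the
    degree sum over [H] misses [#|H|] times [D] by at least the sum of their gaps [D - x]. *)
Lemma half_bound (V : finType) (dg : V -> nat) (D : nat) (S H : {set V})
    (f : V -> int) (P : {set 'I_D.+1}) (a : 'I_D.+1 -> V) :
  (forall v, (dg v <= D)%N) -> H \subset S -> (forall v, 0 <= f v) ->
  (forall v, v \in H -> f v = #|H|%:Z - 1) ->
  (forall x, x \in P -> a x \in S /\ dg (a x) = x) ->
  2 * (\sum_(v in H) (dg v)%:Z - \sum_(v in S) f v) <=
  2 * #|H|%:Z * D%:Z - 2 * #|H|%:Z * (#|H|%:Z - 1) + #|H|%:Z * (#|H|%:Z + 1)
  - 2 * \sum_(x in P) (if a x \in H then #|H|%:Z else f (a x))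
  - 2 * \sum_(v in (S :\: H) :\: (a @: P)) f v.
Proof.
move=> dg_le sHS f0 fH aP.
have inja (Q : {set 'I_D.+1}) : Q \subset P -> {in Q &, injective a}.
  move=> sQ x y /(subsetP sQ) /aP [_ dx] /(subsetP sQ) /aP [_ dy] exy.
  by apply/val_inj; rewrite /= -dx -dy exy.
pose Q1 := [set x in P | a x \in H]; pose Q2 := [set x in P | a x \notin H].
have sQ1 : Q1 \subset P by apply/subsetP=> x; rewrite inE => /andP [].
have sQ2 : Q2 \subset P by apply/subsetP=> x; rewrite inE => /andP [].
have splitP (F : 'I_D.+1 -> int) : \sum_(x in P) F x = \sum_(x in Q1) F x + \sum_(x in Q2) F x.
  rewrite (bigID (fun x => a x \in H)) /=.
  by congr (_ + _); apply: eq_bigl => x; rewrite inE.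
have E1 : \sum_(v in S) f v = #|H|%:Z * (#|H|%:Z - 1) + \sum_(x in Q2) f (a x)
    + \sum_(v in (S :\: H) :\: (a @: P)) f v.
  rewrite (big_setID H) /= (setIidPr sHS) (eq_bigr _ fH) sumr_const -mulr_natl natz.
  rewrite -addrA; congr (_ + _); rewrite (big_setID (a @: P)) /=; congr (_ + _).
  rewrite -(big_imset _ (inja _ sQ2)) /=.
  apply: eq_bigl => v; rewrite !inE; apply/idP/imsetP.
    move=> /andP [/andP [vH vS] /imsetP [x xP ev]]; exists x => //.
    by rewrite inE xP -ev vH.
  move=> [x]; rewrite inE => /andP [xP axH] ->; rewrite axH (aP _ xP).1 /=.
  exact: imset_f.
have E2 : \sum_(v in H) (dg v)%:Z <= #|H|%:Z * D%:Z - \sum_(x in Q1) (D%:Z - x%:Z).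
  have -> : \sum_(x in Q1) (D%:Z - x%:Z) = \sum_(v in a @: Q1) (D%:Z - (dg v)%:Z).
    rewrite (big_imset _ (inja _ sQ1)) /=.
    by apply: eq_bigr => x /(subsetP sQ1) /aP [_ ->].
  have : \sum_(v in a @: Q1) (D%:Z - (dg v)%:Z) <= \sum_(v in H) (D%:Z - (dg v)%:Z).
    apply: sum_subset_le => [v|]; first by have := dg_le v; lia.
    by apply/subsetP=> v /imsetP [x]; rewrite inE => /andP [_ axH] ->.
  rewrite [X in _ <= X]sumrB sumr_const -mulr_natl natz.
  set s1 := \sum_(v in a @: _) _; set s2 := \sum_(v in H) _; move: s1 s2 => s1 s2 h; lia.
(* The gaps [D - x] are distinct, so replacing each of them by [#|H|] costs at most [#|H|] plus
   [#|H| - 1] and so on down to 1. *)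
have E3 : 2 * \sum_(x in Q1) (#|H|%:Z - (D%:Z - x%:Z)) <= #|H|%:Z * (#|H|%:Z + 1).
  have := sum_subn_le #|H| D.+1; rewrite -(big_mkord xpredT (fun j => #|H| - j)%N).
  rewrite big_nat_rev /= add0n big_mkord => h.
  have : \sum_(x in Q1) (#|H|%:Z - (D%:Z - x%:Z)) <=
      (\sum_(i < D.+1) (#|H| - (D.+1 - i.+1)))%N%:Z.
    rewrite (big_morph Posz PoszD (erefl _)) big_mkcond /=; apply: ler_sum => x _.
    by have := ltn_ord x; case: ifP => _; lia.
  set s1 := \sum_(x in Q1) _; set s2 := (\sum_(i < _) _)%N in h * => h'.
  by move: h h'; move: s1 s2 (#|H|) => s1 s2 g h h'; nia.
rewrite splitP (eq_bigr (fun=> #|H|%:Z) (P := fun x => x \in Q1)); last first.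
  by move=> x; rewrite inE => /andP [_ ->].
rewrite [X in _ - 2 * (_ + X)](eq_bigr (fun x => f (a x))); last first.
  by move=> x; rewrite inE => /andP [_ /negPf ->].
rewrite E1; move: E2 E3; rewrite !sumrB.
set s0 := \sum_(x in Q1) #|H|%:Z; set s1 := \sum_(x in Q1) D%:Z.
set s2 := \sum_(x in Q1) _; set s3 := \sum_(x in Q2) _.
set s4 := \sum_(v in _ :\: _) _; set s5 := \sum_(v in H) _.
by move: s0 s1 s2 s3 s4 s5 (#|H|) => s0 s1 s2 s3 s4 s5 g; nia.
Qed.

Section Counting.
Variables (V : finType) (side : V -> bool) (dg : V -> nat) (w : V -> int).
Variables (Z : {set V * V}) (D : nat).
Hypotheses (rZ : realizes_digraph dg Z) (cZ : compatible side w Z).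
Hypotheses (dg_le : forall v, (dg v <= D)%N) (dg_ge : forall v, (2 <= dg v)%N).
Implicit Types (u v : V).

Definition entry u v : int := ((u, v) \in Z : nat)%:Z.
Definition sideA : {set V} := [set v | side v].
Definition sideB : {set V} := [set v | ~~ side v].
(** The thresholds 1 and 2 differ so that the critical sum 2 never decides a crossing pair of equal
    kind: two hubs on opposite sides sum to at least 3 and are joined, two non-hubs sum to at most 1
    and are not. Hubs on one side have positive sum and are joined as well. *)
Definition hubA : {set V} := [set v | side v && (1 <= w v)].
Definition hubB : {set V} := [set v | ~~ side v && (2 <= w v)].
Definition hub_in v : int := \sum_(u in hubA) entry u v.
Definition hub_out v : int := \sum_(u in hubB) entry v u.
Definition cutAB : int := \sum_(u in sideA) \sum_(v in sideB) entry u v.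

Lemma entry01 u v : 0 <= entry u v <= 1.
Proof. by rewrite /entry; case: (_ \in Z). Qed.

Lemma entry1 u v : u != v -> 2 * (cross side u v : nat)%:Z < w u + w v -> entry u v = 1.
Proof.
move=> uv lt; rewrite /entry; case: (boolP (_ \in Z)) => // /(cZ.2 _ _ uv); lia.
Qed.

Lemma entry0 u v : w u + w v < 2 * (cross side u v : nat)%:Z -> entry u v = 0.
Proof. move=> lt; rewrite /entry; case: (boolP (_ \in Z)) => // /(cZ.1); lia. Qed.

Lemma entry_loop v : entry v v = 0.
Proof. by have [_ _ nl] := realizes_digraphP _ _ rZ; rewrite /entry (negPf (nl v)). Qed.

Lemma sum_entry_out u : \sum_v entry u v = (dg u)%:Z.
Proof. by have [<- _ _] := realizes_digraphP _ _ rZ; rewrite outnE. Qed.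

Lemma sum_entry_in u : \sum_v entry v u = (dg u)%:Z.
Proof. by have [_ <- _] := realizes_digraphP _ _ rZ; rewrite innE. Qed.

Lemma sum_sides (F : V -> int) : \sum_(v in sideA) F v + \sum_(v in sideB) F v = \sum_v F v.
Proof.
rewrite [RHS](bigID side) /=; congr (_ + _); by apply: eq_bigl => v; rewrite inE.
Qed.

Lemma disj_sides u v : u \in sideA -> v \in sideB -> u != v.
Proof. by rewrite !inE => su; apply: contraNneq => <-. Qed.

Lemma hubA_sub : hubA \subset sideA.
Proof. by apply/subsetP=> v; rewrite !inE => /andP []. Qed.
Lemma hubB_sub : hubB \subset sideB.
Proof. by apply/subsetP=> v; rewrite !inE => /andP []. Qed.

Lemma cutAB_entry u v : u \in sideA -> v \in sideB -> entry u v =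
  (if u \in hubA then entry u v else 0) + (if v \in hubB then entry u v else 0)
  - ((u \in hubA) && (v \in hubB) : nat)%:Z.
Proof.
move=> uA vB; have uv := disj_sides uA vB; move: uA vB; rewrite !inE => su sv.
have cr : cross side u v by rewrite /cross su (negPf sv).
rewrite su sv /=; case: (lerP 1 (w u)) => h1; case: (lerP 2 (w v)) => h2 /=.
- by rewrite entry1 // cr; lia.
- by rewrite addr0 subr0.
- by rewrite add0r subr0.
- by rewrite entry0 // cr; lia.
Qed.

Lemma hub_in_hub v : v \in hubA -> hub_in v = #|hubA|%:Z - 1.
Proof.
move=> vC; rewrite /hub_in (bigD1 v) //= entry_loop add0r.
rewrite (eq_bigr (fun=> 1)) => [|u /andP [uC uv]]; last first.
  apply: entry1 => //; move: uC vC; rewrite !inE /cross => /andP [-> h1] /andP [-> h2].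
  by rewrite eqxx; lia.
rewrite (eq_bigl (mem (hubA :\ v))) => [|u]; last by rewrite !inE andbC.
by rewrite sumr_const natz [in RHS](cardsD1 v) vC; lia.
Qed.

Lemma hub_out_hub v : v \in hubB -> hub_out v = #|hubB|%:Z - 1.
Proof.
move=> vC; rewrite /hub_out (bigD1 v) //= entry_loop add0r.
rewrite (eq_bigr (fun=> 1)) => [|u /andP [uC uv]]; last first.
  apply: entry1; first by rewrite eq_sym.
  move: uC vC; rewrite !inE /cross => /andP [/negPf -> h1] /andP [/negPf -> h2].
  by rewrite eqxx; lia.
rewrite (eq_bigl (mem (hubB :\ v))) => [|u]; last by rewrite !inE andbC.
by rewrite sumr_const natz [in RHS](cardsD1 v) vC; lia.
Qed.

(** Every arc from A to B starts or ends at a hub, and those doing both, which are all present, are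
    counted twice. The arcs from a hub of A into B are its out-degree less the arcs staying in A,
    and dually for arcs into a hub of B. *)
Lemma cutAB_formula : cutAB = \sum_(v in hubA) (dg v)%:Z + \sum_(v in hubB) (dg v)%:Z
  - #|hubA|%:Z * #|hubB|%:Z - \sum_(v in sideA) hub_in v - \sum_(v in sideB) hub_out v.
Proof.
have E1 : \sum_(u in sideA) \sum_(v in sideB) (if u \in hubA then entry u v else 0) =
    \sum_(v in hubA) (dg v)%:Z - \sum_(v in sideA) hub_in v.
  rewrite /hub_in [X in _ - X]exchange_big /=.
  rewrite -sumrB (eq_bigr (fun u => if u \in hubA then \sum_(v in sideB) entry u v else 0));
    last by move=> u _; case: ifP => // _; rewrite big1.
  rewrite -big_mkcondr /= (eq_bigl (mem hubA)) => [|u]; last first.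
    by apply/andb_idl/(subsetP hubA_sub).
  apply: eq_bigr => u uC; by rewrite -sum_entry_out -(sum_sides (entry u)) addrAC subrr add0r.
have E2 : \sum_(u in sideA) \sum_(v in sideB) (if v \in hubB then entry u v else 0) =
    \sum_(v in hubB) (dg v)%:Z - \sum_(v in sideB) hub_out v.
  rewrite exchange_big /= /hub_out [X in _ - X]exchange_big /=.
  rewrite -sumrB (eq_bigr (fun u => if u \in hubB then \sum_(v in sideA) entry v u else 0));
    last by move=> u _; case: ifP => // _; rewrite big1.
  rewrite -big_mkcondr /= (eq_bigl (mem hubB)) => [|u]; last first.
    by apply/andb_idl/(subsetP hubB_sub).
  apply: eq_bigr => u uC; by rewrite -sum_entry_in -(sum_sides (entry ^~ u)) addrK.
have E3 : \sum_(u in sideA) \sum_(v in sideB) ((u \in hubA) && (v \in hubB) : nat)%:Z =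
    #|hubA|%:Z * #|hubB|%:Z :> int.
  rewrite (eq_bigr (fun u => (u \in hubA : nat)%:Z * #|hubB|%:Z)) => [|u _]; last first.
    case: (u \in hubA) => /=; last by rewrite big1 // mul0r.
    rewrite mul1r -sum1_card (big_morph Posz PoszD (erefl _)) [RHS]big_mkcond.
    rewrite [LHS]big_mkcond /=; apply: eq_bigr => v _.
    by have := subsetP hubB_sub v; case: (v \in hubB) => [->|_] //; case: ifP.
  rewrite -mulr_suml; congr (_ * _).
  rewrite -sum1_card (big_morph Posz PoszD (erefl _)) [RHS]big_mkcond.
  rewrite [LHS]big_mkcond /=; apply: eq_bigr => v _.
  by have := subsetP hubA_sub v; case: (v \in hubA) => [->|_] //; case: ifP.
rewrite /cutAB (eq_bigr (fun u => \sum_(v in sideB)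
   (if u \in hubA then entry u v else 0) + \sum_(v in sideB) (if v \in hubB then entry u v else 0)
  - \sum_(v in sideB) ((u \in hubA) && (v \in hubB) : nat)%:Z)) => [|u uA]; last first.
  by rewrite -big_split -sumrB /=; apply: eq_bigr => v vB; apply: cutAB_entry.
rewrite sumrB big_split /= E1 E2 E3; ring.
Qed.

(** The hubs of both sides are pairwise joined, so the degree of any one of them is at least the
    number of the others. *)
Lemma hub_card_le : (#|hubA| + #|hubB| <= D.+1)%N.
Proof.
have [|/eqP nz] := eqVneq (#|hubA| + #|hubB|)%N 0%N; first by move=> ->.
have [v vH] : exists v, v \in hubA :|: hubB.
  apply/set0Pn/eqP => H; apply: nz.
  have -> : hubA = set0 by apply/eqP; rewrite -subset0 -H subsetUl.
  have -> : hubB = set0 by apply/eqP; rewrite -subset0 -H subsetUr.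
  by rewrite cards0.
have -> : (#|hubA| + #|hubB| = #|hubA :|: hubB|)%N.
  rewrite cardsU [hubA :&: hubB](_ : _ = set0) ?cards0 ?subn0 //.
  by apply/setP=> u; rewrite !inE; case: (side u); rewrite ?andbF.
rewrite (cardsD1 v) vH ltnS; apply: leq_trans (dg_le v).
have [<- _ _] := realizes_digraphP _ _ rZ; apply: subset_leq_card.
apply/subsetP=> u; rewrite !inE => /andP [uv uH].
suff : entry v u = 1 by rewrite /entry; case: (_ \in Z).
apply: entry1; first by rewrite eq_sym.
move: vH uH; rewrite !inE /cross.
by case: (side v); case: (side u) => /=; rewrite ?orbF; lia.
Qed.

Lemma hub_in_ge0 v : 0 <= hub_in v.
Proof. by apply: sumr_ge0 => u _; have /andP [] := entry01 u v. Qed.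

Lemma hub_out_ge0 v : 0 <= hub_out v.
Proof. by apply: sumr_ge0 => u _; have /andP [] := entry01 v u. Qed.

Definition far_in v : int := \sum_(u in hubB) entry u v.
Definition far_out v : int := \sum_(u in hubA) entry v u.

Lemma far_in_le v : far_in v <= #|hubB|%:Z.
Proof.
apply: le_trans (_ : \sum_(u in hubB) 1 <= _); last by rewrite sumr_const natz.
by apply: ler_sum => u _; have /andP [] := entry01 u v.
Qed.

Lemma far_out_le v : far_out v <= #|hubA|%:Z.
Proof.
apply: le_trans (_ : \sum_(u in hubA) 1 <= _); last by rewrite sumr_const natz.
by apply: ler_sum => u _; have /andP [] := entry01 v u.
Qed.

(** A non-hub of A has potential at most 0. At 0 its sum with every hub of A is positive, which
    forces the arc; below 0 its sum with every non-hub is too small for an arc, so all its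
    in-neighbours are hubs. *)
Lemma hub_in_cases v : v \in sideA :\: hubA ->
  (w v = 0 /\ hub_in v = #|hubA|%:Z) \/
  (w v <= -1 /\ (dg v)%:Z = hub_in v + far_in v).
Proof.
rewrite !inE => /andP [nC sv]; move: nC; rewrite sv /= -ltNge => wv.
have [w0|w1] := eqVneq (w v) 0; [left|right]; split=> //; last 1 first.
- rewrite -sum_entry_in -sum_sides; congr (_ + _).
    rewrite [LHS](big_setID hubA) /= (setIidPr hubA_sub) [X in _ + X]big1 ?addr0 // => u.
    rewrite !inE => /andP [nu su]; apply: entry0; move: nu; rewrite su /cross su sv /=; lia.
  rewrite [LHS](big_setID hubB) /= (setIidPr hubB_sub) [X in _ + X]big1 ?addr0 // => u.
  rewrite !inE => /andP [nu su]; apply: entry0; move: nu; rewrite su /cross (negPf su) sv /=; lia.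
- rewrite /hub_in (eq_bigr (fun=> 1)) ?sumr_const ?natz // => u.
  rewrite inE => /andP [su wu]; apply: entry1; last by rewrite /cross su sv /=; lia.
  by apply: contraTneq wu => ->; rewrite w0.
- lia.
Qed.

Lemma hub_out_cases v : v \in sideB :\: hubB ->
  (hub_out v = #|hubB|%:Z) \/
  (w v <= -2 /\ (dg v)%:Z = hub_out v + far_out v).
Proof.
rewrite !inE => /andP [nC sv]; move: nC; rewrite sv /= -ltNge => wv.
have [w0|w1] := lerP (-1) (w v); [left|right].
- rewrite /hub_out (eq_bigr (fun=> 1)) ?sumr_const ?natz // => u.
  rewrite inE => /andP [su wu]; apply: entry1; last by rewrite /cross (negPf su) (negPf sv) /=; lia.
  by apply: contraTneq wu => <-; lia.
- split; first lia.
  rewrite -sum_entry_out -sum_sides addrC; congr (_ + _).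
    rewrite [LHS](big_setID hubB) /= (setIidPr hubB_sub) [X in _ + X]big1 ?addr0 // => u.
    rewrite !inE => /andP [nu su]; apply: entry0; move: nu; rewrite su /cross (negPf su) (negPf sv) /=; lia.
  rewrite [LHS](big_setID hubA) /= (setIidPr hubA_sub) [X in _ + X]big1 ?addr0 // => u.
  rewrite !inE => /andP [nu su]; apply: entry0; move: nu; rewrite su /cross su (negPf sv) /=; lia.
Qed.

(** The hard case is when both vertices are adjacent to hubs only. An arc from [v'] to a hub [u] of
    A needs [w u >= 2 - w v'], while an arc from [u] to [v] is forced once [w u > - w v]. Comparing
    the two thresholds gives [far_out v' <= hub_in v], or else symmetrically
    [far_in v <= hub_out v']. *)
Lemma hub_pair v v' : v \in sideA :\: hubA -> v' \in sideB :\: hubB ->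
  [\/ (dg v)%:Z <= hub_in v + hub_out v', (dg v')%:Z <= hub_in v + hub_out v' |
      #|hubA|%:Z + #|hubB|%:Z <= hub_in v + hub_out v'].
Proof.
move=> vA vB; have fi := far_in_le v; have fo := far_out_le v'.
case: (hub_in_cases vA) => [[_ ->]|[w1 d1]]; case: (hub_out_cases vB) => [->|[w2 d2]].
- by constructor 3.
- by constructor 2; lia.
- by constructor 1; lia.
have sv : side v by move: vA; rewrite !inE => /andP [].
have sv' : side v' = false by move: vB; rewrite !inE => /andP [_ /negPf].
have [h|h] := ltrP (- w v) (2 - w v').
  constructor 2; suff : far_out v' <= hub_in v by lia.
  apply: ler_sum => u; rewrite inE => /andP [su wu].
  have [h1|h1] := ltrP (w u) (2 - w v').
    rewrite entry0; first by have /andP [] := entry01 u v.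
    by rewrite /cross su sv' /=; lia.
  rewrite [leRHS]entry1; first by have /andP [] := entry01 v' u.
    by apply: contraTneq wu => ->; lia.
  by rewrite /cross su sv /=; lia.
constructor 1; suff : far_in v <= hub_out v' by lia.
apply: ler_sum => u; rewrite inE => /andP [/negPf su wu].
have [h1|h1] := ltrP (w u) (2 - w v).
  rewrite entry0; first by have /andP [] := entry01 v' u.
  by rewrite /cross su sv /=; lia.
rewrite [leRHS]entry1; first by have /andP [] := entry01 u v.
  by apply: contraTneq wu => <-; lia.
by rewrite /cross su sv' /=; lia.
Qed.

Variables (P : {set 'I_D.+1}) (a b : 'I_D.+1 -> V) (L : nat).
Hypothesis aP : forall x, x \in P -> a x \in sideA /\ dg (a x) = x.
Hypothesis bP : forall x, x \in P -> b x \in sideB /\ dg (b x) = x.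
Hypothesis szA : (#|P| + D.+1 + L <= #|sideA|)%N.
Hypothesis szB : (#|P| + D.+1 + L <= #|sideB|)%N.
Local Notation kappa := (#|hubA| + #|hubB|)%N.

Lemma rep_bound x : x \in P -> (minn x kappa)%:Z <=
  (if a x \in hubA then #|hubA|%:Z else hub_in (a x)) +
  (if b x \in hubB then #|hubB|%:Z else hub_out (b x)).
Proof.
move=> xP; have [aA da] := aP xP; have [bB db] := bP xP.
have fi := far_in_le (a x); have fo := far_out_le (b x).
case: ifP => ha; case: ifP => hb.
- lia.
- have : b x \in sideB :\: hubB by rewrite inE hb bB.
  by move/hub_out_cases => [->|[_ d1]]; lia.
- have : a x \in sideA :\: hubA by rewrite inE ha aA.
  by move/hub_in_cases => [[_ ->]|[_ d1]]; lia.
have /hub_pair H : a x \in sideA :\: hubA by rewrite inE ha aA.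
have /H : b x \in sideB :\: hubB by rewrite inE hb bB.
by case; lia.
Qed.

(** Any vertex of [RA] and any vertex of [RB] together contribute at least [minn 2 kappa], since all
    degrees are at least 2. If some vertex of [RA] falls short of this, the least value on [RA]
    bounds all of [RA], and its complement to [minn 2 kappa] bounds all of [RB]. *)
Lemma extra_bound (RA RB : {set V}) k :
  RA \subset sideA :\: hubA -> RB \subset sideB :\: hubB ->
  (k <= #|RA|)%N -> (k <= #|RB|)%N ->
  (minn 2 kappa * k)%:Z <= \sum_(v in RA) hub_in v + \sum_(v in RB) hub_out v.
Proof.
move=> sA sB kA kB.
have low (R : {set V}) (f : V -> int) t : (k <= #|R|)%N -> 0 <= t ->
    (forall v, v \in R -> t <= f v) -> t * k%:Z <= \sum_(v in R) f v.
  move=> kR t0 tf; apply: (@le_trans _ _ (\sum_(v in R) t)); last exact: ler_sum.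
  by rewrite sumr_const -mulr_natr natz ler_wpM2l.
have pr v v' : v \in RA -> v' \in RB -> (minn 2 kappa)%:Z <= hub_in v + hub_out v'.
  move=> /(subsetP sA) vA /(subsetP sB) vB.
  by have := dg_ge v; have := dg_ge v'; case: (hub_pair vA vB); lia.
have RA0 : 0 <= \sum_(v in RA) hub_in v by apply: sumr_ge0 => v _; exact: hub_in_ge0.
have RB0 : 0 <= \sum_(v in RB) hub_out v by apply: sumr_ge0 => v _; exact: hub_out_ge0.
have [/forallP H|] := boolP [forall v, (v \in RA) ==> ((minn 2 kappa)%:Z <= hub_in v)].
  rewrite PoszM; have := @low RA hub_in (minn 2 kappa) kA isT.
  move=> /(_ (fun v vR => implyP (H v) vR)); lia.
rewrite negb_forall => /existsP [v0]; rewrite negb_imply -ltNge => /andP [v0R lt0].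
pose v1 := [arg min_(v < v0 in RA) hub_in v]%O.
have [v1R v1min] : v1 \in RA /\ forall v, v \in RA -> hub_in v1 <= hub_in v.
  by rewrite /v1; case: arg_minP.
have h1 := @low RA hub_in _ kA (hub_in_ge0 v1) v1min.
have v10 := v1min _ v0R.
have h2 : ((minn 2 kappa)%:Z - hub_in v1) * k%:Z <= \sum_(v in RB) hub_out v.
  apply: low => //; first lia.
  by move=> v vB; have := pr _ _ v1R vB; lia.
by rewrite PoszM; lia.
Qed.

(** Adding the two halves, the quadratic terms in the numbers of hubs combine into those of
    [sum_minn]. What remains is the sum of [minn x kappa] over missing degrees, plus [kappa], minus
    the contribution of the vertices that are neither hubs nor representatives. The three outcomes
    belong to [kappa = 0], [kappa >= 2] and [kappa = 1]; in the second, [kappa = D.+1] is the worst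
    value. *)
Theorem cutAB_bound : let c := (\sum_(x : 'I_D.+1 | x \notin P) x)%N in
  [\/ cutAB <= 0, cutAB + 2 * L%:Z <= c%:Z + D%:Z + 1 | cutAB + L%:Z <= c%:Z + 1].
Proof.
move=> c.
have HA := @half_bound V dg D sideA hubA hub_in P a dg_le hubA_sub hub_in_ge0 hub_in_hub aP.
have HB := @half_bound V dg D sideB hubB hub_out P b dg_le hubB_sub hub_out_ge0 hub_out_hub bP.
have kD := hub_card_le.
have S1 : (\sum_(x in P) minn x kappa)%N%:Z <=
    \sum_(x in P) (if a x \in hubA then #|hubA|%:Z else hub_in (a x)) +
    \sum_(x in P) (if b x \in hubB then #|hubB|%:Z else hub_out (b x)).
  by rewrite (big_morph Posz PoszD (erefl _)) -big_split /=; apply: ler_sum; exact: rep_bound.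
have S2 := sum_minn kD.
have S3 : (\sum_(x < D.+1) minn x kappa = \sum_(x in P) minn x kappa +
    \sum_(x : 'I_D.+1 | x \notin P) minn x kappa)%N by rewrite (bigID (mem P)).
have S4 k : (\sum_(x : 'I_D.+1 | x \notin P) minn x k <= c)%N.
  by apply: leq_sum => x _; rewrite geq_minl.
have ext : (minn 2 kappa * (D.+1 - kappa + L))%N%:Z <=
    \sum_(v in (sideA :\: hubA) :\: (a @: P)) hub_in v +
    \sum_(v in (sideB :\: hubB) :\: (b @: P)) hub_out v.
  have card (S H : {set V}) (f : 'I_D.+1 -> V) : (#|P| + D.+1 + L <= #|S|)%N ->
      (#|H| <= kappa)%N -> (D.+1 - kappa + L <= #|(S :\: H) :\: (f @: P)|)%N.
    move=> sz hk; have h1 : (#|f @: P| <= #|P|)%N by exact: leq_imset_card.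
    rewrite !cardsD.
    have := subset_leq_card (subsetIr S H).
    have := subset_leq_card (subsetIr (S :\: H) (f @: P)).
    by move: h1 sz hk; lia.
  by apply: extra_bound; rewrite ?subsetDl ?card // ?leq_addl ?leq_addr.
have cf := cutAB_formula.
have main : cutAB <= (\sum_(x : 'I_D.+1 | x \notin P) minn x kappa)%N%:Z + kappa%:Z -
    (minn 2 kappa * (D.+1 - kappa + L))%N%:Z.
  move: HA HB S1 S2 S3 ext cf.
  set s1 := \sum_(v in hubA) _; set s2 := \sum_(v in hubB) _.
  set s3 := \sum_(v in sideA) _; set s4 := \sum_(v in sideB) _.
  set s5 := \sum_(x in P) _; set s6 := \sum_(x in P) _.
  set s7 := \sum_(v in _ :\: _) _; set s8 := \sum_(v in _ :\: _) _.
  set t1 := (\sum_(x in P) _)%N; set t2 := (\sum_(x < D.+1) _)%N.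
  set t3 := (\sum_(x | _) _)%N; set ex := (minn 2 _ * _)%N.
  move: s1 s2 s3 s4 s5 s6 s7 s8 t1 t2 t3 ex (#|hubA|) (#|hubB|) cutAB.
  move=> s1 s2 s3 s4 s5 s6 s7 s8 t1 t2 t3 ex g h cut HA HB S1 S2 S3 ext cf.
  have S2' : 2 * t2%:Z + (g + h)%:Z * ((g + h)%:Z - 1) = 2 * ((g + h)%:Z * D%:Z).
    by case: (g + h)%N S2 => [|m] S2; lia.
  by nia.
have [k0|k0] := eqVneq kappa 0%N.
  constructor 1; move: main; rewrite k0 minn0 mul0n.
  by rewrite (eq_bigr (fun=> 0%N)) ?sum_nat_const ?muln0 // => x _; rewrite minn0.
have [k1|k1] := eqVneq kappa 1%N.
  constructor 3; move: main; rewrite k1; have := S4 1%N.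
  by set s := (\sum_(x | _) _)%N => h1; set cc := cutAB; move: s cc h1 => s cc; lia.
constructor 2; move: main; have := S4 kappa.
have -> : minn 2 kappa = 2 by lia.
set s := (\sum_(x | _) _)%N => h1; set cc := cutAB; move: s cc kappa kD k0 k1 h1 => s cc k; lia.
Qed.

(** Equal out- and in-degrees make the number of arcs from A to B equal to the number of arcs
    back. *)
Lemma cross_count_cutAB : (cross_count side Z)%:Z = 2 * cutAB.
Proof.
have E1 : (cross_count side Z)%:Z = cutAB + \sum_(u in sideB) \sum_(v in sideA) entry u v.
  rewrite /cross_count (big_morph Posz PoszD (erefl _)).
  rewrite (eq_bigl (fun e : V * V => true && ((e.1, e.2) \in Z))); last by case.
  rewrite -(pair_big_dep xpredT (fun u v => (u, v) \in Z)
    (fun u v => (cross side u v : nat)%:Z)) /= -sum_sides; congr (_ + _).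
    apply: eq_bigr => u; rewrite inE => su.
    rewrite big_mkcond [RHS]big_mkcond; apply: eq_bigr => v _.
    by rewrite !inE /cross su /entry; case: (side v); case: (_ \in Z).
  apply: eq_bigr => u; rewrite inE => su.
  rewrite big_mkcond [RHS]big_mkcond; apply: eq_bigr => v _.
  by rewrite !inE /cross (negPf su) /entry; case: (side v); case: (_ \in Z).
have E2 : \sum_(u in sideA) (\sum_(v in sideA) entry u v + \sum_(v in sideB) entry u v) =
    \sum_(u in sideA) (\sum_(v in sideA) entry v u + \sum_(v in sideB) entry v u).
  by apply: eq_bigr => u _; rewrite !sum_sides sum_entry_out sum_entry_in.
move: E2; rewrite !big_split /= [X in X + _]exchange_big /= => /addrI.
by rewrite -/cutAB [RHS]exchange_big /= E1 => <-; rewrite mulr2n mulrDl mul1r.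
Qed.
End Counting.

(** * Switches and connectivity *)

Lemma connect_restrict (T : finType) (r r' : rel T) x y :
  (forall p q, connect r x p -> r p q -> r' p q) -> connect r x y -> connect r' x y.
Proof.
move=> H /connectP [p rp ->] {y}.
suff: path r' x p by move=> rp'; apply/connectP; exists p.
have Hp z : connect r x z -> path r z p -> path r' z p.
  elim: p z {rp} => //= a p IHp z cz /andP [rza rp].
  by rewrite (H _ _ cz rza) IHp //; apply: connect_trans cz (connect1 _).
exact: Hp.
Qed.

Section Switch.
Variables (V : finType) (side : V -> bool) (dg : V -> nat).
Implicit Types (Z : {set V * V}) (u v x y : V).
Local Notation cross := (cross side).
Local Notation cross_count := (cross_count side).

Definition graph_of Z := realizes_digraph dg Z /\ asym Z = set0.
Definition adj Z : rel V := fun u v => (u, v) \in Z.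
Definition edge x y : {set V * V} := [set (x, y); (y, x)].

Lemma graph_sym Z u v : asym Z = set0 -> ((u, v) \in Z) = ((v, u) \in Z).
Proof.
move=> sy.
have H a b : (a, b) \in Z -> (b, a) \in Z.
  move=> abZ; apply: contraT => baZ; have : (a, b) \in asym Z by rewrite inE abZ.
  by rewrite sy inE.
by apply/idP/idP; apply: H.
Qed.

Lemma in_edge x y a b : ((a, b) \in edge x y) =
  ((a == x) && (b == y)) || ((a == y) && (b == x)).
Proof. by rewrite !inE !xpair_eqE. Qed.

Lemma edge_loop x y t : x != y -> (t, t) \notin edge x y.
Proof.
by rewrite in_edge; apply: contra => /orP [] /andP [/eqP <- /eqP <-].
Qed.

Lemma edge_card (P : pred (V * V)) x y : x != y ->
  (\sum_(e in edge x y) P e = P (x, y) + P (y, x))%N.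
Proof.
move=> xy; rewrite big_setU1 /= ?big_set1 //.
by rewrite inE xpair_eqE (negPf xy).
Qed.

Lemma cross_count_addE Z x y : x != y -> (x, y) \notin Z -> (y, x) \notin Z ->
  cross_count (Z :|: edge x y) = (cross_count Z + 2 * cross x y)%N.
Proof.
move=> xy n1 n2; rewrite /cross_count.
rewrite (eq_bigl [predU Z & edge x y]) => [|e]; last by rewrite !inE.
rewrite bigU /=; last first.
  rewrite disjoint_sym disjoint_subset; apply/subsetP=> -[a b]; rewrite in_edge !inE.
  by case/orP => /andP [/eqP -> /eqP ->].
by rewrite (edge_card (fun e => cross e.1 e.2)) //= [cross y x]cross_sym mul2n addnn.
Qed.

Lemma edgeDK Z x y : (x, y) \in Z -> (y, x) \in Z -> (Z :\: edge x y) :|: edge x y = Z.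
Proof.
move=> h1 h2; apply/setP=> -[a b]; rewrite in_setU in_setD.
have [|_] := boolP ((a, b) \in edge x y); last by rewrite orbF.
by rewrite in_edge => /orP [] /andP [/eqP -> /eqP ->]; rewrite ?h1 ?h2.
Qed.

Lemma outn_rem Z x y u : x != y -> (x, y) \in Z -> (y, x) \in Z ->
  (outn (Z :\: edge x y) u)%:Z =
    (outn Z u)%:Z - (u == x : nat)%:Z - (u == y : nat)%:Z /\
  (inn (Z :\: edge x y) u)%:Z =
    (inn Z u)%:Z - (u == x : nat)%:Z - (u == y : nat)%:Z.
Proof.
move=> xy h1 h2; have [] := @outn_add V (Z :\: edge x y) x y u xy.
- by rewrite !inE eqxx.
- by rewrite !inE eqxx orbT.
by rewrite -/(edge x y) edgeDK // => -> ->; split; lia.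
Qed.

Lemma cross_count_remE Z x y : x != y -> (x, y) \in Z -> (y, x) \in Z ->
  cross_count Z = (cross_count (Z :\: edge x y) + 2 * cross x y)%N.
Proof.
move=> xy h1 h2; rewrite -{1}(edgeDK h1 h2) cross_count_addE //.
- by rewrite !inE eqxx.
- by rewrite !inE eqxx orbT.
Qed.

Definition switch Z x y u v :=
  (((Z :\: edge x y) :\: edge u v) :|: edge x u) :|: edge y v.

Lemma in_switch Z x y u v a b : ((a, b) \in switch Z x y u v) =
  [|| [&& (a, b) \in Z, (a, b) \notin edge x y & (a, b) \notin edge u v],
      (a, b) \in edge x u | (a, b) \in edge y v].
Proof.
rewrite /switch [LHS]in_setU [X in X || _]in_setU in_setD in_setD -orbA.
by rewrite andbC -andbA [in RHS]andbCA.
Qed.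

Lemma switchP Z x y u v : graph_of Z -> uniq [:: x; y; u; v] ->
  (x, y) \in Z -> (u, v) \in Z -> (x, u) \notin Z -> (y, v) \notin Z ->
  graph_of (switch Z x y u v) /\
  (cross_count (switch Z x y u v) + 2 * cross x y + 2 * cross u v =
   cross_count Z + 2 * cross x u + 2 * cross y v)%N.
Proof.
move=> [rZ sy] /=; rewrite !inE !negb_or andbT.
move=> /and3P [/and3P [xy xu xv] /andP [yu yv] uv] h1 h2 n1 n2.
have [Zo Zi nl] := realizes_digraphP _ _ rZ.
have h1' : (y, x) \in Z by rewrite -graph_sym.
have h2' : (v, u) \in Z by rewrite -graph_sym.
have n1' : (u, x) \notin Z by rewrite -graph_sym.
have n2' : (v, y) \notin Z by rewrite -graph_sym.
pose Z1 := Z :\: edge x y; pose Z2 := Z1 :\: edge u v; pose Z3 := Z2 :|: edge x u.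
have [yx ux vx uy [vy vu]] : [/\ y != x, u != x, v != x, u != y & v != y /\ v != u].
  by do !split; rewrite eq_sym.
have b1 : (u, v) \in Z1 by rewrite in_setD in_edge h2 (negPf ux) (negPf uy).
have b2 : (v, u) \in Z1 by rewrite in_setD in_edge h2' (negPf vx) (negPf vy).
have c1 : (x, u) \notin Z2 by rewrite !in_setD (negPf n1) !andbF.
have c2 : (u, x) \notin Z2 by rewrite !in_setD (negPf n1') !andbF.
have d1 : (y, v) \notin Z3.
  by rewrite in_setU !in_setD (negPf n2) !andbF /= in_edge (negPf yx) (negPf yu).
have d2 : (v, y) \notin Z3.
  by rewrite in_setU !in_setD (negPf n2') !andbF /= in_edge (negPf vx) (negPf vu).
split; last first.
  rewrite /switch -/Z1 -/Z2 -/Z3 (cross_count_addE yv d1 d2) (cross_count_addE xu c1 c2).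
  have := cross_count_remE xy h1 h1'; have := cross_count_remE uv b1 b2; rewrite -/Z1 -/Z2.
  move: (cross_count Z2) (cross_count Z1) (cross_count Z) => p q r -> ->.
  move: (nat_of_bool (cross x y)) (nat_of_bool (cross u v)) (nat_of_bool (cross x u)).
  by move: (nat_of_bool (cross y v)); clear; lia.
split.
  apply/realizes_digraphP; split=> t; last 1 first.
  - by rewrite in_switch (negPf (nl t)) (negPf (edge_loop t xu)) (negPf (edge_loop t yv)).
  - have [e4 _] := outn_add t yv d1 d2; have [e3 _] := outn_add t xu c1 c2.
    have [e2 _] := outn_rem t uv b1 b2; have [e1 _] := outn_rem t xy h1 h1'.
    have : (outn (switch Z x y u v) t)%:Z = (dg t)%:Z by rewrite e4 e3 e2 e1 Zo; ring.
    by case.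
  - have [_ e4] := outn_add t yv d1 d2; have [_ e3] := outn_add t xu c1 c2.
    have [_ e2] := outn_rem t uv b1 b2; have [_ e1] := outn_rem t xy h1 h1'.
    have : (inn (switch Z x y u v) t)%:Z = (dg t)%:Z by rewrite e4 e3 e2 e1 Zi; ring.
    by case.
apply/eqP; rewrite -subset0 -sy.
apply: subset_trans (asym_addsym _ (swap_pair _ _)) _.
apply: subset_trans (asym_addsym _ (swap_pair _ _)) _.
apply: subset_trans (asym_subsym _ (swap_pair _ _)) _.
exact: asym_subsym (swap_pair _ _).
Qed.

Hypothesis dg_ge : forall v, (2 <= dg v)%N.

Lemma other_neighbour Z u v : graph_of Z -> exists2 t, t != u & (v, t) \in Z.
Proof.
move=> [rZ _]; have [Zo _ _] := realizes_digraphP _ _ rZ.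
have : (0 < #|[set t | (v, t) \in Z] :\ u|)%N.
  have := dg_ge v; rewrite -Zo /outn (cardsD1 u).
  by case: (u \in _) => /=; lia.
by case/card_gt0P => t; rewrite !inE => /andP [tu vt]; exists t.
Qed.

(* If every edge at the component of [z] were a bridge, an oriented edge [(u, v)]
   with the smallest part behind [v] could be replaced by one further out. *)
Lemma nonbridge Z z : graph_of Z -> exists x y, [/\ connect (adj Z) z x,
  (x, y) \in Z & connect (adj (Z :\: edge x y)) x y].
Proof.
move=> gZ; have [rZ sy] := gZ; have [Zo _ nl] := realizes_digraphP _ _ rZ.
have [/existsP [e /and3P [h1 h2 h3]]|] := boolP [exists e : V * V,
    [&& connect (adj Z) z e.1, e \in Z & connect (adj (Z :\: edge e.1 e.2)) e.1 e.2]].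
  by exists e.1, e.2; rewrite -surjective_pairing.
rewrite negb_exists => /forallP bridge; exfalso.
have symc W u v : asym W = set0 -> connect (adj W) u v = connect (adj W) v u.
  by move=> sW; apply: sym_connect_sym => a b; rewrite /adj graph_sym.
have symD x y : asym (Z :\: edge x y) = set0.
  by apply/eqP; rewrite -subset0 -sy; apply: asym_subsym (swap_pair _ _).
pose behind e := #|[set t | connect (adj (Z :\: edge e.1 e.2)) e.2 t]|.
have [t0 _ zt0] := other_neighbour z z gZ.
pose Q (e : V * V) := connect (adj Z) z e.1 && (e \in Z).
have Q0 : Q (z, t0) by rewrite /Q connect0.
have [[u v] /andP [/= cu uvZ] mini] := arg_minnP behind Q0.
have [t tu vtZ] := other_neighbour u v gZ.
have cv : connect (adj Z) z v := connect_trans cu (connect1 uvZ).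
have := mini (v, t); rewrite /Q /= cv vtZ => /(_ isT); apply/negP; rewrite -ltnNge.
have brt : ~~ connect (adj (Z :\: edge v t)) v t by have := bridge (v, t); rewrite /= cv vtZ.
have vt : v != t by apply: contraTneq vtZ => ->; exact: nl.
have uv : u != v by apply: contraTneq uvZ => ->; exact: nl.
have vtZ' : (v, t) \in Z :\: edge u v.
  by rewrite in_setD vtZ in_edge negb_or (eq_sym v u) (negPf uv) eqxx /= (negPf tu).
apply: proper_card; apply/properP; split.
  apply/subsetP=> s; rewrite !inE /= => cs.
  apply: connect_trans (connect1 vtZ') _.
  apply: connect_restrict cs => p q cp; rewrite /adj => pq.
  have nv a : connect (adj (Z :\: edge v t)) t a -> a != v.
    by move=> ca; apply: contraNneq brt => ea; rewrite ea in ca; rewrite symc.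
  have pv := nv _ cp; have qv := nv _ (connect_trans cp (connect1 pq)).
  move: pq; rewrite !in_setD => /andP [_ ->]; rewrite andbT in_edge.
  by rewrite (negPf pv) (negPf qv) andbF.
exists v; first by rewrite inE connect0.
by rewrite inE /= symc.
Qed.

(** The component of the non-bridge [xy] survives the removal of that edge, and the new edges [xu]
    and [yv] attach both [u] and [v] to it, even when [uv] was a bridge. *)
Lemma switch_connect Z x y u v : graph_of Z -> (x, y) \in Z -> (u, v) \in Z ->
  ~~ connect (adj Z) x u -> connect (adj (Z :\: edge x y)) x y ->
  [/\ uniq [:: x; y; u; v], (x, u) \notin Z, (y, v) \notin Z,
      subrel (connect (adj Z)) (connect (adj (switch Z x y u v))) &
      connect (adj (switch Z x y u v)) x u].
Proof.
move=> gZ xyZ uvZ nxu cxy; have [rZ sy] := gZ; have [Zo _ nl] := realizes_digraphP _ _ rZ.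
have symc W a b : asym W = set0 -> connect (adj W) a b = connect (adj W) b a.
  by move=> sW; apply: sym_connect_sym => p q; rewrite /adj graph_sym.
have far a b : connect (adj Z) x a -> connect (adj Z) u b -> ~~ connect (adj Z) a b.
  move=> ca cb; apply: contra nxu => cab; apply: connect_trans ca _.
  by apply: connect_trans cab _; rewrite symc.
have farne a b : connect (adj Z) x a -> connect (adj Z) u b -> a != b.
  by move=> ca cb; apply: contraNneq (far _ _ ca cb) => ->.
have c0 a : connect (adj Z) a a by [].
have cy : connect (adj Z) x y by exact: connect1.
have cv : connect (adj Z) u v by exact: connect1.
have xy : x != y by apply: contraTneq xyZ => ->; exact: nl.
have uv : u != v by apply: contraTneq uvZ => ->; exact: nl.
have U : uniq [:: x; y; u; v].
  by rewrite /= !inE !negb_or xy uv !farne.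
have n1 : (x, u) \notin Z by apply: contra nxu => h; exact: connect1.
have n2 : (y, v) \notin Z.
  by apply: contra (far _ _ cy cv) => h; exact: connect1.
have [[_ syS] _] := switchP gZ U xyZ uvZ n1 n2.
have S1 : connect (adj (switch Z x y u v)) x u.
  by apply: connect1; rewrite /adj in_switch [X in _ || (X || _)]in_edge !eqxx !orbT.
have S2 : connect (adj (switch Z x y u v)) y v.
  by apply: connect1; rewrite /adj in_switch [X in _ || (_ || X)]in_edge !eqxx !orbT.
have subZ a b : (a, b) \in Z :\: edge x y -> (a, b) \in Z by rewrite in_setD => /andP [].
have S3 : connect (adj (switch Z x y u v)) x y.
  apply: connect_restrict cxy => p q cp; rewrite /adj in_setD => /andP [nxy pqZ].
  have cp' : connect (adj Z) x p.
    by apply: connect_sub cp => a b h; apply: connect1; exact: subZ.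
  rewrite in_switch pqZ nxy in_edge negb_or /=.
  by rewrite (negPf (farne _ _ cp' (c0 u))) (negPf (farne _ _ cp' cv)).
have S4 : connect (adj (switch Z x y u v)) u v.
  by apply: connect_trans (connect_trans _ S3) S2; rewrite symc.
split=> //; apply: connect_sub => a b abZ.
have [|n3] := boolP ((a, b) \in edge x y).
  by rewrite in_edge => /orP [] /andP [/eqP -> /eqP ->] //; rewrite symc.
have [|n4] := boolP ((a, b) \in edge u v).
  by rewrite in_edge => /orP [] /andP [/eqP -> /eqP ->] //; rewrite symc.
by apply: connect1; rewrite /adj in_switch n3 n4 andbT; apply/orP; left; rewrite andbT.
Qed.

(** The component of some crossing edge [uv] absorbs another one by a switch with a non-bridge [xy]
    there. If [xy] crosses, ends on opposite sides are joined, so both new edges cross; if it does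
    not, exactly one of the new edges crosses whatever the pairing. *)
Theorem connect_cut Z : graph_of Z -> (0 < cross_count Z)%N ->
  exists Z', [/\ graph_of Z', cross_count Z' = cross_count Z &
    forall u v, connect (adj Z') u v].
Proof.
pose bad Z := [set p : V * V | ~~ connect (adj Z) p.1 p.2].
have [k] := ubnP #|bad Z|.
elim: k Z => // k IHk Z; rewrite ltnS => leb gZ cp.
have [rZ sy] := gZ.
have symc W a b : asym W = set0 -> connect (adj W) a b = connect (adj W) b a.
  by move=> sW; apply: sym_connect_sym => p q; rewrite /adj graph_sym.
have [u [v [uvZ su sv]]] : exists u v, [/\ (u, v) \in Z, side u & ~~ side v].
  have [[u v] uvZ] : exists2 e, e \in Z & cross e.1 e.2.
    apply/exists_inP; apply: contraTT cp; rewrite negb_exists => /forallP H.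
    rewrite -leqNgt /cross_count big1 // => e eZ; have := H e; rewrite eZ /=.
    by case: (cross _ _).
  rewrite /cross /=; case su : (side u); case sv : (side v) => // _.
    by exists u, v; rewrite uvZ su sv.
  by exists v, u; rewrite -graph_sym // uvZ su sv.
have [/forallP H|] := boolP [forall z, connect (adj Z) u z].
  exists Z; split=> // a b; apply: connect_trans (H b).
  by rewrite symc.
rewrite negb_forall => /existsP [z nuz].
have [x0 [y0 [czx0 xyZ0 cxy0]]] := nonbridge z gZ.
(* A crossing [xy] is oriented like [uv], from [side] to its complement. *)
have [x [y [czx xyZ cxy ori]]] : exists x y, [/\ connect (adj Z) z x, (x, y) \in Z,
    connect (adj (Z :\: edge x y)) x y & side x || ~~ side y || (side x && side y)].
  case sx : (side x0); first by exists x0, y0; rewrite sx.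
  case sy0 : (side y0); last by exists x0, y0; rewrite sx sy0.
  exists y0, x0; rewrite sy0; split=> //.
  - exact: connect_trans czx0 (connect1 xyZ0).
  - by rewrite -graph_sym.
  - have -> : edge y0 x0 = edge x0 y0 by rewrite /edge setUC.
    rewrite symc //; apply/eqP; rewrite -subset0 -sy; exact: asym_subsym (swap_pair _ _).
have farx s : connect (adj Z) u s -> ~~ connect (adj Z) x s.
  move=> cus; apply: contra nuz => cxs; apply: connect_trans cus _.
  by rewrite symc //; apply: connect_trans czx cxs.
have step s t : (s, t) \in Z -> connect (adj Z) u s -> 
   (cross x y + cross s t = cross x s + cross y t)%N ->
   exists Z', [/\ graph_of Z', cross_count Z' = cross_count Z &
    forall u v, connect (adj Z') u v].
  move=> stZ cus eqc.
  have [U n1 n2 sub new] := switch_connect gZ xyZ stZ (farx _ cus) cxy.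
  have [gS cS] := switchP gZ U xyZ stZ n1 n2.
  have cS' : cross_count (switch Z x y s t) = cross_count Z.
    move: cS eqc; move: (cross_count _) (cross_count _) (nat_of_bool (cross x y)).
    move: (nat_of_bool (cross s t)) (nat_of_bool (cross x s)) (nat_of_bool (cross y t)).
    by clear; lia.
  rewrite -cS'; apply: IHk => //; last by rewrite cS'.
  apply: leq_trans leb; apply: proper_card; apply/properP; split.
    by apply/subsetP=> p; rewrite !inE; apply: contra => /sub.
  by exists (x, s); rewrite !inE /= ?new // farx.
have [h|h] := boolP (side x && ~~ side y).
  apply: (step v u); first by rewrite -graph_sym.
    exact: connect1.
  by move: h; rewrite /cross su (negPf sv) => /andP [-> /negPf ->].
apply: (step u v) => //; move: h ori; rewrite /cross su (negPf sv).
by case: (side x); case: (side y).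
Qed.

(** An optimum with no crossing edge cannot be made connected without altering the cut. A switch
    between one edge of each half produces two crossing edges, that is, four arcs. *)
Lemma cut_two Z a b : graph_of Z -> cross_count Z = 0%N -> side a -> ~~ side b ->
  exists Z', graph_of Z' /\ cross_count Z' = 4.
Proof.
move=> gZ c0 sa sb; have [rZ sy] := gZ.
have noc u v : (u, v) \in Z -> side u = side v.
  move=> uvZ; apply/eqP; apply: contraT => cr; move/eqP: c0.
  by rewrite /cross_count (bigD1 (u, v)) //= /cross cr.
have [t _ atZ] := other_neighbour a a gZ; have [s _ bsZ] := other_neighbour b b gZ.
have [_ _ nl] := realizes_digraphP _ _ rZ.
have st := noc _ _ atZ; have ss := noc _ _ bsZ.
have sne p q : side p != side q -> p != q by apply: contraNneq => ->.
have U : uniq [:: a; t; b; s].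
  rewrite /= !inE !negb_or andbT; apply/and3P; split; first apply/and3P; first split.
  - by apply: contraTneq atZ => ->; exact: nl.
  - by apply: sne; rewrite sa (negPf sb).
  - by apply: sne; rewrite -ss sa (negPf sb).
  - by apply/andP; split; apply: sne; rewrite -st -?ss sa (negPf sb).
  - by apply: contraTneq bsZ => ->; exact: nl.
have n1 : (a, b) \notin Z by apply/negP => /noc; rewrite sa (negPf sb).
have n2 : (t, s) \notin Z by apply/negP => /noc; rewrite -st -ss sa (negPf sb).
have [gS cS] := switchP gZ U atZ bsZ n1 n2; exists (switch Z a t b s); split=> //.
by move: cS; rewrite c0 /cross -st -ss sa (negPf sb) /=; move: (cross_count _); clear; lia.
Qed.
End Switch.

(** * The second eigenvalue *)

Lemma char_poly_conj (F : fieldType) n (P A : 'M[F]_n) : P \in unitmx ->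
  char_poly (invmx P *m A *m P) = char_poly A.
Proof.
move=> Pu; rewrite /char_poly.
have -> : char_poly_mx (invmx P *m A *m P) =
    map_mx polyC (invmx P) *m char_poly_mx A *m map_mx polyC P.
  rewrite /char_poly_mx !map_mxM mulmxBr mulmxBl; congr (_ - _).
  rewrite -mulmxA -scalar_mxC mulmxA -map_mxM mulVmx // map_mx1 mul1mx //.
rewrite !det_mulmx mulrAC -det_mulmx -map_mxM mulVmx // map_mx1 det1 mul1r //.
Qed.

Section Hermitian.
Local Open Scope sesquilinear_scope.

Lemma ctrmxK (C : numClosedFieldType) m n (M : 'M[C]_(m, n)) : (M^t*)^t* = M.
Proof. by apply/matrixP=> i j; rewrite !mxE conjCK. Qed.

Variables (C : numClosedFieldType) (n : nat) (A : 'M[C]_n) (g0 g1 : 'rV[C]_n).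
Variable (beta : C).
Hypotheses (Ah : A \is hermsymmx) (gA : g0 *m A = 0) (Ag : A *m g0^t* = 0).
Hypotheses (g01 : g0 *m g1^t* = 0) (g10 : g1 *m g0^t* = 0).
Hypotheses (g0p : 0 < (g0 *m g0^t*) 0 0) (g1p : 0 < (g1 *m g1^t*) 0 0).
Hypotheses (beta0 : 0 <= beta)
  (ray : (g1 *m A *m g1^t*) 0 0 <= beta * (g1 *m g1^t*) 0 0).

Let U := spectralmx A.
Let d i := spectral_diag A 0 i.

Lemma spectral_real i : d i \is Num.real.
Proof. by have /mxOverP /(_ 0 i) := hermitian_spectral_diag_real Ah. Qed.

Lemma spectral_eq : A = U^t* *m diag_mx (spectral_diag A) *m U.
Proof.
have /orthomx_spectralP := hermitian_normalmx Ah.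
by rewrite invmx_unitary ?spectral_unitarymx.
Qed.

Lemma char_poly_spectral : char_poly A = \prod_i ('X - (d i)%:P).
Proof.
have /orthomx_spectralP {1}-> := hermitian_normalmx Ah.
rewrite char_poly_conj ?spectral_unit // char_poly_trig ?diag_mx_is_trig //.
by apply: eq_bigr => i _; rewrite mxE eqxx mulr1n.
Qed.

Lemma quadratic_spectral (x : 'rV[C]_n) : (x *m A *m x^t*) 0 0 =
  \sum_i d i * `|(x *m U^t*) 0 i| ^+ 2.
Proof.
rewrite {1}spectral_eq !mulmxA.
set y := x *m U^t*.
have -> : x *m U^t* *m diag_mx (spectral_diag A) *m U *m x^t* =
    y *m diag_mx (spectral_diag A) *m y^t*.
  by rewrite -!mulmxA /y trmx_mul map_mxM /= ctrmxK.
rewrite mxE; apply: eq_bigr => i _; rewrite mul_mx_diag !mxE normCK.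
by rewrite mulrAC mulrA mulrC mulrA.
Qed.

Lemma norm_spectral (x : 'rV[C]_n) : (x *m x^t*) 0 0 =
  \sum_i `|(x *m U^t*) 0 i| ^+ 2.
Proof.
set y := x *m U^t*.
have -> : x *m x^t* = y *m y^t*.
  rewrite /y trmx_mul map_mxM /= ctrmxK mulmxA -[x *m _ *m U]mulmxA -invmx_unitary ?spectral_unitarymx //.
  by rewrite mulVmx ?spectral_unit // mulmx1.
by rewrite mxE; apply: eq_bigr => i _; rewrite !mxE normCK.
Qed.

(** The plane spanned by [g0] and [g1] contains a nonzero [x] without component along eigenvector
    [i0]. If all other eigenvalues exceeded [beta], so would the Rayleigh quotient of [x]; but [g0]
    lies in the kernel and is orthogonal to [g1]. Quantifying over [i0] expresses that two
    eigenvalues, counted with multiplicity, are at most [beta]. *)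
Lemma second_spectral (i0 : 'I_n) : exists2 i, i != i0 & d i <= beta.
Proof.
have betaR : beta \is Num.real by rewrite ger0_real.
have [/existsP [i /andP [ne le]]|] := boolP [exists i, (i != i0) && (d i <= beta)].
  by exists i.
rewrite negb_exists => /forallP H; exfalso.
have big i : i != i0 -> beta < d i.
  by move=> ne; have := H i; rewrite ne /= real_leNgt ?spectral_real // negbK.
pose s := (g0 *m U^t*) 0 i0; pose t := (g1 *m U^t*) 0 i0.
have [a [b [ab0 abn]]] : exists a b, a * s + b * t = 0 /\ (a != 0) || (b != 0).
  have [s0|s0] := eqVneq s 0.
    have [t0|t0] := eqVneq t 0.
      by exists 1, 0; rewrite s0 t0 !mulr0 addr0 oner_eq0.
    by exists 1, 0; rewrite s0 mulr0 mul0r addr0 oner_eq0.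
  by exists (- t), s; rewrite s0 orbT mulNr mulrC addNr.
pose x := a *: g0 + b *: g1.
have xt : x^t* = a^* *: g0^t* + b^* *: g1^t*.
  by rewrite /x linearD /= !linearZ /= map_mxD !map_mxZ.
have xx : (x *m x^t*) 0 0 = `|a| ^+ 2 * (g0 *m g0^t*) 0 0 + `|b| ^+ 2 * (g1 *m g1^t*) 0 0.
  rewrite xt /x mulmxDr !mulmxDl -!scalemxAl -!scalemxAr g01 g10 !scaler0 addr0 add0r.
  by rewrite !mxE !normCK -!mulrA.
have xAx : (x *m A *m x^t*) 0 0 = `|b| ^+ 2 * (g1 *m A *m g1^t*) 0 0.
  rewrite xt /x mulmxDl -!scalemxAl gA scaler0 add0r mulmxDr -!scalemxAr.
  rewrite -!scalemxAl -[g1 *m A *m g0^t*]mulmxA Ag mulmx0 !scaler0 add0r.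
  by rewrite !mxE normCK -mulrA mulrCA.
have y0 : (x *m U^t*) 0 i0 = 0.
  by rewrite /x mulmxDl -!scalemxAl mxE [X in X + _]mxE [X in _ + X]mxE.
have terms : \sum_i (d i - beta) * `|(x *m U^t*) 0 i| ^+ 2 <= 0.
  have -> : \sum_i (d i - beta) * `|(x *m U^t*) 0 i| ^+ 2 =
      (x *m A *m x^t*) 0 0 - beta * (x *m x^t*) 0 0.
    rewrite quadratic_spectral norm_spectral mulr_sumr -sumrB.
    by apply: eq_bigr => i _; rewrite mulrBl.
  rewrite xAx xx mulrDr opprD addrA addrAC subr_le0.
  apply: (@le_trans _ _ 0).
    by rewrite mulrCA -mulrBr mulr_ge0_le0 ?exprn_ge0 // subr_le0.
  by rewrite !mulr_ge0 ?exprn_ge0 // ltW.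
have pos i : 0 <= (d i - beta) * `|(x *m U^t*) 0 i| ^+ 2.
  have [->|ne] := eqVneq i i0; first by rewrite y0 normr0 expr0n /= mulr0.
  by rewrite mulr_ge0 ?exprn_ge0 // subr_ge0 ltW ?big.
have sum0 : \sum_i (d i - beta) * `|(x *m U^t*) 0 i| ^+ 2 == 0.
  by rewrite eq_le terms sumr_ge0.
have xx0 : (x *m x^t*) 0 0 = 0.
  rewrite norm_spectral big1 // => i _.
  have [->|ne] := eqVneq i i0; first by rewrite y0 normr0 expr0n.
  move: sum0; rewrite psumr_eq0 // => /allP /(_ i (mem_index_enum _)) /=.
  by rewrite mulf_eq0 subr_eq0 => /orP [/eqP e|/eqP //]; have := big i ne; rewrite e ltxx.
move: xx0; rewrite xx => /eqP.
rewrite paddr_eq0 ?mulr_ge0 ?exprn_ge0 ?(ltW g0p) ?(ltW g1p) //.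
rewrite !mulf_eq0 (gt_eqF g0p) (gt_eqF g1p) !orbF ?expf_eq0 /= !normr_eq0 ?orbb.
by move: abn; case: (a == 0); case: (b == 0).
Qed.
End Hermitian.

(** The spectral theorem is used over the complex extension of [R]; the eigenvalues are real there
    and come back as real parts. *)
Lemma symmetric_second (R : rcfType) n (N : 'M[R]_n) (g0 g1 : 'rV[R]_n) beta :
  N^T = N -> g0 *m N = 0 -> g0 *m g1^T = 0 ->
  0 < (g0 *m g0^T) 0 0 -> 0 < (g1 *m g1^T) 0 0 -> 0 <= beta ->
  (g1 *m N *m g1^T) 0 0 <= beta * (g1 *m g1^T) 0 0 ->
  exists lam : 'I_n -> R, char_poly N = \prod_i ('X - (lam i)%:P) /\
    forall i0, exists2 i, i != i0 & lam i <= beta.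
Proof.
move=> Nt gN g01 g0p g1p beta0 ray.
pose toC := real_complex R; pose A := map_mx toC N.
have rC x : toC x \is Num.real by apply/complex_realP; exists x.
have ctr m k (M : 'M[R]_(m, k)) : ((map_mx toC M)^t*)%sesqui = map_mx toC M^T.
  by apply/matrixP=> i j; rewrite !mxE conj_Creal ?rC.
have Ah : A \is hermsymmx.
  apply: realsym_hermsym.
    by apply/is_hermitianmxP; rewrite expr0 scale1r map_mx_id // map_trmx Nt.
  by apply/mxOverP=> i j; rewrite mxE; exact: rC.
have gA : map_mx toC g0 *m A = 0 by rewrite -map_mxM gN map_mx0.
have Ng : N *m g0^T = 0 by rewrite -Nt -trmx_mul gN trmx0.
have g10 : g1 *m g0^T = 0 by rewrite -[g1]trmxK -trmx_mul g01 trmx0.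
have H := @second_spectral _ n A (map_mx toC g0) (map_mx toC g1) (toC beta) Ah gA.
pose d := spectral_diag A.
have dR i : d 0 i \is Num.real by exact: spectral_real.
exists (fun i => complex.Re (d 0 i)); split.
  apply: (@map_poly_inj _ _ toC); rewrite map_char_poly -/A (char_poly_spectral Ah).
  by rewrite map_prod_XsubC; apply: eq_bigr => i _; rewrite /= /toC RRe_real ?dR.
move=> i0; have [||||||| i ne le] := H _ _ _ _ _ _ _ i0.
- by rewrite ctr -map_mxM Ng map_mx0.
- by rewrite ctr -map_mxM g01 map_mx0.
- by rewrite ctr -map_mxM g10 map_mx0.
- by rewrite ctr -map_mxM mxE ltcR.
- by rewrite ctr -map_mxM mxE ltcR.
- by rewrite ler0c.
- by rewrite ctr -!map_mxM [X in X <= _]mxE [X in _ * X]mxE -rmorphM lecR.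
by exists i => //; rewrite -lecR RRe_real.
Qed.

Lemma mup_prod_XsubC (R : fieldType) (x : R) (s : seq R) :
  mup x (\prod_(a <- s) ('X - a%:P)) = count_mem x s.
Proof.
elim: s => [|a s IHs]; first by rewrite big_nil mupNroot // root1.
rewrite big_cons mupM ?polyXsubC_eq0 ?monic_neq0 ?monic_prod_XsubC // IHs /=.
by have := mup_XsubCX 1 x a; rewrite expr1 => ->; rewrite eq_sym; case: (_ == _).
Qed.

Lemma count_flatten_nseq (T : eqType) (k : T -> nat) (s : seq T) x : uniq s ->
  count_mem x (flatten [seq nseq (k y) y | y <- s]) = ((x \in s) * k x)%N.
Proof.
elim: s => //= y s IHs /andP [ys U]; rewrite count_cat IHs // count_nseq /= inE.
have [e|ne] := eqVneq y x; last by rewrite mul0n.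
by subst y; rewrite (negPf ys) mul0n addn0.
Qed.

Lemma sorted_flatten_nseq (R : rcfType) (k : R -> nat) (s : seq R) :
  sorted <%R s -> sorted <=%R (flatten [seq nseq (k y) y | y <- s]).
Proof.
rewrite (sorted_pairwise lt_trans) (sorted_pairwise le_trans).
elim: s => //= y s IHs /andP [ys U]; rewrite pairwise_cat IHs // andbT; apply/andP; split.
  apply/allrelP => a b /nseqP [-> _] /flattenP [t /mapP [z zs ->] /nseqP [-> _]].
  by apply/ltW/(allP ys).
by elim: (k y) => //= m ->; rewrite andbT; apply/allP => a /nseqP [->].
Qed.

Lemma nth1_le (R : rcfType) (s : seq R) (beta : R) : sorted <=%R s -> 0 <= beta ->
  (1 < count (fun x => (x <= beta)%R) s)%N -> nth 0 s 1 <= beta.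
Proof.
case: s => [|a [|b s]] //= pa b0; case: (lerP b beta) => //= lt.
have : count (fun x => (x <= beta)%R) s = 0%N.
  apply/eqP; rewrite -leqn0 leqNgt -has_count; apply/hasPn => x xs.
  move: pa => /andP [_] /(order_path_min le_trans) /allP /(_ _ xs) bx.
  by rewrite -ltNge (lt_le_trans lt).
by move=> ->; case: (_ <= _).
Qed.

Lemma spectrum_nth1 (R : rcfType) n (M : 'M[R]_n) (lam : 'I_n -> R) beta :
  char_poly M = \prod_i ('X - (lam i)%:P) -> 0 <= beta ->
  (forall i0, exists2 i, i != i0 & lam i <= beta) -> nth 0 (spectrum M) 1 <= beta.
Proof.
move=> cp b0 two.
have cp0 : char_poly M != 0 by rewrite monic_neq0 ?char_poly_monic.
have rs := roots_on_rootsR cp0.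
have srt : sorted <%R (rootsR (char_poly M)) by exact: sorted_roots.
have pe : perm_eq (spectrum M) (map lam (enum 'I_n)).
  apply/allP => x _ /=; rewrite /spectrum count_flatten_nseq ?lt_sorted_uniq //.
  rewrite -(mup_prod_XsubC x) big_map big_enum /= -cp.
  have [|nx] := boolP (x \in rootsR _); first by rewrite mul1n.
  rewrite mul0n mupNroot //; move: nx; rewrite -rs //.
(* For [n = 0] the spectrum is empty and [nth] returns its default 0. *)
case: n M lam cp two cp0 rs srt pe => [|n] M lam cp two cp0 rs srt pe.
  by move: (perm_size pe); rewrite size_map size_enum_ord => /size0nil ->.
apply: nth1_le => //; first exact: sorted_flatten_nseq.
have [i1 _ le1] := two ord0; have [i2 ne le2] := two i1.
rewrite (permP pe) count_map.
have -> : count (preim lam (fun x => x <= beta)) (enum 'I_n.+1) = #|[set i | lam i <= beta]|.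
  rewrite cardE -size_filter; congr size; rewrite /enum_mem -filter_predI.
  by apply: eq_filter => i; rewrite /= !inE andbT.
by apply/card_gt1P; exists i2, i1; rewrite !inE.
Qed.

(** * Rayleigh bound for the normalized Laplacian *)

Section Rayleigh.
Variables (R : rcfType) (n : nat) (e : rel 'I_n).
Hypotheses (se : simple_graph e) (dpos : forall i, (0 < deg e i)%N).
Local Notation d i := ((deg e i)%:R : R).
Local Notation sq i := (Num.sqrt (d i)).
Local Notation E i j := ((e i j)%:R : R).

Lemma sum_adj i : \sum_j E i j = d i.
Proof.
rewrite /deg -sum1_card natr_sum [RHS]big_mkcond /=; apply: eq_bigr => j _.
by rewrite inE; case: (e i j).
Qed.

(** Conjugation by the square roots of the degrees turns [negLap] into the symmetric [N], whose
    kernel contains [g0]. Orthogonality of [g1] to [g0] is the vanishing of the degree-weighted mean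
    of [f]. The energy runs over ordered pairs, whence the factor 2. *)
Lemma lambda1_le (f : 'I_n -> R) beta : \sum_i d i * f i = 0 ->
  0 < \sum_i d i * f i ^+ 2 -> 0 <= beta ->
  \sum_i \sum_j E i j * (f i - f j) ^+ 2 <= 2 * beta * \sum_i d i * f i ^+ 2 ->
  lambda1 R e <= beta.
Proof.
move=> mean var b0 ray; have [sym irr] := se.
have dp i : 0 < d i by rewrite ltr0n.
have sp i : 0 < sq i by rewrite sqrtr_gt0.
have sn i : sq i != 0 by rewrite gt_eqF.
have ss i : sq i * sq i = d i by rewrite -expr2 sqr_sqrtr // ltW.
pose N : 'M[R]_n := \matrix_(i, j) ((i == j)%:R - E i j / (sq i * sq j)).
pose g0 : 'rV[R]_n := \row_i sq i; pose g1 : 'rV[R]_n := \row_i (sq i * f i).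
pose P : 'M[R]_n := diag_mx g0.
have Pu : P \in unitmx.
  by rewrite unitmxE det_diag unitfE; apply/prodf_neq0 => i _; rewrite mxE.
have sim : negLap R e = invmx P *m N *m P.
  rewrite -mulmxA; apply: (canRL (mulKmx Pu)); rewrite /P mul_diag_mx mul_mx_diag.
  apply/matrixP=> i j; rewrite !mxE; have [->|ne] := eqVneq i j.
    by rewrite irr !mul0r subr0 mulr1 mul1r.
  move: (sn i) (sn j) (ss i); move: (sq i) (sq j) => a b an bn <-.
  by move: ((e i j)%:R : R) => x; rewrite /= !sub0r; field; rewrite an bn.
have gg (a b : 'I_n -> R) : ((\row_i a i : 'rV[R]_n) *m (\row_i b i : 'rV[R]_n)^T) 0 0 = \sum_i a i * b i.
  by rewrite mxE; apply: eq_bigr => i _; rewrite !mxE.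
have g11 : (g1 *m g1^T) 0 0 = \sum_i d i * f i ^+ 2.
  by rewrite gg; apply: eq_bigr => i _; rewrite mulrACA ss expr2.
have [||||||lam [cp two]] := @symmetric_second R n N g0 g1 beta _ _ _ _ _ b0.
- by apply/matrixP=> i j; rewrite !mxE sym eq_sym [sq j * _]mulrC.
- apply/rowP=> j; rewrite !mxE (bigD1 j) //= !mxE eqxx irr mul0r subr0 mulr1.
  rewrite (eq_bigr (fun i => - (E j i / sq j))) => [|i ne]; last first.
    rewrite !mxE (negPf ne) sub0r sym; move: (sn i) (sn j) ((e j i)%:R : R).
    by move: (sq i) (sq j) => a b an bn x; field; rewrite an bn.
  have -> : \sum_(i | i != j) - (E j i / sq j) = - (d j / sq j).
    rewrite sumrN -mulr_suml; congr (- (_ / _)).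
    by rewrite -[RHS]sum_adj [RHS](bigD1 j) //= irr add0r.
  by rewrite -[X in X / _]ss mulfK ?subrr.
- apply/matrixP=> i j; rewrite !ord1 gg [RHS]mxE -[RHS]mean.
  by apply: eq_bigr => k _; rewrite mulrA ss.
- rewrite gg (eq_bigr (fun i => d i)) => [|i _]; last by rewrite ss.
  rewrite lt_neqAle sumr_ge0 ?andbT => [|i _]; last exact: ltW.
  rewrite eq_sym; apply: contraTN var => /eqP s0.
  suff -> : \sum_i d i * f i ^+ 2 = 0 by rewrite ltxx.
  apply: big1 => i _; have /eqP := s0; rewrite psumr_eq0; last by move=> k _; exact: ltW.
  by move=> /allP /(_ i (mem_index_enum _)) /= /eqP ->; rewrite mul0r.
- by rewrite g11.
- rewrite g11.
  have -> : (g1 *m N *m g1^T) 0 0 = \sum_i d i * f i ^+ 2 - \sum_i \sum_j E i j * (f i * f j).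
    rewrite mxE; under eq_bigr => j _ do rewrite !mxE mulr_suml.
    rewrite exchange_big -sumrB /=; apply: eq_bigr => i _.
    rewrite (eq_bigr (fun j => (i == j)%:R * (d i * f i ^+ 2) - E i j * (f i * f j))) => [|j _]; last first.
      rewrite !mxE; have [->|ne] := eqVneq i j.
        by rewrite irr !mul0r !subr0 mul1r mulr1 mulrACA ss expr2.
      rewrite !sub0r !mul0r sub0r; move: (sn i) (sn j) ((e i j)%:R : R).
      by move: (sq i) (sq j) => a b an bn x; field; rewrite an bn.
    rewrite sumrB; congr (_ - _); rewrite (bigD1 i) //= eqxx mul1r big1 ?addr0 // => j ne.
    by rewrite eq_sym (negPf ne) mul0r.
  suff exp : \sum_i \sum_j E i j * (f i - f j) ^+ 2 =
      2 * (\sum_i d i * f i ^+ 2 - \sum_i \sum_j E i j * (f i * f j)).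
    by move: ray; rewrite exp -mulrA ler_pM2l // ltr0n.
  have e1 : \sum_i \sum_j E i j * f i ^+ 2 = \sum_i d i * f i ^+ 2.
    by apply: eq_bigr => i _; rewrite -mulr_suml sum_adj.
  have e2 : \sum_i \sum_j E i j * f j ^+ 2 = \sum_i d i * f i ^+ 2.
    rewrite exchange_big /= -e1; apply: eq_bigr => i _; apply: eq_bigr => j _.
    by rewrite sym.
  rewrite mulrBr mulr_natl mulr2n -{1}e1 -e2 mulr_sumr -big_split -sumrB /=.
  apply: eq_bigr => i _; rewrite mulr_sumr -big_split -sumrB /=.
  by apply: eq_bigr => j _; ring.
rewrite /lambda1 /lambda; apply: (@spectrum_nth1 _ _ _ lam) => //.
by rewrite sim char_poly_conj.
Qed.
End Rayleigh.

(** * Cycles *)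

Section Cycle.
Variable (n : nat).
Hypothesis n12 : (12 <= n)%N.

Definition cycle_rel : rel 'I_n := fun i j => (j == ordS i) || (i == ordS j).
(** The distance from vertex 0 along the cycle. *)
Definition tent (i : nat) : nat := minn i (n - i).

Lemma ordS_val (i : 'I_n) : ordS i = (if i.+1 == n then 0 else i.+1)%N :> nat.
Proof.
rewrite /=; have := ltn_ord i; rewrite leq_eqVlt => /predU1P [->|lt].
  by rewrite modnn eqxx.
by rewrite modn_small // ltn_eqF.
Qed.

Lemma ord_pred_val (i : 'I_n) : ord_pred i = (if i == 0 :> nat then n.-1 else i.-1)%N :> nat.
Proof.
have := congr1 val (ord_predK i); rewrite -[val _]/(nat_of_ord _) ordS_val.
rewrite -[val i]/(nat_of_ord i); have := ltn_ord (ord_pred i); have := ltn_ord i.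
by move: (nat_of_ord (ord_pred i)) (nat_of_ord i) => p q; case: eqP; case: eqP; lia.
Qed.

Lemma cycle_simple : simple_graph cycle_rel.
Proof.
split=> [i j|i]; first by rewrite /cycle_rel orbC.
rewrite /cycle_rel orbb; apply/negP => /eqP /(congr1 (@nat_of_ord n)); rewrite ordS_val.
by have := ltn_ord i; case: eqP; lia.
Qed.

Lemma cycle_deg i : deg cycle_rel i = 2.
Proof.
rewrite /deg; have -> : [set j | cycle_rel i j] = [set ordS i; ord_pred i].
  apply/setP=> j; rewrite !inE /cycle_rel; congr (_ || _).
  by apply/eqP/eqP => ->; rewrite ?ordSK ?ord_predK.
rewrite cards2; have -> // : ordS i != ord_pred i.
apply/negP => /eqP /(congr1 (@nat_of_ord n)); rewrite ordS_val ord_pred_val.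
by have := ltn_ord i; case: eqP; case: eqP; lia.
Qed.

Lemma cycle_connected : connected_graph cycle_rel.
Proof.
have sym := (cycle_simple).1.
have n0 : (0 < n)%N by lia.
have from0 k (kn : (k < n)%N) : connect cycle_rel (Ordinal n0) (Ordinal kn).
  elim: k kn => [|k IHk] kn; first by rewrite (_ : Ordinal kn = Ordinal n0) //; exact: val_inj.
  have kn' : (k < n)%N by lia.
  apply: connect_trans (IHk kn') (connect1 _); apply/orP; left; apply/eqP/val_inj.
  by rewrite -[RHS]/(nat_of_ord _) ordS_val /= ltn_eqF.
move=> i j; apply: (@connect_trans _ _ (Ordinal n0)).
  by rewrite (sym_connect_sym sym); case: i => i Hi; exact: from0.
by case: j => j Hj; exact: from0.
Qed.

Lemma tent_cycle i j : cycle_rel i j -> (tent i <= tent j + 1)%N.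
Proof.
rewrite /tent => /orP [] /eqP /(congr1 (@nat_of_ord n)); rewrite ordS_val;
  have := ltn_ord i; have := ltn_ord j;
  by move: (nat_of_ord i) (nat_of_ord j) => a b; case: eqP; lia.
Qed.

(** Every distance is attained twice, except 0, where [h] vanishes, and for even [n] the distance
    [k] of the antipode, which accounts for the extra [h k]. *)
Lemma sum_tent (h : nat -> nat) k : h 0%N = 0%N ->
  (n = k.*2 -> \sum_(i < n) h (tent i) + h k = (\sum_(i < k.+1) h i).*2)%N /\
  (n = k.*2.+1 -> \sum_(i < n) h (tent i) = (\sum_(i < k.+1) h i).*2)%N.
Proof.
move=> h0.
have rev : (\sum_(j < k) h (k - j) = \sum_(i < k.+1) h i)%N.
  rewrite big_ord_recl /= h0 add0n (reindex_inj rev_ord_inj) /=.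
  by apply: eq_bigr => i _; rewrite /bump /=; congr h; have := ltn_ord i; lia.
split=> en.
  have -> : (\sum_(i < n) h (tent i) = \sum_(0 <= i < k + k) h (tent i))%N.
    by rewrite big_mkord en addnn.
  rewrite (big_cat_nat _ (n := k)) ?leq_addr //= big_mkord.
  have -> : (\sum_(k <= i < k + k) h (tent i) = \sum_(j < k) h (tent (j + k)))%N.
    by rewrite -{1}[k]add0n big_addn addnK big_mkord.
  rewrite (eq_bigr (fun i : 'I_k => h i)) => [|i _]; last first.
    by congr h; rewrite /tent; have := ltn_ord i; lia.
  rewrite [X in (_ + X + _)%N](eq_bigr (fun j : 'I_k => h (k - j)%N)) => [|i _]; last first.
    by congr h; rewrite /tent; have := ltn_ord i; lia.
  by rewrite rev big_ord_recr /= addnAC addnn.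
have -> : (\sum_(i < n) h (tent i) = \sum_(0 <= i < k.+1 + k) h (tent i))%N.
  by rewrite big_mkord en -addnn addSn.
rewrite (big_cat_nat _ (n := k.+1)) ?leq_addr //= big_mkord.
have -> : (\sum_(k.+1 <= i < k.+1 + k) h (tent i) = \sum_(j < k) h (tent (j + k.+1)))%N.
  by rewrite -{1}[k.+1]add0n big_addn addKn big_mkord.
rewrite -addnn.
congr (_ + _)%N; last rewrite -rev; apply: eq_bigr => i _; congr h; rewrite /tent;
  have := ltn_ord i; lia.
Qed.

Lemma sum_id k : (2 * (\sum_(i < k.+1) i) = k * k.+1)%N.
Proof. by elim: k => [|k IHk]; [rewrite big_ord1|rewrite big_ord_recr /= mulnDr IHk; nia]. Qed.

Lemma sum_sq k : (6 * (\sum_(i < k.+1) i ^ 2) = k * k.+1 * (2 * k + 1))%N.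
Proof. by elim: k => [|k IHk]; [rewrite big_ord1|rewrite big_ord_recr /= mulnDr IHk; nia]. Qed.

(** After division by the square of [n], this says that four times the variance of the tent is at
    least [n - 1]. The left quantity is about one twelfth of the square of [n], so [n >= 12]
    suffices. *)
Lemma tent_variance :
  (n ^ 2 * (n - 1) + 4 * (\sum_(i < n) tent i) ^ 2 <= 4 * n * (\sum_(i < n) tent i ^ 2))%N.
Proof.
pose k := n./2; have [e1 o1] := @sum_tent id k erefl.
have [e2 o2] := @sum_tent (fun x => x ^ 2)%N k erefl.
have := sum_id k; have := sum_sq k.
have k6 : (6 <= k)%N by rewrite /k; lia.
have h1 : (6 * k <= k * k)%N by rewrite leq_mul2r k6 orbT.
have h2 : (6 * (k * k) <= k * (k * k))%N by rewrite leq_mul2r k6 orbT.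
have h3 : (6 * (k * (k * k)) <= k * (k * (k * k)))%N by rewrite leq_mul2r k6 orbT.
have := odd_double_half n; rewrite -/k; case: (odd n) => en.
  have en' : n = k.*2.+1 by rewrite -en.
  move: (o1 en') (o2 en') => /= -> ->.
  move: (\sum_(i < k.+1) i)%N (\sum_(i < k.+1) i ^ 2)%N => a b hb ha.
  have hkb : (6 * (k * b) = k * (k * k.+1 * (2 * k + 1)))%N by rewrite -hb; lia.
  rewrite -!mul2n ha en' -mul2n subSS subn0 !expnS !expn0 !muln1.
  clear - h1 h2 h3 hb hkb; lia.
have en' : n = k.*2 by rewrite -en.
move: (e1 en') (e2 en') => /=.
move: (\sum_(i < k.+1) i)%N (\sum_(i < k.+1) i ^ 2)%N (\sum_(i < n) tent i)%N.
move: (\sum_(i < n) tent i ^ 2)%N => s a b t s1 s2 hb ha.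
have -> : (t = k * k)%N by lia.
have h4 : (3 * s = 2 * (k * (k * k)) + k)%N by rewrite !expnS !expn0 !muln1 in s2; lia.
have h5 : (3 * (k * s) = 2 * (k * (k * (k * k))) + k * k)%N.
  by rewrite mulnCA h4; lia.
have [m em] : exists m, (n = m.+1)%N by exists n.-1; lia.
have em' : (m.+1 = 2 * k)%N by rewrite -em en' mul2n.
have h6 : (k * k * m.+1 = 2 * (k * (k * k)))%N by rewrite em'; lia.
rewrite {2}em subSS subn0 en' -mul2n !expnS !expn0 !muln1.
clear - h1 h2 h3 h5 h6; lia.
Qed.
End Cycle.

(** * Cuts *)

Lemma nedges_deg n (e : rel 'I_n) : simple_graph e -> (2 * nedges e = \sum_i deg e i)%N.
Proof.
move=> [sym irr].
have -> : (\sum_i deg e i = \sum_i \sum_(j | e i j) 1)%N.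
  by apply: eq_bigr => i _; rewrite /deg -sum1_card; apply: eq_bigl => j; rewrite inE.
rewrite (pair_big_dep xpredT (fun i j => e i j) (fun i j => 1%N)) /=.
rewrite (bigID (fun p : 'I_n * 'I_n => (p.1 < p.2)%N)) /=.
rewrite [X in (_ + X)%N](reindex_inj (h := fun p : 'I_n * 'I_n => (p.2, p.1))) /=; last first.
  by move=> [a b] [a' b'] [-> ->].
rewrite [X in (_ + X)%N](eq_bigl (fun p : 'I_n * 'I_n => e p.1 p.2 && (p.1 < p.2)%N)).
  by rewrite /nedges -sum1_card addnn -mul2n; congr (2 * _)%N; apply: eq_bigl => p; rewrite inE.
move=> [a b] /=; rewrite sym -leqNgt leq_eqVlt; case: (eqVneq (a : nat) b) => //= /val_inj ->.
by rewrite irr.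
Qed.

Lemma cycle_lambda1 (R : rcfType) n : (12 <= n)%N ->
  lambda1 R (cycle_rel (n := n)) <= 2 / (n%:R - 1).
Proof.
move=> n12; pose S := (\sum_(i < n) tent n i)%N; pose Q := (\sum_(i < n) tent n i ^ 2)%N.
have var := tent_variance n12; rewrite -/S -/Q in var.
have nR : (12%:R : R) <= n%:R by rewrite ler_nat.
have varR : n%:R ^+ 2 * (n%:R - 1) + 4 * S%:R ^+ 2 <= 4 * n%:R * Q%:R :> R.
  move: var; rewrite -(ler_nat R) natrD !natrM ?natrX natrB; last by lia.
  by move=> h; lra.
(* The tent, centred and scaled by [n]: its mean is 0 and adjacent values differ by at most [n]. *)
pose f (i : 'I_n) : R := n%:R * (tent n i)%:R - S%:R.
have sumc (c : R) : \sum_(i < n) c = n%:R * c by rewrite sumr_const card_ord mulr_natl.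
have sT : \sum_(i < n) (tent n i)%:R = S%:R :> R by rewrite natr_sum.
have sQ : \sum_(i < n) (tent n i)%:R ^+ 2 = Q%:R :> R.
  by rewrite natr_sum; apply: eq_bigr => i _; rewrite natrX.
have dE i : (deg (cycle_rel (n := n)) i)%:R = 2 :> R by rewrite cycle_deg.
have sf2 : \sum_i (deg (cycle_rel (n := n)) i)%:R * f i ^+ 2 =
    2 * n%:R * (n%:R * Q%:R - S%:R ^+ 2).
  under eq_bigr => i _ do rewrite dE.
  rewrite -mulr_sumr -mulrA; congr (_ * _).
  rewrite (eq_bigr (fun i : 'I_n => n%:R ^+ 2 * (tent n i)%:R ^+ 2
    - 2 * n%:R * S%:R * (tent n i)%:R + S%:R ^+ 2)) => [|i _]; last by rewrite /f; ring.
  by rewrite big_split sumrB /= -!mulr_sumr sT sQ sumc; ring.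
have key : n%:R ^+ 2 * (n%:R - 1) <= 4 * (n%:R * Q%:R - S%:R ^+ 2) :> R by lra.
have n1 : 0 < n%:R - 1 :> R by lra.
have n2 : 0 < n%:R ^+ 2 :> R by rewrite exprn_gt0 //; lra.
apply: (@lambda1_le R n _ (cycle_simple n12) _ f).
- by move=> i; rewrite cycle_deg.
- under eq_bigr => i _ do rewrite dE.
  by rewrite -mulr_sumr /f sumrB -mulr_sumr sT sumc subrr mulr0.
- rewrite sf2 mulr_gt0 //; first lra.
  have : 0 < n%:R ^+ 2 * (n%:R - 1) :> R by rewrite mulr_gt0.
  lra.
- by rewrite divr_ge0 // ltW.
apply: (@le_trans _ _ (\sum_i \sum_j (cycle_rel i j)%:R * n%:R ^+ 2)).
  apply: ler_sum => i _; apply: ler_sum => j _.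
  have [eij|_] := boolP (cycle_rel i j); last by rewrite !mul0r.
  have eji : cycle_rel j i by rewrite (cycle_simple n12).1.
  rewrite !mul1r /f.
  have h1 := tent_cycle n12 eij; have h2 := tent_cycle n12 eji.
  rewrite -(ler_nat R) natrD in h1; rewrite -(ler_nat R) natrD in h2.
  have -> : n%:R * (tent n i)%:R - S%:R - (n%:R * (tent n j)%:R - S%:R) =
    n%:R * ((tent n i)%:R - (tent n j)%:R) :> R by ring.
  rewrite exprMn -[leRHS]mulr1 ler_pM2l //.
  by rewrite -[1](expr1n _ 2) -subr_ge0 subr_sqr mulr_ge0 //; lra.
under eq_bigr => i _ do rewrite -mulr_suml sum_adj dE.
rewrite sumc sf2.
have -> : 2 * (2 / (n%:R - 1)) * (2 * n%:R * (n%:R * Q%:R - S%:R ^+ 2)) =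
    2 * n%:R * (4 * (n%:R * Q%:R - S%:R ^+ 2) / (n%:R - 1)) :> R.
  by field; rewrite gt_eqF.
have -> : n%:R * (2 * n%:R ^+ 2) = 2 * n%:R * n%:R ^+ 2 :> R by ring.
rewrite ler_pM2l; last by lra.
by rewrite ler_pdivlMr.
Qed.

Section CutBound.
Variables (R : rcfType) (n : nat) (e : rel 'I_n) (side : 'I_n -> bool).
Hypotheses (se : simple_graph e) (dpos : forall i, (0 < deg e i)%N).
Let volA := (\sum_(i | side i) deg e i)%N.
Let volB := (\sum_(i | ~~ side i) deg e i)%N.
Let cc := cross_count side [set p | e p.1 p.2].

(** One of the two truncated differences is 0, so the last hypothesis bounds the square of the
    volume difference. Writing m for the number of edges, it yields that [volA] times [volB] is at
    least m times m - D/2, which converts the usual cut ratio into the stated denominator. As [cc]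
    counts arcs, [2 * c] means c edges. *)
Lemma lambda1_cut (c D : nat) : (0 < volA)%N -> (0 < volB)%N ->
  (cc <= 2 * c)%N -> (D < volA + volB)%N ->
  ((volA - volB) ^ 2 + (volB - volA) ^ 2 <= (volA + volB) * D)%N ->
  lambda1 R e <= (2 * c%:R) / ((nedges e)%:R - D%:R / 2).
Proof.
move=> A0 B0 ccle Dv bal.
have vol2 : (2 * nedges e = volA + volB)%N by rewrite nedges_deg // (bigID side).
have mR : (nedges e)%:R = (volA%:R + volB%:R) / 2 :> R.
  by rewrite -natrD -vol2 natrM mulrAC divff ?mul1r ?pnatr_eq0.
have AR : 0 < volA%:R :> R by rewrite ltr0n.
have BR : 0 < volB%:R :> R by rewrite ltr0n.
have DR : D%:R < volA%:R + volB%:R :> R by rewrite -natrD ltr_nat.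
have balR : (volA%:R - volB%:R) ^+ 2 <= (volA%:R + volB%:R) * D%:R :> R.
  rewrite -natrD -natrM; apply: le_trans (_ : ((volA - volB) ^ 2 + (volB - volA) ^ 2)%N%:R <= _).
    have [le|/ltnW le] := leqP volB volA.
      have z : (volB - volA = 0)%N by lia.
      by rewrite z exp0n // addn0 natrX natrB.
    have z : (volA - volB = 0)%N by lia.
    by rewrite z exp0n // add0n natrX natrB // -sqrrN opprB.
  by rewrite ler_nat.
pose f (i : 'I_n) : R := if side i then volB%:R else - volA%:R.
have split_sum (F : 'I_n -> R) (a b : R) : (forall i, side i -> F i = a) ->
    (forall i, ~~ side i -> F i = b) ->
    \sum_i (deg e i)%:R * F i = volA%:R * a + volB%:R * b.
  move=> Fa Fb; rewrite (bigID side) /= /volA /volB.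
  rewrite !(natr_sum _ _ _ (deg e)) !mulr_suml; congr (_ + _).
    by apply: eq_bigr => i si; rewrite Fa.
  by apply: eq_bigr => i si; rewrite Fb.
have sf2 : \sum_i (deg e i)%:R * f i ^+ 2 = volA%:R * volB%:R * (volA%:R + volB%:R).
  rewrite (split_sum _ (volB%:R ^+ 2) (volA%:R ^+ 2)); first ring.
    by move=> i si; rewrite /f si.
  by move=> i /negPf si; rewrite /f si sqrrN.
have den : 0 < (nedges e)%:R - D%:R / 2 :> R by rewrite mR; lra.
have c0 : 0 <= c%:R :> R by rewrite ler0n.
apply: (@lambda1_le R n _ se dpos f).
- rewrite (split_sum _ volB%:R (- volA%:R)); first ring.
    by move=> i si; rewrite /f si.
  by move=> i /negPf si; rewrite /f si.
- by rewrite sf2 !mulr_gt0 ?addr_gt0.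
- by rewrite divr_ge0 ?mulr_ge0 // ltW.
have -> : \sum_i \sum_j (e i j)%:R * (f i - f j) ^+ 2 =
    cc%:R * (volA%:R + volB%:R) ^+ 2.
  rewrite /cc /cross_count natr_sum mulr_suml.
  rewrite (eq_bigl (fun p : 'I_n * 'I_n => true && e p.1 p.2)); last by move=> p; rewrite inE.
  rewrite -(pair_big_dep xpredT (fun i j => e i j)
    (fun i j => (cross side i j)%:R * (volA%:R + volB%:R : R) ^+ 2)) /=.
  apply: eq_bigr => i _; rewrite [RHS]big_mkcond; apply: eq_bigr => j _.
  case: (e i j); rewrite ?mul0r // mul1r /f /cross.
  case: (side i); case: (side j); rewrite /= ?mul0r ?mul1r ?subrr ?expr0n //=; ring.
rewrite sf2.
have prod : (nedges e)%:R * ((nedges e)%:R - D%:R / 2) <= volA%:R * volB%:R :> R.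
  rewrite mR; move: balR; set a : R := volA%:R; set b : R := volB%:R; set t : R := D%:R.
  by move: a b t => a b t; nra.
have ccR : cc%:R <= 2 * c%:R :> R by rewrite -natrM ler_nat.
apply: (@le_trans _ _ (2 * c%:R * (volA%:R + volB%:R) ^+ 2)).
  by rewrite ler_wpM2r // sqr_ge0.
have -> : 2 * (2 * c%:R / ((nedges e)%:R - D%:R / 2)) *
    (volA%:R * volB%:R * (volA%:R + volB%:R)) =
   (2 * c%:R * (volA%:R + volB%:R)) * (2 * (volA%:R * volB%:R) / ((nedges e)%:R - D%:R / 2)) :> R.
  by rewrite !mulrA; ring.
have -> : 2 * c%:R * (volA%:R + volB%:R) ^+ 2 =
   (2 * c%:R * (volA%:R + volB%:R)) * (2 * (nedges e)%:R) :> R.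
  by rewrite mR; field.
rewrite ler_wpM2l ?mulr_ge0 ?addr_ge0 ?ler0n //.
rewrite ler_pdivlMr // -mulrA ler_pM2l //; lra.
Qed.
End CutBound.

(** * Assembly *)

Local Close Scope ring_scope.

Section LowCut.
Variables (V : finType) (side : V -> bool) (dg : V -> nat) (D : nat).

(** [K] bounds the crossing edges before symmetrization, which may add one, and [L] counts spare
    vertices per side. The two numerical conditions answer the cases of several hubs and of a single
    hub in [cutAB_bound]. *)
Lemma low_cut_graph (P : {set 'I_D.+1}) (K L : nat) :
  let c := \sum_(x : 'I_D.+1 | x \notin P) x in
  (exists Z, realizes_digraph dg Z) -> ~~ odd (\sum_v dg v) ->
  (forall v, 2 <= dg v <= D) ->
  (forall (x : 'I_D.+1) s, x \in P -> exists2 v, side v = s & dg v = x) ->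
  (forall s, #|P| + D.+1 + L <= #|[set v | side v == s]|) ->
  c + D.+1 <= K + 2 * L -> c + 1 <= K + L ->
  exists2 Z, graph_of dg Z & cross_count side Z <= 2 * K.+1.
Proof.
move=> c exZ ev dgb reps sz K1 K2.
have [Z [w [rZ cin cout]]] := symmetric_potential side exZ.
have cZ : compatible side w Z by split.
have dg_le v : dg v <= D by have /andP [] := dgb v.
have dg_ge v : 2 <= dg v by have /andP [] := dgb v.
have [v0 _] : exists v0, v0 \in [set v | side v == true].
  by apply/card_gt0P; apply: leq_trans (sz true); rewrite addnAC addnS.
have rep s : exists a : 'I_D.+1 -> V, forall x, x \in P -> side (a x) = s /\ dg (a x) = x.
  exists (fun x : 'I_D.+1 => odflt v0 [pick v | (side v == s) && (dg v == x :> nat)]) => x xP.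
  case: pickP => [v /andP [/eqP sv /eqP dv]|none] //=.
  by have [v sv dv] := reps x s xP; have := none v; rewrite sv dv !eqxx.
have [a aP] := rep true; have [b bP] := rep false.
have H := @cutAB_bound V side dg w Z D rZ cZ dg_le dg_ge P a b L.
have cc := cross_count_cutAB side rZ.
have le2K : cross_count side Z <= 2 * K.
  have [||||h|h|h] := H.
  - by move=> x /aP [sx dx]; rewrite inE sx.
  - by move=> x /bP [sx dx]; rewrite inE sx.
  - by apply: leq_trans (sz true) _; rewrite /sideA; apply: subset_leq_card;
      apply/subsetP=> v; rewrite !inE => /eqP ->.
  - by apply: leq_trans (sz false) _; rewrite /sideB; apply: subset_leq_card;
      apply/subsetP=> v; rewrite !inE => /eqP ->.
  - by move: cc h; move: (cutAB side Z) (cross_count side Z); clear; lia.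
  - move: cc h K1; clear K2; rewrite -/c; move: (cutAB side Z) (cross_count side Z) c; clear; lia.
  - move: cc h K2; clear K1; rewrite -/c; move: (cutAB side Z) (cross_count side Z) c; clear; lia.
have [Z' [rZ' sZ' ccZ']] := symmetrize rZ cZ ev.
by exists Z' => //; apply: leq_trans ccZ' _; rewrite mulnS addnC leq_add2l.
Qed.

(** The volume of a side is the number of crossing edges plus twice the number of edges inside
    it. *)
Lemma cut_parity Z : graph_of dg Z ->
  exists2 X, cross_count side Z = 2 * X & odd X = odd (\sum_(v | side v) dg v).
Proof.
move=> [rZ sy]; have [Zo _ nl] := realizes_digraphP _ _ rZ.
have sw e : (swap e \in Z) = (e \in Z) by rewrite [e]surjective_pairing /swap /= graph_sym.
exists (\sum_(e in Z | side e.1 && ~~ side e.2) 1).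
  rewrite /cross_count (bigID (fun e => side e.1)) /= mul2n -addnn; congr (_ + _).
    rewrite [RHS]big_mkcond [LHS]big_mkcond; apply: eq_bigr => e _; rewrite /cross.
    by case: (e \in Z); case: (side e.1); case: (side e.2).
  rewrite (reindex_inj (inv_inj (@swapK V))) /=.
  rewrite [RHS]big_mkcond [LHS]big_mkcond; apply: eq_bigr => e _; rewrite /cross sw.
  by case: (e \in Z); case: (side e.1); case: (side e.2).
have -> : \sum_(v | side v) dg v = \sum_(e in Z | side e.1) 1.
  rewrite (eq_bigl (fun e : V * V => side e.1 && ((e.1, e.2) \in Z))); last first.
    by move=> [u v]; rewrite andbC.
  rewrite -(pair_big_dep side (fun u v => (u, v) \in Z) (fun u v => 1)) /=.
  by apply: eq_bigr => u _; rewrite -Zo /outn -sum1_card; apply: eq_bigl => v; rewrite inE.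
rewrite [in RHS](bigID (fun e => side e.2)) /= oddD.
rewrite [X in odd X (+) _](eq_bigl (mem [set e in Z | side e.1 && side e.2])) ?sum1_card; last first.
  by move=> e; rewrite /= !inE -?andbA.
rewrite (negPf (even_symmetric _ _)) /=; last first.
- apply/setP=> e; rewrite !inE sw /=; case: (e \in Z) => //=.
  by case: (side e.1); case: (side e.2).
- by move=> v; rewrite inE (negPf (nl v)).
by congr odd; apply: eq_card => e; rewrite unfold_in [RHS]unfold_in -andbA.
Qed.
End LowCut.

Lemma alternating_sum (s : seq nat) : sorted geq s ->
  \sum_(i < size s | odd i) nth 0 s i <= \sum_(i < size s | ~~ odd i) nth 0 s i
  <= \sum_(i < size s | odd i) nth 0 s i + head 0 s.
Proof.
elim: s => [|x s IHs] srt; first by rewrite !big_ord0.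
have srt' : sorted geq s by case: s srt {IHs} => //= y s /andP [].
have hx : head 0 s <= x by case: s srt {IHs srt'} => //= y s /andP [].
have shift (b : bool) : \sum_(i < size (x :: s) | odd i == b) nth 0 (x :: s) i =
    (if b then 0 else x) + \sum_(i < size s | odd i == ~~ b) nth 0 s i.
  rewrite big_mkcond big_ord_recl /= [in RHS]big_mkcond; congr (_ + _).
    by case: b.
  by apply: eq_bigr => i _; rewrite /bump /=; case: b; case: (odd i).
have sE (t : seq nat) : \sum_(i < size t | odd i) nth 0 t i = \sum_(i < size t | odd i == true) nth 0 t i.
  by apply: eq_bigl => i; rewrite eqb_id.
have sN (t : seq nat) : \sum_(i < size t | ~~ odd i) nth 0 t i = \sum_(i < size t | odd i == false) nth 0 t i.
  by apply: eq_bigl => i; rewrite eqbF_neg.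
have := IHs srt'; rewrite !sE !sN !shift /=.
move: (\sum_(i < size s | _) _) (\sum_(i < size s | _) _) hx => p q; clear; lia.
Qed.

Lemma count_card (d : seq nat) x :
  count_mem x d = #|[set i : 'I_(size d) | nth 0 d i == x]|.
Proof.
by rewrite -sum1_count (big_nth 0) big_mkord -sum1_card; apply: eq_bigl => i; rewrite inE.
Qed.

Lemma flip_sum (T : finType) (s s' : pred T) k (F : T -> nat) :
  (forall i, i != k -> s' i = s i) -> s k -> ~~ s' k ->
  \sum_(i | s i) F i = \sum_(i | s' i) F i + F k.
Proof.
move=> eqs sk nsk; rewrite (bigD1 k) //= addnC; congr (_ + _).
by apply: eq_bigl => i; case: (eqVneq i k) => [->|/eqs ->]; rewrite ?andbF ?andbT ?(negPf nsk).
Qed.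

Lemma card_parity n : \sum_(i < n | odd i) 1 = n./2 /\ \sum_(i < n | ~~ odd i) 1 = uphalf n.
Proof.
elim: n => [|n [IH1 IH2]]; first by rewrite !big_ord0.
rewrite big_mkcond big_ord_recr -big_mkcond /= IH1 big_mkcond big_ord_recr -big_mkcond /= IH2.
rewrite uphalf_half; case: (odd n) => /=; rewrite ?addn0; split=> //; lia.
Qed.

Lemma card_avoid (T : finType) (P U : {set T}) : P \subset ~: U -> #|P| + #|U| <= #|T|.
Proof. by move=> /subset_leq_card le; rewrite -(cardsC U) addnC leq_add2l. Qed.

(** * The halves of the sorted sequence and the cases of c *)

Section Main.
Variables (R : rcfType) (d : seq nat).
Hypotheses (gr : graphic d) (srt : sorted geq d) (big : 6 * head 0 d <= size d)
  (low : 2 <= last 0 d) (mult : forall x, x \in d -> 1 < count_mem x d).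
Local Notation n := (size d).
Local Notation D := (head 0 d).
Let dg (i : 'I_n) := nth 0 d i.
Let c := \sum_(1 <= k < D.+1 | k \notin d) k.
Let even_side (i : 'I_n) := ~~ odd i.
Let P : {set 'I_D.+1} := [set x : 'I_D.+1 | (x : nat) \in d].

Lemma n_gt0 : 0 < n.
Proof. by move: low; case: d. Qed.

Lemma nth_noninc i j : i <= j < n -> nth 0 d j <= nth 0 d i.
Proof.
move=> /andP [ij jn].
have tr : transitive geq by move=> a b e /= h1 h2; exact: leq_trans h2 h1.
by apply: (sorted_leq_nth tr leqnn 0 srt) => //; rewrite inE; lia.
Qed.

Lemma dg_bounds i : 2 <= dg i <= D.
Proof.
have n0 := n_gt0; have lt := ltn_ord i; apply/andP; split.
  by apply: leq_trans low _; rewrite -nth_last; apply: nth_noninc; lia.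
by rewrite -nth0; apply: nth_noninc.
Qed.

Lemma D_ge2 : 2 <= D.
Proof. by have /andP [h1 h2] := dg_bounds (Ordinal n_gt0); exact: leq_trans h2. Qed.

Lemma mem_ge2 x : x \in d -> 2 <= x <= D.
Proof. by case/(nthP 0) => i lt <-; exact: (dg_bounds (Ordinal lt)). Qed.

Lemma dg_even : ~~ odd (\sum_v dg v).
Proof.
case: gr => e [se [_ de]]; rewrite (eq_bigr (deg e)) => [|i _]; last by rewrite de.
by rewrite -nedges_deg // mul2n odd_double.
Qed.

Lemma dg_digraph : exists Z, realizes_digraph dg Z.
Proof.
case: gr => e [[sym irr] [_ de]]; exists [set p | e p.1 p.2].
apply/realizes_digraphP; split=> v; last by rewrite inE irr.
  by rewrite /dg -de; apply: eq_card => u; rewrite !inE.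
by rewrite /dg -de; apply: eq_card => u; rewrite !inE sym.
Qed.

(** Equal values are contiguous in a sorted sequence, so a repeated value occupies two successive
    positions, which have opposite parity. *)
Lemma both_sides x s : x \in d -> exists2 v, even_side v = s & dg v = x.
Proof.
move=> xd; have := mult xd; rewrite count_card => /card_gt1P [i [j []]].
rewrite !inE => /eqP di /eqP dj ij.
wlog lt : i j di dj ij / i < j.
  move=> H; have [lt|ge] := ltnP i j; first exact: (H i j).
  apply: (H j i) => //; first by rewrite eq_sym.
  by rewrite ltn_neqAle ge andbT eq_sym.
have lt' : i.+1 < n by exact: leq_ltn_trans (ltn_ord j).
have d1 : nth 0 d i.+1 = x.
  apply/eqP; rewrite eqn_leq; apply/andP; split; [rewrite -di|rewrite -dj].
    by apply: nth_noninc; rewrite leqnSn.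
  by apply: nth_noninc; rewrite lt ltn_ord.
case: (eqVneq (even_side i) s) => [<-|ne]; first by exists i.
by exists (Ordinal lt'); move: ne; rewrite /even_side //=; case: (odd i); case: s.
Qed.

Lemma card_sides s : 3 * D <= #|[set v | even_side v == s]|.
Proof.
have [h1 h2] := card_parity n.
have -> : #|[set v | even_side v == s]| = \sum_(i < n | even_side i == s) 1.
  by rewrite -sum1_card; apply: eq_bigl => i; rewrite inE.
have -> : \sum_(i < n | even_side i == s) 1 = if s then uphalf n else n./2.
  case: s; [rewrite -h2|rewrite -h1]; apply: eq_bigl => i; rewrite /even_side.
    by rewrite eqb_id.
  by rewrite eqbF_neg negbK.
by move: big; rewrite uphalf_half; case: s; move: D => m; lia.
Qed.

Lemma cE : c = \sum_(x : 'I_D.+1 | x \notin P) x.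
Proof.
rewrite (eq_bigl (fun x : 'I_D.+1 => (x : nat) \notin d)) => [|x]; last by rewrite inE.
rewrite -(big_mkord (fun k => k \notin d) id) big_ltn_cond //=.
by case: ifP.
Qed.

Lemma notin_P (x : 'I_D.+1) : x < 2 -> x \notin P.
Proof. by move=> x2; rewrite inE; apply/negP => /mem_ge2; lia. Qed.

Lemma c_pos : 0 < c.
Proof.
have D2 := D_ge2; have D1 : 1 < D.+1 by lia.
rewrite cE (bigD1 (Ordinal D1)) //; exact: (notin_P (x := Ordinal D1)).
Qed.

Lemma c_one : c = 1 -> forall x, 2 <= x <= D -> x \in d.
Proof.
move=> c1 x /andP [x2 xD]; apply: contraT => xd.
have D1 : 1 < D.+1 by lia.
have xD' : x < D.+1 by [].
move: c1; rewrite cE (bigD1 (Ordinal D1)) /=; last exact: (notin_P (x := Ordinal D1)).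
rewrite (bigD1 (Ordinal xD')) /=; first by lia.
by rewrite inE xd; apply/eqP => -[]; lia.
Qed.

Lemma volume_ge (side : 'I_n -> bool) :
  12 * D <= \sum_(i | side i) dg i + \sum_(i | ~~ side i) dg i.
Proof.
rewrite -(bigID side xpredT dg) /=.
apply: (@leq_trans (\sum_(i < n) 2)); first by rewrite sum_nat_const card_ord; lia.
by apply: leq_sum => i _; have /andP [] := dg_bounds i.
Qed.

Local Notation result := (exists e : rel 'I_n, realizes d e /\ connected_graph e /\
    (lambda1 R e <= (2 * c%:R) / ((nedges e)%:R - D%:R / 2))%R).

(** [t] is the tolerated difference of the volumes. The total volume is at least [12 * D], so the
    condition on [t] is the balance condition of [lambda1_cut]. *)
Lemma realization_of_cut side Z t : graph_of dg Z -> 0 < cross_count side Z <= 2 * c ->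
  (forall s, exists v, side v = s) ->
  \sum_(i | side i) dg i <= \sum_(i | ~~ side i) dg i + t ->
  \sum_(i | ~~ side i) dg i <= \sum_(i | side i) dg i + t ->
  t * t <= 12 * D * D -> result.
Proof.
move=> gZ /andP [cpos cle] nonempty tA tB tt.
have dg_ge v : 2 <= dg v by have /andP [] := dg_bounds v.
have [Z' [[rZ' sZ'] ccZ' conn]] := connect_cut dg_ge gZ cpos.
have [Zo Zi nl] := realizes_digraphP _ _ rZ'.
pose e : rel 'I_n := fun i j => (i, j) \in Z'.
have de i : deg e i = dg i by rewrite -Zo.
have se : simple_graph e.
  by split=> [i j|i]; rewrite /e; [exact: graph_sym|apply/negbTE].
exists e; split; first by [].
split; first exact: conn.
have dpos i : 0 < deg e i by rewrite de; exact: leq_trans (dg_ge i).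
have vA : \sum_(i | side i) deg e i = \sum_(i | side i) dg i by apply: eq_bigr.
have vB : \sum_(i | ~~ side i) deg e i = \sum_(i | ~~ side i) dg i by apply: eq_bigr.
have volp s : 0 < \sum_(i | side i == s) dg i.
  have [v sv] := nonempty s; rewrite (bigD1 v) /=; last by rewrite sv.
  by rewrite addn_gt0 (leq_trans _ (dg_ge v)).
have pA : 0 < \sum_(i | side i) dg i.
  by rewrite (eq_bigl (fun i => side i == true)) ?volp // => i; rewrite eqb_id.
have pB : 0 < \sum_(i | ~~ side i) dg i.
  by rewrite (eq_bigl (fun i => side i == false)) ?volp // => i; rewrite eqbF_neg.
have vge := volume_ge side; have D2 := D_ge2.
apply: (@lambda1_cut R n e side se dpos); rewrite ?vA ?vB //.
- rewrite (_ : [set p | e p.1 p.2] = Z') ?ccZ' //.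
  by apply/setP=> p; rewrite inE /e -surjective_pairing.
- by apply: leq_trans vge; lia.
move: tA tB tt vge; move: (\sum_(i | side i) dg i) (\sum_(i | ~~ side i) dg i) D => p q m.
clear => tA tB tt vge.
have h : (p - q) ^ 2 + (q - p) ^ 2 <= t * t.
  have [le|/ltnW le] := leqP q p.
    have -> : q - p = 0 by lia.
    by rewrite addn0 -mulnn leq_mul //; lia.
  have -> : p - q = 0 by lia.
  by rewrite add0n -mulnn leq_mul //; lia.
apply: leq_trans h (leq_trans tt _); by rewrite leq_mul2r vge orbT.
Qed.

Lemma base_volume :
  \sum_(i | ~~ even_side i) dg i <= \sum_(i | even_side i) dg i
    <= \sum_(i | ~~ even_side i) dg i + D.
Proof.
have := alternating_sum srt.
by rewrite (eq_bigl (fun i : 'I_n => ~~ even_side i)) // => i; rewrite /even_side negbK.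
Qed.

Lemma base_sides s : exists v, even_side v = s.
Proof.
have D2 := D_ge2; have : 0 < #|[set v | even_side v == s]|.
  by apply: leq_trans (card_sides s); lia.
by case/card_gt0P => v; rewrite inE => /eqP; exists v.
Qed.

Lemma card_P : #|P| + 2 <= D.+1.
Proof.
have D2 := D_ge2; have D1 : 1 < D.+1 by lia.
have : P \subset ~: [set ord0; Ordinal D1].
  apply/subsetP=> x xP; rewrite !inE negb_or; apply/andP; split.
    by apply: contraTneq xP => ->; exact: notin_P.
  by apply: contraTneq xP => ->; exact: notin_P.
by move/card_avoid; rewrite card_ord cards2.
Qed.

(** Each half has at least [3 * D] vertices and the degrees 0 and 1 are missing, so [L = D] spare
    vertices are available. With this [L] both conditions of [low_cut_graph] reduce to the
    hypothesis. *)
Lemma base_low_cut K : c + 1 <= K + D ->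
  exists2 Z, graph_of dg Z & cross_count even_side Z <= 2 * K.+1.
Proof.
move=> KD; apply: (@low_cut_graph _ even_side dg D P K D).
- exact: dg_digraph.
- exact: dg_even.
- exact: dg_bounds.
- by move=> x s; rewrite inE => /both_sides; apply.
- by move=> s; apply: leq_trans (card_sides s); have := card_P; clear; lia.
- by rewrite -cE; move: KD; clear; move: c D => a b; lia.
- by rewrite -cE.
Qed.

Lemma realization_c_ge2 : 2 <= c -> result.
Proof.
move=> c2; have D2 := D_ge2; have /andP [vB vA] := base_volume.
have fin Z : graph_of dg Z -> 0 < cross_count even_side Z <= 2 * c -> result.
  move=> gZ cc; apply: (realization_of_cut gZ cc base_sides (t := D)) => //.
    by apply: leq_trans vB (leq_addr _ _).
  by rewrite -mulnA leq_pmull.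
(* [K = c - 1] leaves room for the edge added by symmetrization. *)
have [Z gZ ccZ] := @base_low_cut (c - 1) ltac:(by lia).
have [cc0|] := posnP (cross_count even_side Z); last first.
  by move=> pos; apply: (fin Z) => //; rewrite pos (leq_trans ccZ) //; lia.
have [a sa] := base_sides true; have [b sb] := base_sides false.
have dg_ge v : 2 <= dg v by have /andP [] := dg_bounds v.
have [Z' [gZ' cc4]] := @cut_two _ even_side dg dg_ge Z a b gZ cc0 sa (negbT sb).
by apply: (fin Z') => //; rewrite cc4; lia.
Qed.

(** At most two edges cross, and their number is odd like the volume, so it is 1. *)
Lemma realization_odd_volume side Z t : c = 1 -> graph_of dg Z -> cross_count side Z <= 4 ->
  odd (\sum_(i | side i) dg i) -> (forall s, exists v, side v = s) ->
  \sum_(i | side i) dg i <= \sum_(i | ~~ side i) dg i + t ->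
  \sum_(i | ~~ side i) dg i <= \sum_(i | side i) dg i + t ->
  t * t <= 12 * D * D -> result.
Proof.
move=> c1 gZ le4 oddA nonempty tA tB tt.
have [X ccX oX] := cut_parity side gZ.
have X1 : X = 1.
  have X2 : X <= 2 by move: le4; rewrite ccX; clear; lia.
  by move: oX; rewrite oddA; case: X {ccX} X2 => [|[|[|]]].
by apply: (realization_of_cut gZ _ nonempty tA tB tt); rewrite ccX X1 c1.
Qed.

(** Moving the vertex [k] of degree 3 to the other half makes the volume odd. [Q] must consist of
    degrees that are represented in both halves without [k], and a half may shrink by one vertex.
    [K <= 1] is affordable because parity tolerates a bound of two crossing edges. *)
Lemma realization_flipped (k : 'I_n) (Q : {set 'I_D.+1}) K L : c = 1 -> 3 <= D -> dg k = 3 ->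
  ~~ odd (\sum_(i | even_side i) dg i) ->
  (forall (x : 'I_D.+1) s, x \in Q -> exists v, [/\ v != k, even_side v = s & dg v = x]) ->
  #|Q| + D.+1 + L <= 3 * D - 1 -> K <= 1 ->
  \sum_(x : 'I_D.+1 | x \notin Q) x + D.+1 <= K + 2 * L ->
  \sum_(x : 'I_D.+1 | x \notin Q) x + 1 <= K + L -> result.
Proof.
move=> c1 D3 dk ev reps szQ K1 h1 h2.
pose side i := if i == k then ~~ even_side i else even_side i.
have sidek : side k = ~~ even_side k by rewrite /side eqxx.
have siden i : i != k -> side i = even_side i by rewrite /side => /negPf ->.
have cards s : 3 * D - 1 <= #|[set v | side v == s]|.
  apply: leq_trans (leq_sub2r 1 (card_sides s)) _; rewrite leq_subLR.
  apply: (@leq_trans #|k |: [set v | side v == s]|); last first.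
    by rewrite cardsU1 leq_add2r; case: (_ \notin _).
  apply: subset_leq_card; apply/subsetP=> v; rewrite !inE.
  by case: (eqVneq v k) => //= /siden ->.
have [Z gZ ccZ] : exists2 Z, graph_of dg Z & cross_count side Z <= 2 * K.+1.
  apply: (@low_cut_graph _ side dg D Q K L) => //.
  - exact: dg_digraph.
  - exact: dg_even.
  - exact: dg_bounds.
  - by move=> x s /(reps x s) [v [vk <- dv]]; exists v => //; rewrite siden.
  - by move=> s; apply: leq_trans szQ (cards s).
have nonempty s : exists v, side v = s.
  have : 0 < #|[set v | side v == s]| by apply: leq_trans (cards s); lia.
  by case/card_gt0P => v; rewrite inE => /eqP; exists v.
have /andP [vB vA] := base_volume.
have fA : if even_side k then
    \sum_(i | even_side i) dg i = \sum_(i | side i) dg i + 3 /\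
    \sum_(i | ~~ side i) dg i = \sum_(i | ~~ even_side i) dg i + 3 else
    \sum_(i | side i) dg i = \sum_(i | even_side i) dg i + 3 /\
    \sum_(i | ~~ even_side i) dg i = \sum_(i | ~~ side i) dg i + 3.
  rewrite -dk; case: ifP => ek; split; apply: flip_sum;
    rewrite ?sidek ?ek // => i ik; by rewrite siden.
move: fA; set A0 := \sum_(i | even_side i) dg i in vA vB ev *.
set B0 := \sum_(i | ~~ even_side i) dg i in vA vB *.
set A1 := \sum_(i | side i) dg i; set B1 := \sum_(i | ~~ side i) dg i => fA.
(* The move shifts the volume difference by 6, and the tolerance [D + 6] is admissible from [D = 3]
   on. *)
apply: (@realization_odd_volume side Z (D + 6)) => //; rewrite -/A1 -/B1.
- by apply: leq_trans ccZ _; move: K1; clear; lia.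
- case: ifP fA => _ [eA _]; last by rewrite eA oddD (negPf ev).
  by move: ev; rewrite eA oddD; case: (odd A1).
- move: vA vB fA; clearbody A0 B0 A1 B1; clear; case: ifP => _ vA vB [eA eB]; lia.
- move: vA vB fA; clearbody A0 B0 A1 B1; clear; case: ifP => _ vA vB [eA eB]; lia.
- move: D3; clear; move: D => m; nia.
Qed.

Lemma realization_c_eq1 : c = 1 -> 3 <= D -> result.
Proof.
move=> c1 D3; have /andP [vB vA] := base_volume.
have D2 := D_ge2.
have [oA|eA] := boolP (odd (\sum_(i | even_side i) dg i)).
  have [Z gZ ccZ] := @base_low_cut 0 ltac:(by rewrite c1; lia).
  apply: (@realization_odd_volume even_side Z D) => //.
  - by apply: leq_trans ccZ _.
  - exact: base_sides.
  - by apply: leq_trans vB (leq_addr _ _).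
  - by rewrite -mulnA leq_pmull.
have d3 : 3 \in d by apply: c_one => //; rewrite D3.
have sumP : \sum_(x : 'I_D.+1 | x \notin P) x = 1 by rewrite -cE.
(* If the half of [k] has another vertex of degree 3, all degrees stay represented; only a spare
   vertex is lost, and [K = 1] pays for it. *)
have regular k : dg k = 3 ->
    (exists k1, [/\ k1 != k, even_side k1 = even_side k & dg k1 = 3]) -> result.
  move=> dk [k1 [k1k ek1 dk1]].
  apply: (@realization_flipped k P 1 (D - 1)) => //; rewrite ?sumP.
  - move=> x s; rewrite inE => /(both_sides s) [v ev dv].
    case: (eqVneq v k) => [e|vk]; last by exists v.
    by exists k1; rewrite k1k ek1 dk1 -ev e -dv e dk.
  - by have := card_P; lia.
  - by lia.
  - by lia.
have [kA sA dA] := both_sides true d3.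
have [kB sB dB] := both_sides false d3.
have [/existsP [k1 /and3P [h1 h2 /eqP h3]]|nA] := boolP [exists k1,
    [&& k1 != kA, even_side k1 & dg k1 == 3]].
  by apply: (regular kA dA); exists k1; rewrite h1 h2 sA h3.
have uniqA i : even_side i -> dg i = 3 -> i = kA.
  move=> ei di; apply: contraNeq nA => ik; apply/existsP; exists i.
  by rewrite ik ei di.
(* For [D = 3] the half of [kA] would consist of one vertex of degree 3 and vertices of degree 2, so
   its volume would be odd. *)
have D4 : 4 <= D.
  rewrite ltn_neqAle D3 andbT; apply: contraNneq eA => e3.
  rewrite (bigD1 kA) //= dA oddD /=.
  rewrite (eq_bigr (fun=> 2)) ?sum_nat_const ?oddM ?andbF // => i /andP [ei ik].
  have := dg_bounds i; rewrite -e3 => /andP [l2 l3].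
  have : dg i != 3 by apply: contra ik => /eqP /(uniqA i ei) ->.
  by move: l2 l3; case: (dg i) => [|[|[|[|]]]].
have D3' : 3 < D.+1 by lia.
pose x3 := Ordinal D3'.
have x3P : x3 \in P by rewrite inE.
have sumQ : \sum_(x : 'I_D.+1 | x \notin P :\ x3) x = 4.
  rewrite (bigD1 x3) /=; last by rewrite !inE eqxx.
  rewrite (eq_bigl (fun x => x \notin P)) ?sumP // => x; rewrite !inE negb_and negbK.
  case: (eqVneq x x3) => [->|] /=; last by rewrite andbT.
  by rewrite d3.
have cardQ : #|P :\ x3| + 3 <= D.+1.
  by have := card_P; rewrite (cardsD1 x3 P) x3P; move: #|_|; clear; lia.
(* Degree 3 disappears from the half of [kA] and counts as missing, which raises the missing sum
   from 1 to 4 but frees a representative, so [L = D] is kept. [5 - D] is 1 for [D = 4] and 0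
   beyond. *)
apply: (@realization_flipped kA (P :\ x3) (5 - D) D) => //; rewrite ?sumQ.
- move=> x s; rewrite !inE => /andP [xx3 /(both_sides s) [v ev dv]].
  exists v; split=> //; apply: contra xx3 => /eqP vk; apply/eqP/val_inj.
  by rewrite /= -dv vk.
- by lia.
- by lia.
- by lia.
- by lia.
Qed.

(** Here every volume is even, so a connected realization has at least two edges across any cut,
    whereas c = 1; a cut indicator cannot give the bound. *)
Lemma realization_dmax2 : D = 2 -> result.
Proof.
move=> D2; have n12 : 12 <= n by move: big; rewrite D2.
have dg2 i : dg i = 2 by have := dg_bounds i; rewrite D2; lia.
have c1 : c = 1.
  rewrite /c D2 big_ltn_cond // big_ltn_cond // big_geq //.
  have -> : 1 \notin d by apply/negP => /mem_ge2.
  have -> // : (2 \notin d) = false.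
  by apply/negbF; rewrite -(dg2 (Ordinal n_gt0)) mem_nth.
exists (cycle_rel (n := n)); split.
  split; first exact: cycle_simple.
  by split=> // i; rewrite cycle_deg //; exact: esym (dg2 i).
split; first exact: cycle_connected.
have e2 : nedges (cycle_rel (n := n)) = n.
  have := nedges_deg (cycle_simple n12).
  rewrite (eq_bigr (fun=> 2)) => [|i _]; last by rewrite cycle_deg.
  by rewrite sum_nat_const card_ord; lia.
by rewrite e2 c1 D2 mulr1 divff ?pnatr_eq0 //; exact: cycle_lambda1.
Qed.

Lemma low_lambda1_realization : result.
Proof.
have D2 := D_ge2; have cp := c_pos.
have [c2|c2] := leqP 2 c; first exact: realization_c_ge2.
have c1 : c = 1 by apply/eqP; rewrite eqn_leq cp andbT.
have [D3|D3] := leqP 3 D; first exact: realization_c_eq1.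
by apply: realization_dmax2; apply/eqP; rewrite eqn_leq D2 andbT.
Qed.
End Main.

Unset Implicit Arguments.
Local Open Scope ring_scope.

Theorem theorem4 (R : realType) (d : seq nat) :
  graphic d ->
  sorted geq d ->
  (6 * head 0 d <= size d)%N ->
  (2 <= last 0 d)%N ->
  (forall x, x \in d -> (1 < count_mem x d)%N) ->
  let n := size d in
  let dmax := head 0%N d in
  let c := (\sum_(1 <= k < dmax.+1 | k \notin d) k)%N in
  exists e : rel 'I_n,
    realizes d e /\ connected_graph e /\
    lambda1 R e <= (2 * c%:R) / ((nedges e)%:R - dmax%:R / 2).
Proof.
move=> gr srt big low mult n dmax c.
exact: (@low_lambda1_realization R d gr srt big low mult).
Qed.
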